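(* Let $b$ be a prime, $s,m\in\mathbb N$, $R\in\mathbb N$ odd, $p\in(1,2)$, $\delta\in(0,1/8)$, $\beta>0$, and let $\mathcal S$ be an $s$-dimensional generalized Niederreiter sequence in base $b$ that is $(\log n)^{1+\beta}$-reduced. Let $\mathcal M_{m,R,\mathcal S}(f)$ be the median of $R$ independent coarsely scrambled estimates, each based on the first $b^m$ points of $\mathcal S$. Then for every $f\in L^p((0,1)^s)$, $$\mathbb P\left\{\left|\mathcal M_{m,R,\mathcal S}(f)-I(f)\right|>\left(\delta+\sqrt{C_\beta}\right)\delta^{-1/p}\,\|f\|_{L^p}\,b^{-m(1-1/p)}\right\}\le\frac12(8\delta)^{\frac{R+1}{2}},$$ where $C_\beta=\exp\left(2+\frac{1}{2(\log 2)^{1+\beta}}+\frac{1}{\beta(\log 2)^\beta}\right)$.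
   Context: Functions are real valued on $(0,1)^s$; $I(f)=\int_{(0,1)^s}f(\boldsymbol x)\,d\boldsymbol x$. $\log$ is the natural logarithm. The field $\mathbb F_b$ is identified with $\{0,\dots,b-1\}$ with arithmetic modulo $b$. Generalized Niederreiter sequence (GNS): let $p_1,\dots,p_s\in\mathbb F_b[x]$ be monic pairwise coprime polynomials (the base polynomials), $e_j=\deg p_j$. For $1\le j\le s$ and $k\in\mathbb N$ put $k_j=\lfloor (k-1)/e_j\rfloor$, and let $y_k^{(j)}\in\mathbb F_b[x]$ be such that, for each $t\ge1$, the residues $y_k^{(j)}\bmod p_j$ for $(t-1)e_j\le k-1<te_j$ are linearly independent over $\mathbb F_b$. Expand $y_k^{(j)}(x)/p_j(x)^t=\sum_{r\ge1}a^{(j)}(t,k,r)x^{-r}$ in $\mathbb F_b((x^{-1}))$. The GNS $\mathcal S$ is the digital sequence with generating matrices $C_j=(c^{(j)}_{k,r})_{k,r\in\mathbb N}$, $c^{(j)}_{k,r}=a^{(j)}(k_j+1,k,r)$: for $n\in\mathbb N_0$ with base-$b$ digits $n=\eta_0+\eta_1b+\cdots$ and $\vec n=(\eta_0,\eta_1,\dots)^\top$, the $n$-th point has $j$-th coordinate $\phi_b(C_j\vec n)$, where $\phi_b(\vec z)=\sum_{r\ge1}z_rb^{-r}$ for $\vec z\in\mathbb F_b^{\mathbb N}$. Reduced GNS: for a positive sequence $a(n)$, $n\ge2$, a GNS is $a(n)$-reduced if its base polynomials are irreducible and, for each degree $n\ge2$, at most $\lfloor (b^n-1)/(n\,a(n))\rfloor$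 monic irreducible polynomials of degree $n$ are used as base polynomials. Coarse scrambling: let $D_j\in\mathbb F_b^{\mathbb N}$ and $M_j\in\mathbb F_b^{\mathbb N\times\mathbb N}$, $j=1,\dots,s$, be independent; $D_j$ has i.i.d. uniform entries; $M_j$ is block lower triangular with $e_j\times e_j$ blocks, its diagonal blocks uniform on $\mathrm{GL}(e_j,\mathbb F_b)$ and its blocks below the diagonal uniform on $\mathbb F_b^{e_j\times e_j}$, all blocks independent. The scrambled points are $\widetilde{\boldsymbol x}_n=(\phi_b(M_1C_1\vec n+D_1),\dots,\phi_b(M_sC_s\vec n+D_s))$. The estimator is $\mathcal I_{m,\mathcal S}(f)=b^{-m}\sum_{n=0}^{b^m-1}f(\widetilde{\boldsymbol x}_n)$, and $\mathcal M_{m,R,\mathcal S}(f)$ is the median of $R$ independent realizations of $\mathcal I_{m,\mathcal S}(f)$. *)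

(* Defs.v *)
From HB Require Import structures.
From mathcomp Require Import all_boot all_order all_algebra.
From mathcomp Require Import all_classical all_reals all_analysis.

Set Implicit Arguments.
Unset Strict Implicit.
Unset Printing Implicit Defensive.
Import Order.TTheory GRing.Theory Num.Theory.
Import numFieldNormedType.Exports.

Local Open Scope classical_set_scope.
Local Open Scope ring_scope.

Section cons_measure.
Context d (T : measurableType d) (R : realType) (n : nat).
Variables (m1 : {sigma_finite_measure set T -> \bar R})
  (m2 : {sigma_finite_measure set (n.-tuple T) -> \bar R}).

Definition tcons (x : T * n.-tuple T) : n.+1.-tuple T := [tuple of x.1 :: x.2].

Lemma measurable_tcons : measurable_fun setT tcons.
Proof. exact: (measurable_cons measurable_fst measurable_snd). Qed.

Definition cons_measure : set (n.+1.-tuple T) -> \bar R :=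
  pushforward (m1 \x m2)%E tcons.

Let cons_measure0 : cons_measure set0 = 0%E.
Proof. by rewrite /cons_measure /pushforward preimage_set0 measure0. Qed.

Let cons_measure_ge0 A : (0 <= cons_measure A)%E.
Proof. exact: (measure_ge0 (m1 \x m2)%E). Qed.

Let cons_measure_sigma_additive : semi_sigma_additive cons_measure.
Proof.
move=> F mF tF mUF; rewrite /cons_measure /pushforward preimage_bigcup.
apply: measure_semi_sigma_additive.
- by move=> i; rewrite -[X in measurable X]setTI; exact: measurable_tcons.
- apply/trivIsetP => /= i j _ _ ij; rewrite -preimage_setI.
  by move/trivIsetP : tF => /(_ _ _ _ _ ij) ->//; rewrite preimage_set0.
- by rewrite -preimage_bigcup -[X in measurable X]setTI;
    exact: measurable_tcons.
Qed.

HB.instance Definition _ := isMeasure.Build _ _ _ cons_measure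
  cons_measure0 cons_measure_ge0 cons_measure_sigma_additive.

(** The library's sigma-finite instance for [\x] is shadowed by its instance for
    products of subprobability measures, hence the direct proof. *)
Let cons_measure_sigma_finite : sigma_finite setT cons_measure.
Proof.
pose g (x : n.+1.-tuple T) : T * n.-tuple T := (thead x, [tuple of behead x]).
have mg : measurable_fun setT g.
  apply/measurable_fun_pairP; split.
    exact: measurable_tnth.
  exact: measurable_behead.
have gK x : g (tcons x) = x.
  by case: x => a t; congr pair; apply/val_inj.
have /sigma_finiteP[F [TF ndF Foo]] := sigma_finiteT m1.
have /sigma_finiteP[G [TG ndG Goo]] := sigma_finiteT m2.
exists (fun i => g @^-1` (F i `*` G i)).
  rewrite -preimage_bigcup -(_ : setT = \bigcup_i (F i `*` G i)).
    by rewrite preimage_setT.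
  rewrite -setXTT TF TG predeqE => -[x y]; split.
    move=> [/= [i _ Fix] [k _ Gky]]; exists (maxn i k) => //; split.
    - by move: x Fix; exact/subsetPset/ndF/leq_maxl.
    - by move: y Gky; exact/subsetPset/ndG/leq_maxr.
  by move=> [i _ []/= ? ?]; split; exists i.
move=> i; have [mF Fi] := Foo i; have [mG Gi] := Goo i; split.
  by rewrite -[X in measurable X]setTI; apply: mg => //; exact: measurableX.
rewrite /cons_measure /pushforward -comp_preimage.
rewrite (_ : g \o tcons = id) ?preimage_id; last by apply/funext => x /=.
by rewrite product_measure1E// lte_mul_pinfty// ge0_fin_numE.
Qed.

HB.instance Definition _ := Measure_isSigmaFinite.Build _ _ _ cons_measure
  cons_measure_sigma_finite.

End cons_measure.

Fixpoint power_measure d (T : measurableType d) (R : realType)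
    (mu : {sigma_finite_measure set T -> \bar R}) (n : nat) :
    {sigma_finite_measure set (n.-tuple T) -> \bar R} :=
  if n is n'.+1 then cons_measure mu (power_measure mu n')
  else dirac [tuple].

Definition lebesgue_tuple (R : realType) (n : nat) :=
  power_measure (@lebesgue_measure R) n.

Definition open_cube (R : realType) (n : nat) :
    set (n.-tuple (measurableTypeR R)) :=
  [set x | forall i, 0 < (tnth x i : R) < 1].
Arguments open_cube : clear implicits.

(** A function on the open unit cube is represented by its extension by zero.
    The scrambled points lie outside of the open cube with probability zero. *)
Definition cube_fun (R : realType) (n : nat)
    (f : n.-tuple (measurableTypeR R) -> R) :
    n.-tuple (measurableTypeR R) -> R :=
  f \_ (open_cube R n).

Definition Lp_cube (R : realType) (n : nat) (p : R)
    (f : n.-tuple (measurableTypeR R) -> R) : Prop :=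
  cube_fun f \in Lfun (lebesgue_tuple R n) p%:E.

Definition norm_cube (R : realType) (n : nat) (p : R)
    (f : n.-tuple (measurableTypeR R) -> R) : R :=
  fine (Lnorm (lebesgue_tuple R n) p%:E (EFin \o cube_fun f)).

Definition integral_cube (R : realType) (n : nat)
    (f : n.-tuple (measurableTypeR R) -> R) : R :=
  \int[lebesgue_tuple R n]_(x in open_cube R n) f x.

(** [a n] is the coefficient of [x^n] in the expansion of [f / g] in the field
    F((x^-1)) of formal Laurent series: [a] has only finitely many nonzero
    coefficients at positive exponents, and [g] times the series is [f]. *)
Definition laurent_expansion (F : fieldType) (f g : {poly F}) (a : int -> F) :
    Prop :=
  (exists N : int, forall n, N < n -> a n = 0) /\
  (forall n : int,
    \sum_(i < size g) g`_i * a (n - i%:Z) = if n is Posz k then f`_k else 0).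

(** All indices [k] and [r] are shifted by one: [gns_y S j k] is $y_{k+1}$,
    and [gns_C S j k r] is the entry $c_{k+1,r+1}$, read off from the
    coefficient of $x^{-(r+1)}$ in $y_{k+1}/p^{\lfloor k/e\rfloor+1}$. *)
Record GNS (b s : nat) := {
  gns_base : 'I_s -> {poly 'F_b};
  gns_y : 'I_s -> nat -> {poly 'F_b};
  gns_C : 'I_s -> nat -> nat -> 'F_b;
  gns_deg := fun j => (size (gns_base j)).-1;
  gns_base_monic : forall j, gns_base j \is monic;
  gns_deg_gt0 : forall j, (0 < gns_deg j)%N;
  gns_base_coprime : forall i j, i != j -> coprimep (gns_base i) (gns_base j);
  gns_y_free : forall j t (c : 'I_(gns_deg j) -> 'F_b),
    \sum_(i < gns_deg j)
      c i *: (gns_y j (t * gns_deg j + i)%N %% gns_base j) = 0 ->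
    forall i, c i = 0;
  gns_C_laurent : forall j k, exists2 a : int -> 'F_b,
    laurent_expansion (gns_y j k) (gns_base j ^+ (k %/ gns_deg j).+1%N) a &
    forall r, gns_C j k r = a (- r.+1%:Z)
}.

(** Pairwise coprime nonconstant polynomials are distinct, so that counting
    coordinates amounts to counting base polynomials. *)
Definition reduced (R : realType) (b s : nat) (a : nat -> R) (S : GNS b s) :
    Prop :=
  (forall j, irreducible_poly (gns_base S j)) /\
  (forall n, (2 <= n)%N ->
    #|[set j | gns_deg S j == n]%SET|%:Z <=
      Num.floor ((b%:R ^+ n - 1) / (n%:R * a n))).

Definition bdigit (b n i : nat) : 'F_b := ((n %/ b ^ i) %% b)%N%:R.

(** The product of a generating matrix with the digit vector of [n]; the digits
    of [n] of index at least [n] vanish. *)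
Definition digit_mulv (b : nat) (C : nat -> nat -> 'F_b) (n k : nat) : 'F_b :=
  \sum_(r < n) C k r * bdigit b n r.

Definition phi (R : realType) (b : nat) (z : nat -> 'F_b) : R :=
  limn (series (fun r => (nat_of_ord (z r))%:R / b%:R ^+ r.+1 : R)).

Section independence.
Context d (Om : measurableType d) (R : realType) (P : probability Om R).

(** [T] carries the discrete sigma-algebra; only used with [T] finite. *)
Definition sigma_of (T : Type) (X : Om -> T) : set (set Om) :=
  [set X @^-1` B | B in [set: set T]].

Definition sigma_of_family (I T : Type) (X : I -> Om -> T) : set (set Om) :=
  <<s \bigcup_i sigma_of (X i) >>.

Definition mutually_independent (I : eqType) (G : I -> set (set Om)) : Prop :=
  forall (J : seq I) (A : I -> set Om), uniq J ->
    (forall i, i \in J -> G i (A i)) ->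
    P (\big[setI/setT]_(i <- J) A i) = (\prod_(i <- J) P (A i))%E.

Definition uniform_on (T : finType) (A : {set T}) (X : Om -> T) : Prop :=
  forall v, measurable (X @^-1` [set v]) /\
    P (X @^-1` [set v]) = ((v \in A)%:R / #|A|%:R)%:E.

End independence.

Definition mat_block (T : Type) (e : nat) (M : nat -> nat -> T) (a c : nat) :
    'M[T]_e :=
  \matrix_(i, l) M (a * e + i)%N (c * e + l)%N.

Section scrambling.
Context d (Om : measurableType d) (R : realType) (P : probability Om R).
Variables (b s : nat).
Implicit Types (S : GNS b s) (D : 'I_s -> nat -> Om -> 'F_b)
  (M : 'I_s -> nat -> nat -> Om -> 'F_b).

Definition sigma_shift D (j : 'I_s) := sigma_of_family (D j).

Definition sigma_matrix M (j : 'I_s) :=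
  sigma_of_family (fun kl : nat * nat => M j kl.1 kl.2).

Definition rblock (e : 'I_s -> nat) M j (a c : nat) (w : Om) :
    'M['F_b]_(e j) :=
  mat_block (e j) (fun k l => M j k l w) a c.

Record coarse_scrambling (e : 'I_s -> nat) D M : Prop := {
  shift_uniform : forall j k, uniform_on P [set: 'F_b]%SET (D j k);
  shift_indep : forall j, mutually_independent P (fun k => sigma_of (D j k));
  matrix_lower : forall j k l w, (k %/ e j < l %/ e j)%N -> M j k l w = 0;
  matrix_diag : forall j a,
    uniform_on P [set G : 'M['F_b]_(e j) | G \in unitmx]%SET (rblock e M j a a);
  matrix_below : forall j a c, (c < a)%N ->
    uniform_on P [set: 'M['F_b]_(e j)]%SET (rblock e M j a c);
  matrix_indep : forall j, mutually_independent P
    (fun ac : nat * nat => sigma_of (rblock e M j ac.1 ac.2));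
  shift_matrix_indep : mutually_independent P
    (fun i : 'I_s + 'I_s => match i with
      | inl j => sigma_shift D j
      | inr j => sigma_matrix M j
      end)
}.

Definition sigma_scrambling D M : set (set Om) :=
  <<s \bigcup_j (sigma_shift D j `|` sigma_matrix M j) >>.

(** The rows of a block lower triangular matrix with blocks of size [e] are
    finite: row [k] is supported on the columns [l < (k %/ e).+1 * e]. *)
Definition lower_mulv (e : nat) (M : nat -> nat -> 'F_b) (v : nat -> 'F_b)
    (k : nat) : 'F_b :=
  \sum_(l < ((k %/ e).+1 * e)%N) M k l * v l.

Definition scrambled_point S D M (n : nat) (w : Om) :
    s.-tuple (measurableTypeR R) :=
  [tuple phi R (fun k =>
     lower_mulv (gns_deg S j) (fun k l => M j k l w)
       (digit_mulv (gns_C S j) n) k + D j k w) | j < s].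

Definition estimator S D M (m : nat)
    (f : s.-tuple (measurableTypeR R) -> R) (w : Om) : R :=
  (b%:R ^+ m)^-1 *
    \sum_(0 <= n < (b ^ m)%N) cube_fun f (scrambled_point S D M n w).

End scrambling.

(** The median of an odd number of values. *)
Definition median (R : realType) (xs : seq R) : R :=
  nth 0 (sort <=%R xs) (size xs)./2.

Definition median_estimator d (Om : measurableType d) (R : realType)
    (b s N : nat) (S : GNS b s) (D : 'I_N -> 'I_s -> nat -> Om -> 'F_b)
    (M : 'I_N -> 'I_s -> nat -> nat -> Om -> 'F_b) (m : nat)
    (f : s.-tuple (measurableTypeR R) -> R) (w : Om) : R :=
  median [seq estimator S (D r) (M r) m f w | r <- enum 'I_N].

Definition C_const (R : realType) (beta : R) : R :=
  expR (2 + 1 / (2 * ln 2 `^ (1 + beta)) + 1 / (beta * ln 2 `^ beta)).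

(* Main.v *)
Require Import Defs.
From mathcomp Require Import all_boot all_order all_algebra.
From mathcomp Require Import all_classical all_reals all_analysis.
From mathcomp Require Import measurable_realfun.
From mathcomp Require Import ring lra zify.

(** Every scrambled point is uniform on the cube ([scrambled_point_law]), which
    lets an unbounded integrand be replaced by a truncated one. At the level
    [t = ||f|| (b^m / delta)^(1/p)] Markov's inequality for [|f|^p] bounds by
    [delta / b^m] the probability that a given point exceeds the level
    ([pr_exceed_le]); hence with probability at least [1 - delta] the estimator
    sees only [g = f 1{|f| <= t}] at its [b^m] points. The integral of [g] is
    within [delta t / b^m] of that of [f], and [E g^2 <= delta t^2 / b^m]
    ([truncation_bias], [truncation_second_moment]). Writing [C] for
    [C_const beta], the average of [g] over the net has variance at most
    [C E g^2 / b^m], so by Chebyshev it is farther than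
    [sqrt C t / b^m] from its mean with probability at most [delta]. As
    [t / b^m] is [delta^(-1/p) ||f|| b^(-m(1-1/p))], a single estimate misses
    the announced accuracy with probability at most [2 delta]
    ([single_estimate]). The median of [N = 2k - 1] estimates misses it only if
    [k] of them do ([median_dist_count]); by independence and a union bound over
    sets of indices this has probability at most
    [2^N (2 delta)^k = (8 delta)^k / 2] ([majority_pr_le]).

    The variance bound is Fourier analysis on the leading digits, a vector space
    over F_b. The digits of the points of the net run through a random linear
    subspace, translated by an independent uniform shift. Averaging over the
    shift, the second moment of the average of [h] becomes the sum of the
    energies of [h] at the frequencies orthogonal to the subspace
    ([coset_average_energy]): the frequency zero contributes the squared mean,
    all the others together have energy at most [E h^2] by Parseval's identity
    ([sum_line_energy]), and each of them is orthogonal to the subspace with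
    probability at most [C / b^m] ([pr_col_orth_le]). Summing the characters
    along lines keeps everything real.

    To bound this probability, let [tau_j] be the number of blocks of the [j]-th
    component of a frequency up to its last nonzero one, and
    [n = \sum_j tau_j e_j]. Multiplied by the random matrix [M_j], that
    component becomes a row supported on the first [tau_j] blocks, uniform among
    those with nonzero last block ([pr_row_image_le]); this accounts for the
    factor [b^e_j / (b^e_j - 1)]. The rows annihilating the first [m] columns of
    the generating matrices number at most [b^(n-m)] if [m < n], and none has
    nonzero last blocks if [n <= m], because the first [n] columns determine the
    row ([gns_count]): a combination of rows is the expansion of a fraction with
    denominator [Q = \prod_j p_j^tau_j] of degree [n]; when its first [n]
    coefficients vanish the fraction is a polynomial, and coprimality and the
    independence of the residues of the [y_k] force the combination to be
    trivial ([gns_rank]). The product of the factors over [j] is at most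
    [C] since few base polynomials have a given degree
    ([gns_constant_le]).

    Finally the second moment bound passes from functions of finitely many
    digits to bounded measurable functions because the former approximate the
    latter in the mean, simultaneously at all points of the net
    ([L1_digit_approximation], [net_average_second_moment]). *)

Set Implicit Arguments.
Unset Strict Implicit.
Unset Printing Implicit Defensive.
Import Order.TTheory GRing.Theory Num.Theory.
Import numFieldNormedType.Exports.
Local Open Scope classical_set_scope.
Local Open Scope ring_scope.

(** * Laurent series and the rank of generating matrices *)

Section LaurentAction.
Variable F : fieldType.
Implicit Types (f g h : {poly F}) (a : int -> F).

(** A Laurent series in [x^-1] is given by its coefficients [a n] at [x^n]; this
    is the coefficient of the product of such a series with a polynomial. *)
Definition poly_act g a (n : int) : F := \sum_(i < size g) g`_i * a (n - i%:Z).

Definition poly_seq f (n : int) : F := if n is Posz k then f`_k else 0.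

Lemma poly_actE N g a n : (size g <= N)%N ->
  poly_act g a n = \sum_(i < N) g`_i * a (n - i%:Z).
Proof.
move=> gN; rewrite /poly_act (big_ord_widen N (fun i => g`_i * a (n - i%:Z)))//.
rewrite big_mkcond; apply: eq_bigr => i _; case: ltnP => // gi.
by rewrite nth_default// mul0r.
Qed.

Lemma poly_actD g h a n :
  poly_act (g + h) a n = poly_act g a n + poly_act h a n.
Proof.
set N := maxn (size g) (size h).
rewrite !(@poly_actE N) ?leq_maxl ?leq_maxr//; last first.
  by rewrite (leq_trans (size_polyD _ _)).
by rewrite -big_split; apply: eq_bigr => i _; rewrite coefD mulrDl.
Qed.

Lemma poly_actZ c g a n : poly_act (c *: g) a n = c * poly_act g a n.
Proof.
rewrite !(@poly_actE (size g)) ?size_scale_leq//.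
by rewrite mulr_sumr; apply: eq_bigr => i _; rewrite coefZ mulrA.
Qed.

Lemma poly_actMX g a n : poly_act (g * 'X) a n = poly_act g a (n - 1).
Proof.
rewrite (@poly_actE (size g).+1); last first.
  by rewrite (leq_trans (size_polyMleq _ _))// size_polyX addn2.
rewrite big_ord_recl coefMX/= mul0r add0r; apply: eq_bigr => i _.
by rewrite coefMX/= /bump /= add1n; congr (_ * a _); lia.
Qed.

Lemma poly_act_recl g c h a n :
  poly_act ((g * 'X + c%:P) * h) a n =
  poly_act (g * h) a (n - 1) + c * poly_act h a n.
Proof.
by rewrite mulrDl poly_actD mul_polyC poly_actZ mulrAC poly_actMX.
Qed.

Lemma poly_act1 a n : poly_act 1 a n = a n.
Proof. by rewrite /poly_act size_poly1 big_ord1 coef1 mul1r subr0. Qed.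

Lemma poly_act0 a n : poly_act 0 a n = 0.
Proof. by rewrite /poly_act size_poly0 big_ord0. Qed.

Lemma poly_actM g h a n :
  poly_act (g * h) a n = poly_act g (poly_act h a) n.
Proof.
elim/poly_ind: g n => [|g c IH] n; first by rewrite mul0r !poly_act0.
by rewrite poly_act_recl IH -[g * 'X + _]mulr1 poly_act_recl mulr1 poly_act1.
Qed.

Lemma poly_act_seq g f n : poly_act g (poly_seq f) n = poly_seq (g * f) n.
Proof.
elim/poly_ind: g n => [|g c IH] n.
  by rewrite mul0r poly_act0; case: n => // k; rewrite /= coef0.
rewrite -[g * 'X + _]mulr1 poly_act_recl !mulr1 IH poly_act1.
rewrite mulrDl mul_polyC mulrAC.
case: n => [[|k]|k].
- by rewrite sub0r /= coefD coefMX coefZ.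
- rewrite (_ : k.+1%:Z - 1 = k%:Z); last by lia.
  by rewrite /= coefD coefMX coefZ.
- rewrite (_ : Negz k - 1 = Negz k.+1); last by lia.
  by rewrite /= mulr0 addr0.
Qed.

Lemma poly_act_sum g (I : finType) (c : I -> F) (a : I -> int -> F) n :
  poly_act g (fun k => \sum_i c i * a i k) n = \sum_i c i * poly_act g (a i) n.
Proof.
rewrite /poly_act.
under eq_bigr do rewrite mulr_sumr.
rewrite exchange_big; apply: eq_bigr => i _; rewrite mulr_sumr.
by apply: eq_bigr => k _; rewrite mulrCA.
Qed.

(** Subtract from the series its polynomial part [c]: what remains is of order
    below [x^-deg g], and its product with [g] is the polynomial [f - g * c] of
    negative degree, hence zero. *)
Lemma laurent_dvdp f g a (N : int) : g != 0 ->
  (forall n, N < n -> a n = 0) ->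
  (forall n, poly_act g a n = poly_seq f n) ->
  (forall r, (r < (size g).-1)%N -> a (- r.+1%:Z) = 0) ->
  g %| f.
Proof.
move=> g0 aN gaf a0.
pose c := \poly_(i < `|N|.+1) a i%:Z.
have cE k : c`_k = a k%:Z.
  rewrite coef_poly; case: ltnP => // kN.
  by rewrite aN//; lia.
suff -> : f = g * c by rewrite dvdp_mulr.
apply/polyP => k; rewrite -[f`_k]/(poly_seq f k%:Z) -gaf.
rewrite -[(g * c)`_k]/(poly_seq (g * c) k%:Z) -poly_act_seq.
apply: eq_bigr => i _; congr (_ * _).
case E : (k%:Z - i%:Z) => [l|l] /=; first by rewrite cE.
rewrite NegzE a0//.
by have := ltn_ord i; move: E; rewrite NegzE; lia.
Qed.

End LaurentAction.

Section GNSRank.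
Variables (b s : nat) (S : GNS b s).
Local Notation p := (gns_base S).
Local Notation e := (gns_deg S).
Local Notation y := (gns_y S).
Local Notation F := ('F_b).

Lemma gns_base_neq0 j : p j != 0.
Proof. by rewrite monic_neq0// gns_base_monic. Qed.

(** Divisibility by [p j] itself concerns only the last block of coefficients,
    the other blocks being multiples of [p j]; the independence of the residues
    kills that block, and dividing by [p j] leaves the same statement for one
    block less. *)
Lemma gns_base_power_free j t (v : nat -> F) :
  p j ^+ t %| \sum_(a < t) p j ^+ (t.-1 - a) *
      \sum_(i < e j) v (a * e j + i)%N *: y j (a * e j + i)%N ->
  forall l, (l < t * e j)%N -> v l = 0.
Proof.
elim: t => [|t IH] //.
rewrite big_ord_recr /= subnn expr0 mul1r.
set B := (X in _ + X).
have -> : \sum_(a < t) p j ^+ (t - a) *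
      \sum_(i < e j) v (a * e j + i)%N *: y j (a * e j + i)%N =
   p j * \sum_(a < t) p j ^+ (t.-1 - a) *
      \sum_(i < e j) v (a * e j + i)%N *: y j (a * e j + i)%N.
  rewrite mulr_sumr; apply: eq_bigr => a _; rewrite mulrA -exprS.
  by congr (_ ^+ _ * _); have := ltn_ord a; lia.
move=> dv.
have pB : p j %| B.
  have : p j %| p j ^+ t.+1 by rewrite exprS dvdp_mulr.
  by move=> /dvdp_trans /(_ dv); rewrite dvdp_addr// dvdp_mulr.
have v0 : forall i : 'I_(e j), v (t * e j + i)%N = 0.
  apply: (@gns_y_free _ _ S j t (fun i => v (t * e j + i)%N)).
  rewrite -[RHS](eqP pB).
  rewrite (big_morph (fun q => q %% p j) (id1 := 0) (op1 := +%R)) ?mod0p//;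
    last by move=> f g; rewrite modpD.
  by apply: eq_bigr => i _; rewrite modpZl.
have B0 : B = 0 by apply: big1 => i _; rewrite v0 scale0r.
move: dv; rewrite B0 addr0 exprS dvdp_mul2l ?gns_base_neq0// => /IH v0' l lt.
have [/v0'//|tl] := ltnP l (t * e j).
have li : (l - t * e j < e j)%N by move: lt; rewrite mulSn; lia.
by rewrite -[RHS](v0 (Ordinal li)) /= subnKC.
Qed.

Lemma poly_seq_sum (I : finType) (c : I -> F) (f : I -> {poly F}) n :
  \sum_i c i * poly_seq (f i) n = poly_seq (\sum_i c i *: f i) n.
Proof.
case: n => k /=; last by rewrite big1// => i _; rewrite mulr0.
by rewrite coef_sum; apply: eq_bigr => i _; rewrite coefZ.
Qed.

(** The combination of rows expands a fraction with denominator
    [\prod_j p j ^+ tau j], whose degree is the number of coefficients assumed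
    to vanish; so the denominator divides the numerator. Modulo [p j ^+ tau j]
    the numerator retains only the contribution of the coordinate [j]. *)
Lemma gns_rank (tau : 'I_s -> nat) (v : 'I_s -> nat -> F) :
  (forall r, (r < \sum_j tau j * e j)%N ->
     \sum_j \sum_(l < (tau j * e j)%N) v j l * gns_C S j l r = 0) ->
  forall j l, (l < tau j * e j)%N -> v j l = 0.
Proof.
move=> vC.
pose Q := \prod_j p j ^+ tau j.
pose Q' j := \prod_(i | i != j) p i ^+ tau i.
have QE j : Q = Q' j * p j ^+ tau j by rewrite /Q (bigD1 j)//= mulrC.
have Q0 : Q \is monic.
  by apply: monic_prod => j _; rewrite monic_exp// gns_base_monic.
have szQ : (size Q).-1 = (\sum_j tau j * e j)%N.
  rewrite /Q size_prod => [|j _]; last by rewrite expf_neq0// gns_base_neq0.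
  have szp j : size (p j ^+ tau j) = (tau j * e j).+1.
    rewrite mulnC -[(_ * _)%N]size_exp prednK// lt0n size_poly_eq0.
    by rewrite expf_neq0// gns_base_neq0.
  under eq_bigr do rewrite szp -addn1.
  by rewrite big_split /= sum1_card -addSn addnK.
pose a j l := sval (cid2 (gns_C_laurent S j l)).
have aL j l : laurent_expansion (y j l) (p j ^+ (l %/ e j).+1) (a j l).
  by rewrite /a; case: cid2.
have aC j l r : gns_C S j l r = a j l (- r.+1%:Z).
  by rewrite /a; case: cid2.
pose A n := \sum_j 1 * \sum_(l < (tau j * e j)%N) v j l * a j l n.
(* [Y j / p j ^+ tau j] is the part of the fraction that belongs to [j]. *)
pose Y j := \sum_(l < (tau j * e j)%N)
   v j l *: (p j ^+ ((tau j).-1 - l %/ e j) * y j l).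
have dvQ : Q %| \sum_j 1 *: (Q' j * Y j).
  have [N aN] : exists N : int, forall n, N < n ->
      forall j l, (l < tau j * e j)%N -> a j l n = 0.
    have B j : exists N : int, forall n, N < n ->
        forall l, (l < tau j * e j)%N -> a j l n = 0.
      elim: (tau j * e j)%N => [|t [N NP]]; first by exists 0.
      have [[N' N'P] _] := aL j t.
      exists (Num.max N N') => n; rewrite gt_max => /andP[nN nN'] l.
      by rewrite ltnS leq_eqVlt => /predU1P[->|]; [exact: N'P|exact: NP].
    have [N NP] := choice B.
    exists (\sum_j `|N j|) => n nN j l lt; apply: (NP j) => //.
    apply: le_lt_trans nN; rewrite (bigD1 j)//=.
    by rewrite ler_wpDr ?sumr_ge0// ler_norm.
  apply: (@laurent_dvdp _ _ _ A N); first exact: monic_neq0.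
  - move=> n nN; rewrite /A big1// => j _; rewrite big1 ?mulr0// => l _.
    by rewrite aN ?mulr0.
  - move=> n; rewrite /A poly_act_sum -poly_seq_sum.
    apply: eq_bigr => j _; congr (_ * _).
    rewrite poly_act_sum /Y mulr_sumr.
    under [in RHS]eq_bigr do rewrite -scalerAr.
    rewrite -poly_seq_sum; apply: eq_bigr => l _; congr (_ * _).
    have lt : (l %/ e j < tau j)%N by rewrite ltn_divLR ?gns_deg_gt0.
    have -> : Q = (Q' j * p j ^+ ((tau j).-1 - l %/ e j)) *
        p j ^+ (l %/ e j).+1.
      rewrite (QE j) -mulrA -exprD; congr (_ * _ ^+ _).
      by move: lt; move: (tau j) (l %/ e j)%N => t q; lia.
    rewrite poly_actM (_ : poly_act (p j ^+ _) _ = poly_seq (y j l)).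
      by rewrite poly_act_seq mulrA.
    by apply/funext => k; have [_] := aL j l; exact.
  - move=> r; rewrite szQ => /vC <-; rewrite /A.
    apply: eq_bigr => j _; rewrite mul1r; apply: eq_bigr => l _.
    by rewrite aC.
move=> j; apply: (@gns_base_power_free j (tau j) (v j)).
have -> : \sum_(a0 < tau j) p j ^+ ((tau j).-1 - a0) *
   \sum_(i < e j) v j (a0 * e j + i)%N *: y j (a0 * e j + i)%N = Y j.
  rewrite /Y -(big_mkord xpredT (fun l => v j l *:
     (p j ^+ ((tau j).-1 - l %/ e j) * y j l))) big_nat_mul big_mkord.
  apply: eq_bigr => t _; rewrite mulr_sumr -[X in index_iota X _]add0n mulSn.
  rewrite big_addn addnK big_mkord; apply: eq_bigr => i _.
  rewrite [(i + _)%N]addnC -scalerAr divnMDl ?gns_deg_gt0// divn_small// addn0.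
  by [].
have dvp i k : i != k -> p k ^+ tau k %| Q' i.
  by move=> ik; rewrite /Q' (bigD1 k) 1?eq_sym//= dvdp_mulr.
have : p j ^+ tau j %| \sum_j 1 *: (Q' j * Y j).
  by apply: dvdp_trans dvQ; rewrite (QE j) dvdp_mull.
rewrite (bigD1 j)//= dvdp_addl; last first.
  apply: (big_ind (fun q => p j ^+ tau j %| q)) => [|f g ? ?|i ij].
  - by rewrite dvdp0.
  - by rewrite dvdp_add.
  - by rewrite scale1r dvdp_mulr// dvp.
rewrite scale1r mulrC Gauss_dvdpl// coprimep_expl//.
apply: (big_ind (fun q => coprimep (p j) q)) => [|f g ? ?|i ij].
- exact: coprimep1.
- by rewrite coprimepMr; apply/andP.
- by rewrite coprimep_expr// gns_base_coprime// eq_sym.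
Qed.

End GNSRank.

(** * Counting vectors orthogonal to generating matrices *)

Section GNSCount.
Variables (b s : nat) (S : GNS b s).
Local Notation e := (gns_deg S).

Definition block_supported L (tau : 'I_s -> nat)
    (v : {ffun 'I_s * 'I_L -> 'F_b}) :=
  [forall x : 'I_s * 'I_L, ((tau x.1 * e x.1 <= x.2)%N ==> (v x == 0)) ].

Definition orthogonal_columns L m (v : {ffun 'I_s * 'I_L -> 'F_b}) :=
  [forall r : 'I_m, \sum_x v x * gns_C S x.1 x.2 r == 0].

Definition top_block_neq0 L (tau : 'I_s -> nat)
    (v : {ffun 'I_s * 'I_L -> 'F_b}) :=
  [forall j, (0 < tau j)%N ==>
    [exists l : 'I_L, ((tau j).-1 * e j <= l)%N && (v (j, l) != 0)]].

Lemma block_supported_sum L tau (v : {ffun 'I_s * 'I_L -> 'F_b}) r :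
  (forall j, (tau j * e j <= L)%N) -> block_supported tau v ->
  \sum_x v x * gns_C S x.1 x.2 r =
  \sum_j \sum_(l < (tau j * e j)%N)
     (if insub (val l) is Some l' then v (j, l') else 0) * gns_C S j l r.
Proof.
move=> tauL /forallP vs.
transitivity (\sum_j \sum_(l < L) v (j, l) * gns_C S j l r).
  by rewrite pair_bigA; apply: eq_bigr => -[j l] _.
apply: eq_bigr => j _.
rewrite (big_ord_widen L (fun l =>
  (if insub l is Some l' then v (j, l') else 0) * gns_C S j l r))//.
rewrite [RHS]big_mkcond; apply: eq_bigr => l _.
have -> : insub (val l) = Some l by rewrite valK.
case: ltnP => // tl; have := vs (j, l).
by rewrite /= tl => /eqP ->; rewrite mul0r.
Qed.

Lemma block_supported_inj L tau (v : {ffun 'I_s * 'I_L -> 'F_b}) :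
  (forall j, (tau j * e j <= L)%N) -> block_supported tau v ->
  (forall r, (r < \sum_j tau j * e j)%N ->
     \sum_x v x * gns_C S x.1 x.2 r = 0) -> v = 0.
Proof.
move=> tauL vs vC.
pose u (j : 'I_s) (l : nat) := if insub l is Some l' then v (j, l') else 0.
have u0 : forall j l, (l < tau j * e j)%N -> u j l = 0.
  apply: gns_rank => r /vC; rewrite (block_supported_sum _ tauL vs) => v0.
  by rewrite -[RHS]v0; apply: eq_bigr => j _; apply: eq_bigr.
apply/ffunP => -[j l]; rewrite ffunE.
have [lt|tl] := ltnP l (tau j * e j).
  by have := u0 j l lt; rewrite /u valK.
by move/forallP: vs => /(_ (j, l)); rewrite /= tl => /eqP.
Qed.

(** A vector supported on [n] positions is determined by its products with the
    first [n] columns. If the first [m < n] of these vanish, [n - m] products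
    are left to choose; if the first [m >= n] vanish, so does the vector, which
    has then no nonzero top block. *)
Lemma gns_count L m (tau : 'I_s -> nat) : prime b ->
  (forall j, (tau j * e j <= L)%N) -> (exists j, (0 < tau j)%N) ->
  (#|[set v : {ffun 'I_s * 'I_L -> 'F_b} | [&& block_supported tau v,
       orthogonal_columns m v & top_block_neq0 tau v]]%SET| * b ^ m
    <= b ^ (\sum_j tau j * e j))%N.
Proof.
move=> pb tauL [j0 tj0].
set n := (\sum_j tau j * e j)%N; set A := [set _ | _]%SET.
have [nm|mn] := leqP n m.
  suff -> : A = finset.set0 by rewrite cards0.
  apply/setP => v; rewrite !inE; apply/negP => /and3P[vs /forallP vo /forallP vt].
  have v0 : v = 0.
    apply: (block_supported_inj tauL vs) => r rn.
    by have /eqP := vo (Ordinal (leq_trans rn nm)).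
  have := vt j0; rewrite tj0 /= => /existsP[l /andP[_]].
  by rewrite v0 ffunE eqxx.
rewrite -[X in (_ <= b ^ X)%N](subnK (ltnW mn)) expnD leq_mul2r; apply/orP; right.
pose phi (v : {ffun 'I_s * 'I_L -> 'F_b}) : {ffun 'I_(n - m) -> 'F_b} :=
  [ffun r : 'I_(n - m) => \sum_x v x * gns_C S x.1 x.2 (m + r)%N].
have inj : {in A &, injective phi}.
  move=> v w; rewrite !inE => /and3P[/forallP vs /forallP vo _].
  move=> /and3P[/forallP ws /forallP wo _] vw.
  apply/eqP; rewrite -subr_eq0; apply/eqP.
  have ds : block_supported tau (v - w).
    apply/forallP => x; apply/implyP => tx; rewrite !ffunE.
    have := vs x; have := ws x; rewrite tx /= => /eqP -> /eqP ->.
    by rewrite subr0.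
  apply: (block_supported_inj tauL ds) => r rn.
  have -> : \sum_x (v - w) x * gns_C S x.1 x.2 r =
     \sum_x v x * gns_C S x.1 x.2 r - \sum_x w x * gns_C S x.1 x.2 r.
    by rewrite -sumrB; apply: eq_bigr => x _; rewrite !ffunE mulrBl.
  have [rm|mr] := ltnP r m.
    have /eqP := vo (Ordinal rm); have /eqP := wo (Ordinal rm) => /= -> ->.
    by rewrite subrr.
  have rnm : (r - m < n - m)%N by rewrite ltn_sub2r.
  by move/ffunP: vw => /(_ (Ordinal rnm)); rewrite !ffunE /= subnKC// => ->;
    rewrite subrr.
rewrite -(card_in_imset inj); apply: leq_trans (max_card _) _.
have := card_ffun 'I_(n - m) 'F_b; rewrite (card_Fp pb) card_ord => <-.
exact: leqnn.
Qed.

End GNSCount.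

(** * Real Fourier analysis over a prime field *)

Section LineKernel.
Variables (R : realType) (b : nat).
Hypothesis pb : prime b.
Local Notation F := ('F_b).

(** The average over [c != 0] of the characters [t |-> omega^(c t)], with
    [omega] a primitive complex [b]-th root of unity: averaging over a line of
    frequencies gives a real function. *)
Definition line_kernel (t : F) : R :=
  (b%:R * (t == 0)%:R - 1) / (b%:R - 1).

Let b1 : 1 < b%:R :> R. Proof. by rewrite ltr1n prime_gt1. Qed.
Let b0 : b%:R - 1 != 0 :> R. Proof. by rewrite subr_eq0 gt_eqF. Qed.

Lemma line_kernel0 : line_kernel 0 = 1.
Proof. by rewrite /line_kernel eqxx mulr1 divff. Qed.

Lemma sum_line_kernel : \sum_t line_kernel t = 0.
Proof.
rewrite -mulr_suml sumrB sumr_const card_Fp// -mulr_sumr.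
rewrite (bigD1 0)//= big1 ?eqxx ?addr0; last by move=> i /negPf ->.
by rewrite mulr1 subrr mul0r.
Qed.

Definition dot (I : finType) (x y : {ffun I -> F}) : F := \sum_i x i * y i.

Lemma dotDr (I : finType) (x y z : {ffun I -> F}) :
  dot x (y + z) = dot x y + dot x z.
Proof. by rewrite -big_split; apply: eq_bigr => i _; rewrite ffunE mulrDr. Qed.

Lemma dotC (I : finType) (x y : {ffun I -> F}) : dot x y = dot y x.
Proof. by apply: eq_bigr => i _; rewrite mulrC. Qed.

Lemma dotBr (I : finType) (x y z : {ffun I -> F}) :
  dot x (y - z) = dot x y - dot x z.
Proof. by rewrite -sumrB; apply: eq_bigr => i _; rewrite !ffunE mulrBr. Qed.

Lemma dot0r (I : finType) (x : {ffun I -> F}) : dot x 0 = 0.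
Proof. by rewrite /dot big1// => i _; rewrite ffunE mulr0. Qed.

(** Translating by a multiple of a coordinate vector shifts the value of a
    nonzero linear form arbitrarily, so that the sum does not depend on [t] and
    vanishes like the sum of the kernel over F_b. *)
Lemma sum_line_kernel_dot (I : finType) (mu : {ffun I -> F}) (t : F) :
  mu != 0 -> \sum_(x : {ffun I -> F}) line_kernel (t - dot mu x) = 0.
Proof.
move=> mu0; pose G u := \sum_(x : {ffun I -> F}) line_kernel (u - dot mu x).
have [i0 mui0] : exists i, mu i != 0.
  apply/existsP; apply: contraNT mu0 => /existsPn mu0.
  by apply/eqP/ffunP => i; rewrite ffunE; apply/eqP; move: (mu0 i); rewrite negbK.
have GE u : G u = G t.
  pose d : {ffun I -> F} := [ffun i => if i == i0 then (t - u) / mu i0 else 0].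
  have dE : dot mu d = t - u.
    rewrite /dot (bigD1 i0)//= big1 ?addr0; last first.
      by move=> i /negPf ii0; rewrite ffunE ii0 mulr0.
    by rewrite ffunE eqxx mulrC divfK.
  rewrite /G [RHS](reindex_inj (addrI d)) /=.
  by apply: eq_bigr => x _; rewrite dotDr dE; congr line_kernel; ring.
have : \sum_u G u = 0.
  rewrite exchange_big big1// => x _.
  by rewrite -[RHS]sum_line_kernel [RHS](reindex_inj (addIr (- dot mu x))).
under eq_bigr do rewrite GE.
rewrite sumr_const card_Fp// => /eqP; rewrite mulrn_eq0.
by rewrite eqn0Ngt prime_gt0//= => /eqP.
Qed.

(** Orthogonality of the characters, summed along lines. *)
Lemma line_kernel_inversion (I : finType) (x : {ffun I -> F}) :
  \sum_(mu : {ffun I -> F}) line_kernel (dot mu x) =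
  #|{ffun I -> F}|%:R * (x == 0)%:R.
Proof.
have [->|x0] := eqVneq x 0; last first.
  rewrite mulr0 -[RHS](@sum_line_kernel_dot _ (- x) 0); last by rewrite oppr_eq0.
  apply: eq_bigr => mu _; congr line_kernel.
  by rewrite sub0r dotC /dot -sumrN; apply: eq_bigr => i _;
    rewrite !ffunE mulNr opprK.
rewrite mulr1 -sumr_const; apply: eq_bigr => mu _.
by rewrite dot0r line_kernel0.
Qed.

(** The average of the squared modulus of the Fourier coefficients of [h] at the
    nonzero multiples of [mu]. *)
Definition line_energy (I : finType) (mu : {ffun I -> F})
    (h : {ffun I -> F} -> R) : R :=
  \sum_z \sum_y h z * h y * line_kernel (dot mu (y - z)).

(** With [T t] the sum of [h] over a level set of [dot mu], this is the
    Cauchy--Schwarz inequality for [T] over the [b] elements of F_b, proved from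
    the sum of the squares [(T t - T u) ^+ 2]. *)
Lemma line_energy_ge0 (I : finType) (mu : {ffun I -> F}) h :
  0 <= line_energy mu h.
Proof.
pose T t := \sum_(z | dot mu z == t) h z.
have sumT : \sum_z h z = \sum_t T t.
  rewrite /T (exchange_big_dep xpredT)//=; apply: eq_bigr => z _.
  by rewrite (big_pred1 (dot mu z))// => t; rewrite /= eq_sym.
have sumTT : \sum_z \sum_y h z * h y * (dot mu (y - z) == 0)%:R =
    \sum_t T t ^+ 2.
  transitivity (\sum_z h z * T (dot mu z)).
    apply: eq_bigr => z _; rewrite /T mulr_sumr [RHS]big_mkcond.
    apply: eq_bigr => y _; rewrite dotBr subr_eq0.
    by case: eqP => _; rewrite ?mulr1 ?mulr0.
  rewrite (partition_big (dot mu) xpredT)//=; apply: eq_bigr => t _.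
  rewrite expr2 {1}/T mulr_suml; apply: eq_bigr => z /eqP -> //.
have -> : line_energy mu h =
    (b%:R * (\sum_t T t ^+ 2) - (\sum_t T t) ^+ 2) / (b%:R - 1).
  rewrite -sumTT -sumT expr2 big_distrlr /= mulr_sumr -sumrB mulr_suml.
  apply: eq_bigr => z _; rewrite mulr_sumr -sumrB mulr_suml.
  by apply: eq_bigr => y _; rewrite /line_kernel; ring.
rewrite divr_ge0 ?subr_ge0 ?(ltW b1)//.
have : 0 <= \sum_t \sum_u (T t - T u) ^+ 2.
  by apply: sumr_ge0 => t _; apply: sumr_ge0 => u _; exact: sqr_ge0.
have -> : \sum_t \sum_u (T t - T u) ^+ 2 =
    2 * (b%:R * (\sum_t T t ^+ 2) - (\sum_t T t) ^+ 2).
  have E t : \sum_u (T t - T u) ^+ 2 =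
      b%:R * T t ^+ 2 - 2 * (T t * \sum_u T u) + \sum_u T u ^+ 2.
    under eq_bigr do rewrite sqrrB -mulr_natl.
    rewrite big_split sumrB /= sumr_const card_Fp// mulr_natl -mulr_sumr.
    by rewrite -mulr_sumr.
  under eq_bigr do rewrite E.
  rewrite big_split sumrB /= sumr_const card_Fp// -mulr_natl -!mulr_sumr.
  by rewrite -mulr_suml; ring.
by rewrite pmulr_rge0 ?subr_ge0.
Qed.

Lemma line_energy0 (I : finType) (h : {ffun I -> F} -> R) :
  line_energy 0 h = (\sum_z h z) ^+ 2.
Proof.
rewrite /line_energy expr2 big_distrlr /=.
apply: eq_bigr => z _; apply: eq_bigr => y _.
by rewrite dotC dot0r line_kernel0 mulr1.
Qed.

(** Parseval's identity. *)
Lemma sum_line_energy (I : finType) (h : {ffun I -> F} -> R) :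
  \sum_mu line_energy mu h = #|{ffun I -> F}|%:R * \sum_z h z ^+ 2.
Proof.
rewrite exchange_big mulr_sumr; apply: eq_bigr => z _ /=.
rewrite exchange_big /= (bigD1 z)//= [X in _ + X]big1 ?addr0; last first.
  move=> y yz; rewrite -mulr_sumr line_kernel_inversion subr_eq0 (negPf yz).
  by rewrite !mulr0.
by rewrite -mulr_sumr line_kernel_inversion subrr eqxx mulr1 mulrC expr2.
Qed.

Definition lin_image (I J : finType) (G : {ffun I * J -> F})
    (x : {ffun J -> F}) : {ffun I -> F} :=
  [ffun i => \sum_j G (i, j) * x j].

Definition col_orth (I J : finType) (G : {ffun I * J -> F})
    (mu : {ffun I -> F}) : bool :=
  [forall j, \sum_i mu i * G (i, j) == 0].

Lemma lin_imageB (I J : finType) (G : {ffun I * J -> F}) x y :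
  lin_image G (x - y) = lin_image G x - lin_image G y.
Proof.
apply/ffunP => i; rewrite !ffunE -sumrB.
by apply: eq_bigr => j _; rewrite !ffunE mulrBr.
Qed.

Lemma sum_line_kernel_image (I J : finType) (G : {ffun I * J -> F}) mu t :
  \sum_x line_kernel (t - dot mu (lin_image G x)) =
  #|{ffun J -> F}|%:R * (col_orth G mu)%:R * line_kernel t.
Proof.
pose nu : {ffun J -> F} := [ffun j => \sum_i mu i * G (i, j)].
have nuE x : dot mu (lin_image G x) = dot nu x.
  rewrite /dot; under eq_bigr do rewrite ffunE mulr_sumr.
  rewrite exchange_big; apply: eq_bigr => j _; rewrite ffunE mulr_suml.
  by apply: eq_bigr => i _; rewrite mulrA.
under eq_bigr do rewrite nuE.
have -> : col_orth G mu = (nu == 0).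
  apply/forallP/eqP => [Gmu|nu0 j].
    by apply/ffunP => j; rewrite !ffunE; exact/eqP.
  by have := congr1 (fun g : {ffun J -> F} => g j) nu0; rewrite !ffunE => ->.
have [->|nu0] := eqVneq nu 0; last by rewrite mulr0 mul0r sum_line_kernel_dot.
under eq_bigr do rewrite dotC dot0r subr0.
by rewrite sumr_const -[LHS]mulr_natl [in RHS]mulr1.
Qed.

(** Averaging over the translates by the image of [G] retains exactly the
    frequencies orthogonal to that image. *)
Lemma coset_average_energy (I J : finType) (G : {ffun I * J -> F})
    (h : {ffun I -> F} -> R) :
  #|{ffun I -> F}|%:R * \sum_z (\sum_x h (lin_image G x + z)) ^+ 2 =
  #|{ffun J -> F}|%:R ^+ 2 * \sum_(mu | col_orth G mu) line_energy mu h.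
Proof.
have -> : \sum_z (\sum_x h (lin_image G x + z)) ^+ 2 =
    #|{ffun J -> F}|%:R * \sum_z \sum_x h z * h (z + lin_image G x).
  under eq_bigr do rewrite expr2 big_distrlr /=.
  rewrite exchange_big /=.
  transitivity (\sum_(x' : {ffun J -> F}) \sum_z \sum_x h z * h (z + lin_image G x)).
    apply: eq_bigr => x' _.
    rewrite [RHS](reindex_inj (addrI (lin_image G x'))) /=.
    apply: eq_bigr => z _; rewrite [RHS](reindex_inj (addIr (- x'))) /=.
    apply: eq_bigr => x _; congr (_ * h _).
      by rewrite lin_imageB [RHS]addrC addrA subrK.
  by rewrite sumr_const mulr_natl.
rewrite mulrCA expr2 -mulrA; congr (_ * _).
have -> : \sum_z \sum_x h z * h (z + lin_image G x) =
   \sum_z \sum_y h z * h y * \sum_x (y - z - lin_image G x == 0)%:R.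
  apply: eq_bigr => z _.
  under [RHS]eq_bigr do rewrite mulr_sumr.
  rewrite [RHS]exchange_big /=; apply: eq_bigr => x _.
  rewrite (bigD1 (z + lin_image G x))//= big1 ?addr0; last first.
    move=> y; rewrite -subr_eq0 opprD addrA => /negPf ->; by rewrite mulr0.
  by rewrite addrAC addrK subrr eqxx mulr1.
rewrite /line_energy [in RHS]exchange_big /= [LHS]mulr_sumr [RHS]mulr_sumr.
apply: eq_bigr => z _.
rewrite [in RHS]exchange_big /= [LHS]mulr_sumr [RHS]mulr_sumr.
apply: eq_bigr => y _; rewrite -mulr_sumr [LHS]mulrCA [RHS]mulrCA.
congr (_ * _); rewrite mulr_sumr.
under eq_bigr do rewrite -line_kernel_inversion.
rewrite exchange_big /=.
under eq_bigr do under eq_bigr do rewrite dotBr.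
under eq_bigr do rewrite sum_line_kernel_image.
rewrite mulr_sumr [RHS]big_mkcond /=; apply: eq_bigr => mu _.
by case: col_orth; rewrite ?mulr1 // mulr0 mul0r.
Qed.

End LineKernel.

(** * The constant of a reduced sequence *)

Section ReducedConstant.
Variable R : realType.

Lemma ln_ge1BV (x : R) : 0 < x -> 1 - x^-1 <= ln x.
Proof.
move=> x0; have xV : 0 < x^-1 by rewrite invr_gt0.
have := @le_ln1Dx R (x^-1 - 1); rewrite ltrBrDl subrr => /(_ xV).
by rewrite addrC subrK lnV ?posrE//; lra.
Qed.

(** The right-hand side is the integral of [x `^ (- (1 + beta))] from [u] to [v],
    the left-hand side uses the value at [v] only; the inequality
    [1 + x <= expR x] replaces integration. *)
Lemma powRN_diff_ge (u v beta : R) : 0 < u -> 0 < v -> 0 < beta ->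
  (v - u) / v `^ (1 + beta) <= beta^-1 * (u `^ (- beta) - v `^ (- beta)).
Proof.
move=> u0 v0 beta0.
rewrite ler_pdivlMl//.
have vb0 : 0 < v `^ (- beta) by rewrite powR_gt0.
have -> : u `^ (- beta) = v `^ (- beta) * expR (beta * ln (v / u)).
  rewrite /powR !gt_eqF// -expRD ln_div ?posrE//; congr expR; ring.
have -> : (v `^ (1 + beta))^-1 = v `^ (- beta) / v.
  rewrite -powRN opprD powRD; last by rewrite (gt_eqF v0) implybT.
  by rewrite (powR_inv1 (ltW v0)) mulrC.
have h1 := expR_ge1Dx (beta * ln (v / u)).
have h2 : 1 - (v / u)^-1 <= ln (v / u) by rewrite ln_ge1BV// divr_gt0.
have h3 : beta * (1 - (v / u)^-1) <= beta * ln (v / u) by rewrite ler_pM2l.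
rewrite [leLHS](_ : _ = v `^ (- beta) * (beta * ((v - u) / v)));
  last by ring.
rewrite -[X in _ <= _ - X]mulr1 -mulrBr ler_pM2l//.
have -> : (v - u) / v = 1 - (v / u)^-1 by field; lra.
lra.
Qed.

(** The integral test: after the first term the series is dominated by the
    telescoping differences of [beta^-1 * ln n `^ (- beta)], because
    [1 / n <= ln n - ln (n - 1)]. *)
Lemma sum_ln_series_le (beta : R) (n : nat) : 0 < beta ->
  \sum_(2 <= k < n) (k%:R * ln k%:R `^ (1 + beta))^-1 <=
    1 / (2 * ln 2 `^ (1 + beta)) + 1 / (beta * ln (2 : R) `^ beta).
Proof.
move=> beta0.
have ln2 : 0 < ln 2 :> R by rewrite ln_gt0// ltr1n.
have [n2|] := leqP n 2.
  rewrite big_geq//; apply: addr_ge0; apply: divr_ge0 => //.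
    by rewrite mulr_ge0// powR_ge0.
  by rewrite mulr_ge0 ?powR_ge0// ltW.
case: n => // n; rewrite ltnS => n2.
suff h : \sum_(2 <= k < n.+1) (k%:R * ln k%:R `^ (1 + beta))^-1 <=
    1 / (2 * ln 2 `^ (1 + beta)) +
    beta^-1 * (ln (2 : R) `^ (- beta) - ln n%:R `^ (- beta)).
  apply: le_trans h _; rewrite lerD2l div1r invfM ler_pM2l ?invr_gt0//.
  by rewrite -powRN gerBl powR_ge0.
elim: n n2 => // n IH; rewrite ltnS leq_eqVlt => /predU1P[<-|n2].
  by rewrite big_nat1 subrr mulr0 addr0 div1r.
rewrite big_nat_recr/=; last by rewrite ltnS ltnW.
have n1 : (1 : R) < n%:R by rewrite ltr1n.
have lnn : 0 < ln n%:R :> R by rewrite ln_gt0.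
have lnn1 : 0 < ln n.+1%:R :> R by rewrite ln_gt0// ltr1n ltnW// ltnW.
have := powRN_diff_ge lnn lnn1 beta0.
have h : (n.+1%:R * ln n.+1%:R `^ (1 + beta))^-1 <=
    (ln n.+1%:R - ln n%:R) / ln n.+1%:R `^ (1 + beta) :> R.
  rewrite invfM ler_pM2r ?invr_gt0 ?powR_gt0//.
  have : 0 < n.+1%:R / n%:R :> R by rewrite divr_gt0// (lt_trans _ n1).
  move=> /ln_ge1BV; rewrite ln_div ?posrE ?(lt_trans _ n1)//.
  apply: le_trans; rewrite invf_div -natr1.
  rewrite (_ : 1 - n%:R / (n%:R + 1) = (n%:R + 1)^-1)//.
  by field; lra.
have {}IH := IH n2; move=> hd; apply: le_trans (lerD IH (le_trans h hd)) _.
by rewrite -addrA -mulrDr addrA subrK.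
Qed.

Variables (b s : nat) (S : GNS b s).
Hypothesis pb : prime b.
Local Notation e := (gns_deg S).

(** Monic polynomials of degree one are told apart by their constant term. *)
Lemma gns_deg1_count : (#|[set j | e j == 1%N]%SET| <= b)%N.
Proof.
pose c (j : 'I_s) := (gns_base S j)`_0.
have inj : {in [set j | e j == 1%N]%SET &, injective c}.
  move=> i j; rewrite !inE => /eqP ei /eqP ej cij; apply/eqP/negP => /negP ij.
  have := gns_base_coprime S ij.
  have pE k : e k = 1%N -> gns_base S k = 'X + (c k)%:P.
    move=> ek; apply/polyP => -[|[|l]]; rewrite coefD coefX coefC/= ?add0r ?addr0//.
      have := monicP (gns_base_monic S k); rewrite /lead_coef.
      by move: ek; rewrite /gns_deg => ->.
    by rewrite nth_default//; move: ek; rewrite /gns_deg; case: size => [|[|[]]].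
  rewrite !pE// cij /coprimep gcdpp size_XaddC.
  by [].
rewrite -(card_in_imset inj); apply: leq_trans (max_card _) _.
by rewrite card_Fp.
Qed.

Lemma gns_factor_le (j : 'I_s) :
  1 <= (b%:R ^+ e j / (b%:R ^+ e j - 1) : R) <= expR (b%:R ^+ e j - 1)^-1.
Proof.
have B1 : (1 : R) < b%:R ^+ e j.
  by rewrite exprn_egt1 ?ltr1n ?prime_gt1// -lt0n gns_deg_gt0.
move: (b%:R ^+ e j) B1 => B B1.
have -> : B / (B - 1) = 1 + (B - 1)^-1 by field; lra.
by rewrite expR_ge1Dx andbT lerDl invr_ge0; lra.
Qed.

(** As [B / (B - 1) <= expR (B - 1)^-1], the exponents add up by degree. Degree
    one contributes at most [b / (b - 1) <= 2], and degree [n >= 2] at most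
    [1 / (n * ln n `^ (1 + beta))] because the bound on the number of base polynomials contains
    the factor [b ^ n - 1]. *)
Lemma gns_constant_le (beta : R) (Q : pred 'I_s) : 0 < beta ->
  reduced (fun n => ln n%:R `^ (1 + beta)) S ->
  \prod_(j | Q j) (b%:R ^+ e j / (b%:R ^+ e j - 1)) <= C_const beta.
Proof.
move=> beta0 [_ red].
have b1 : (1 : R) < b%:R by rewrite ltr1n prime_gt1.
have B1 n : (0 < n)%N -> (1 : R) < b%:R ^+ n.
  by move=> n0; rewrite exprn_egt1// -lt0n.
apply: (@le_trans _ _ (\prod_j (b%:R ^+ e j / (b%:R ^+ e j - 1)))).
  rewrite big_mkcond; apply: ler_prod => j _.
  have /andP[h _] := gns_factor_le j.
  by case: ifP => _; rewrite ?lexx ?h ?(le_trans _ h) ?ler01.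
apply: (@le_trans _ _ (\prod_j expR (b%:R ^+ e j - 1)^-1)).
  apply: ler_prod => j _; have /andP[h ->] := gns_factor_le j.
  by rewrite (le_trans _ h).
rewrite -expR_sum /C_const ler_expR.
pose n0 := (\max_j e j).+1.
have e_lt j : (e j < n0)%N by rewrite ltnS (leq_bigmax j).
rewrite (partition_big (fun j => Ordinal (e_lt j)) xpredT)//=.
pose g n : R := \sum_(j | e j == n) (b%:R ^+ e j - 1)^-1.
rewrite -[leLHS]/(\sum_(n < n0) g n).
have gE n : g n = #|[set j | e j == n]%SET|%:R * (b%:R ^+ n - 1)^-1.
  rewrite /g (eq_bigr (fun=> (b%:R ^+ n - 1)^-1)); last by move=> j /eqP ->.
  rewrite sumr_const mulr_natl; congr (_ *+ _).
  by apply: eq_card => j; rewrite !inE.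
have g0 : g 0%N = 0.
  by rewrite /g big1// => j /eqP ej; have := gns_deg_gt0 S j; rewrite ej.
have g1 : g 1%N <= 2.
  rewrite gE expr1 ler_pdivrMr ?subr_gt0//.
  have : #|[set j | e j == 1%N]%SET|%:R <= b%:R :> R.
    by rewrite ler_nat gns_deg1_count.
  have : (2 : R) <= b%:R by rewrite ler_nat prime_gt1.
  lra.
have g2 n : (2 <= n)%N -> g n <= (n%:R * ln n%:R `^ (1 + beta))^-1.
  move=> n2; rewrite gE; have := red n n2.
  rewrite floor_ge_int => cn.
  have B1n : 0 < b%:R ^+ n - 1 :> R by rewrite subr_gt0 B1// ltnW.
  by rewrite ler_pdivrMr// mulrC.
rewrite -addrA -(big_mkord xpredT g) /n0.
have [|] := leqP (\max_j e j) 0.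
  rewrite leqn0 => /eqP ->; rewrite big_nat1 g0.
  have ln2 : 0 < ln 2 :> R by rewrite ln_gt0// ltr1n.
  by rewrite !addr_ge0// divr_ge0// mulr_ge0 ?powR_ge0// ltW.
move=> n1; rewrite big_ltn// g0 add0r big_ltn//; apply: lerD => //.
apply: le_trans (sum_ln_series_le _ beta0).
rewrite !big_nat; apply: ler_sum => n /andP[n2 _]; exact: g2.
Qed.

End ReducedConstant.

(** * Finite-valued random variables and independence *)

Section FiniteValued.
Context d (Om : measurableType d).

Definition finite_rv (T : finType) (X : Om -> T) :=
  forall t, measurable (X @^-1` [set t]).

Lemma finite_rv_preimage (T : finType) (X : Om -> T) (B : set T) :
  finite_rv X -> measurable (X @^-1` B).
Proof.
move=> mX; have -> : X @^-1` B = \bigcup_(t in B) X @^-1` [set t].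
  by apply/seteqP; split => w /=; [move=> BX; exists (X w)|case=> t Bt ->].
by apply: fin_bigcup_measurable => // t _; exact: mX.
Qed.

Lemma finite_rv_comp (T U : finType) (f : T -> U) (X : Om -> T) :
  finite_rv X -> finite_rv (fun w => f (X w)).
Proof. by move=> mX u; exact: (@finite_rv_preimage _ _ (f @^-1` [set u]) mX). Qed.

Lemma measurable_forall (I : finType) (A : I -> set Om) :
  (forall i, measurable (A i)) -> measurable [set w | forall i, A i w].
Proof.
move=> mA; rewrite (_ : [set w | _] = \bigcap_(i in [set: I]) A i).
  by apply: fin_bigcap_measurable.
by apply/seteqP; split => w /= Aw i //; exact: Aw.
Qed.

Lemma finite_rv_ffun (I T : finType) (X : I -> Om -> T) :
  (forall i, finite_rv (X i)) -> finite_rv (fun w => [ffun i => X i w]).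
Proof.
move=> mX f; rewrite (_ : _ @^-1` _ = [set w | forall i, X i w = f i]).
  by apply: measurable_forall => i; exact: mX.
apply/seteqP; split => w /=; first by move=> <- i; rewrite ffunE.
by move=> Xf; apply/ffunP => i; rewrite ffunE.
Qed.

Lemma finite_rv_pair (T U : finType) (X : Om -> T) (Y : Om -> U) :
  finite_rv X -> finite_rv Y -> finite_rv (fun w => (X w, Y w)).
Proof.
move=> mX mY [t u]; rewrite (_ : _ @^-1` _ = X @^-1` [set t] `&` Y @^-1` [set u]).
  by apply: measurableI; [exact: mX|exact: mY].
by apply/seteqP; split => w /= [-> ->].
Qed.

Lemma finite_rv_cst (T : finType) (t : T) : finite_rv (fun=> t : T).
Proof. by move=> u; rewrite preimage_cst; case: ifP. Qed.

Lemma finite_rv_sum (V : finZmodType) (I : finType) (X : I -> Om -> V) :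
  (forall i, finite_rv (X i)) -> finite_rv (fun w => \sum_i X i w).
Proof.
move=> mX.
have := finite_rv_comp (fun f : {ffun I -> V} => \sum_i f i)
  (finite_rv_ffun mX).
suff -> : (fun w => \sum_i [ffun i => X i w] i) = (fun w => \sum_i X i w) by [].
by apply/funext => w; apply: eq_bigr => i _; rewrite ffunE.
Qed.

End FiniteValued.

Section Probability.
Context d (Om : measurableType d) (R : realType) (P : probability Om R).

Definition pr (A : set Om) : R := fine (P A).

Lemma prE A : measurable A -> P A = (pr A)%:E.
Proof. by move=> mA; rewrite fineK// fin_num_measure. Qed.

Lemma pr_ge0 A : 0 <= pr A. Proof. by rewrite fine_ge0. Qed.

Lemma pr_le1 A : measurable A -> pr A <= 1.
Proof. by move=> mA; rewrite -lee_fin -prE// probability_le1. Qed.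

Lemma prT : pr setT = 1. Proof. by rewrite /pr probability_setT. Qed.

Lemma pr0 : pr set0 = 0. Proof. by rewrite /pr measure0. Qed.

Lemma le_pr A B : measurable A -> measurable B -> A `<=` B -> pr A <= pr B.
Proof. by move=> mA mB AB; rewrite -lee_fin -!prE// le_measure ?inE. Qed.

Lemma prU_le A B : measurable A -> measurable B -> pr (A `|` B) <= pr A + pr B.
Proof.
move=> mA mB; rewrite -lee_fin EFinD -!prE//; last exact: measurableU.
exact: measureU2.
Qed.

Lemma pr_split (T : finType) (W : Om -> T) A : finite_rv W -> measurable A ->
  pr A = \sum_t pr (A `&` W @^-1` [set t]).
Proof.
move=> mW mA; apply: EFin_inj; rewrite -sumEFin -prE//.
have mAW t : measurable (A `&` W @^-1` [set t]) by apply: measurableI.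
under eq_bigr do rewrite -prE//.
have {1}-> : A = \bigcup_(t in [set: T]) (A `&` W @^-1` [set t]).
  apply/seteqP; split => w; first by move=> Aw; exists (W w).
  by case=> t _ [].
rewrite measure_fin_bigcup//; [|exact: finite_finset|].
  rewrite [RHS](fsbig_seq _ _ (index_enum_uniq T)).
  suff -> : [set` index_enum T] = [set: T] by [].
  by apply/seteqP; split => t _ //=; rewrite mem_index_enum.
apply/trivIsetP => t u _ _ /eqP tu; apply/seteqP.
by split => // w [[_ /= ->] [_ /=]].
Qed.

Lemma pr_preimage (T : finType) (W : Om -> T) (B : pred T) : finite_rv W ->
  pr [set w | B (W w)] = \sum_(t | B t) pr (W @^-1` [set t]).
Proof.
move=> mW; rewrite (pr_split mW); last exact: (finite_rv_preimage [set t | B t] mW).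
rewrite [RHS]big_mkcond; apply: eq_bigr => t _; case: ifPn => Bt.
  by congr pr; apply/seteqP; split => w [] //= ->.
by rewrite -[RHS]pr0; congr pr; apply/seteqP; split => // w [/= + Wt]; rewrite Wt (negPf Bt).
Qed.

Lemma independent_pr (I : finType) (G : I -> set (set Om)) (A : I -> set Om) :
  mutually_independent P G -> (forall i, G i (A i)) ->
  (forall i, measurable (A i)) ->
  pr [set w | forall i, A i w] = \prod_i pr (A i).
Proof.
move=> indG GA mA; apply: EFin_inj; rewrite -prE; last exact: measurable_forall.
rewrite -prodEFin; under eq_bigr do rewrite -prE//.
rewrite -(indG (index_enum I) A) ?index_enum_uniq//; congr (P _).
rewrite -bigcap_seq; apply/seteqP; split => w /= Aw i //.
by apply: Aw; rewrite /= mem_index_enum.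
Qed.

Lemma independent_inj (I J : eqType) (f : J -> I) (G : I -> set (set Om)) :
  injective f -> mutually_independent P G ->
  mutually_independent P (G \o f).
Proof.
move=> f_inj indG s A us GA.
pose A' i := [set w | forall j, j \in s -> f j = i -> A j w].
have A'E j : j \in s -> A' (f j) = A j.
  move=> js; apply/seteqP; split => w /=; first exact.
  by move=> Aw k _ /f_inj ->.
have := indG [seq f j | j <- s] A'.
rewrite map_inj_uniq// => /(_ us).
rewrite !big_map => indA; rewrite (eq_big_seq _ A'E) in indA.
rewrite indA; last first.
  by move=> i /mapP[j js ->]; rewrite A'E//; exact: GA.
by apply: eq_big_seq => j js; rewrite A'E.
Qed.

Lemma uniform_on_finite_rv (T : finType) (A : {set T}) (X : Om -> T) :
  uniform_on P A X -> finite_rv X.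
Proof. by move=> uX t; have [] := uX t. Qed.

Lemma uniform_on_pr (T : finType) (A : {set T}) (X : Om -> T) (B : pred T) :
  uniform_on P A X ->
  pr [set w | B (X w)] = #|[set x in A | B x]|%:R / #|A|%:R.
Proof.
move=> uX; rewrite pr_preimage; last exact: uniform_on_finite_rv uX.
under eq_bigr do rewrite /pr (uX _).2 /=.
rewrite -mulr_suml; congr (_ / _).
rewrite -sum1_card natr_sum big_mkcond [RHS]big_mkcond /=; apply: eq_bigr => t _.
by rewrite !inE; case: (B t); case: (t \in A).
Qed.

End Probability.

(** * Image of a row under a block triangular random matrix *)

Section RowImage.
Variables (F : finFieldType) (e : nat).
Implicit Types (u v : 'rV[F]_e).

Lemma card_rV : #|{: 'rV[F]_e}| = (#|F| ^ e)%N.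
Proof. by rewrite card_mx mul1n. Qed.

(** The map [m |-> u *m m] is linear and onto, so its fibres are translates of
    one another. *)
Lemma card_mulmx_fiber u v : u != 0 ->
  (#|[set m : 'M[F]_e | u *m m == v]%SET| * #|F| ^ e)%N = #|{: 'M[F]_e}|.
Proof.
move=> u0; pose fib v := [set m : 'M[F]_e | u *m m == v]%SET.
have uV : u *m pinvmx u = 1%:M.
  by apply: mulmxVp; rewrite /row_free rank_rV u0.
have fibE w : #|fib w| = #|fib v|.
  pose sh := pinvmx u *m (v - w).
  rewrite -(card_imset (fib w) (addrI sh)).
  congr #|pred_of_set _|; apply/setP => m; rewrite inE.
  have ush : u *m sh = v - w by rewrite mulmxA uV mul1mx.
  apply/imsetP/eqP => [[m' + ->]|um].
    by rewrite inE => /eqP um'; rewrite mulmxDr um' ush subrK.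
  exists (m - sh); last by rewrite addrC subrK.
  by rewrite inE mulmxBr um ush subKr.
rewrite -[RHS]sum1_card (partition_big (fun m => u *m m) xpredT)//=.
rewrite (eq_bigr (fun=> #|fib v|)) => [|w _].
  by rewrite sum_nat_const card_rV mulnC.
by rewrite -(fibE w) -sum1_card; apply: eq_bigl => m; rewrite inE.
Qed.

Lemma unitmx_transitive u v : u != 0 -> v != 0 ->
  exists2 g : 'M[F]_e, g \in unitmx & u *m g = v.
Proof.
have dec (w : 'rV[F]_e) : w != 0 -> exists2 a, a != 0 &
    exists2 E : 'M[F]_e, E \in unitmx & w = a *: (pid_mx 1 *m E).
  move=> w0; exists (col_ebase w 0 0).
    have := col_ebase_unit w; rewrite {1}[col_ebase w]mx11_scalar.
    by rewrite unitmxE det_scalar1 unitfE.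
  exists (row_ebase w); first exact: row_ebase_unit.
  by rewrite -{1}(mulmx_ebase w) rank_rV w0 [col_ebase w]mx11_scalar
    mul_scalar_mx -scalemxAl !mxE mulr1n.
move=> /dec[a a0 [E Eu ->]] /dec[a' a'0 [E' E'u ->]].
exists ((a' / a) *: (invmx E *m E')).
  rewrite unitmxZ ?unitfE ?mulf_neq0 ?invr_eq0//.
  by rewrite unitmx_mul unitmx_inv Eu.
rewrite -scalemxAl -scalemxAr scalerA mulrC divfK// -mulmxA.
by rewrite (mulmxA E) mulmxV// mul1mx.
Qed.

(** The group acts transitively on nonzero rows, so that right multiplication
    identifies the fibres over any two of them. *)
Lemma card_unitmx_fiber u v : u != 0 -> v != 0 ->
  (#|[set m : 'M[F]_e | (m \in unitmx) && (u *m m == v)]%SET| *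
     (#|F| ^ e).-1)%N = #|[set m : 'M[F]_e | m \in unitmx]%SET|.
Proof.
move=> u0 v0.
pose fib w := [set m : 'M[F]_e | (m \in unitmx) && (u *m m == w)]%SET.
have fibE w : w != 0 -> #|fib w| = #|fib v|.
  move=> w0; have [g gu wg] := unitmx_transitive w0 v0.
  have inj : injective (mulmx^~ g : 'M[F]_e -> 'M[F]_e).
    by apply: (can_inj (g := mulmx^~ (invmx g))) => m; rewrite mulmxK.
  rewrite -(card_imset (fib w) inj).
  congr #|pred_of_set _|; apply/setP => m; rewrite inE.
  apply/imsetP/andP => [[m' + ->]|[mu /eqP um]].
    rewrite inE => /andP[m'u /eqP um'].
    by rewrite unitmx_mul m'u gu mulmxA um' wg.
  exists (m *m invmx g); last by rewrite mulmxKV.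
  by rewrite inE unitmx_mul mu unitmx_inv gu mulmxA um -wg mulmxK ?eqxx.
rewrite -[RHS]sum1_card.
rewrite (partition_big (fun m => u *m m) (fun w => w != 0))/=; last first.
  move=> m; rewrite inE => mu; apply: contra u0 => /eqP um.
  by rewrite -(mulmxK mu u) um mul0mx.
rewrite (eq_bigr (fun=> #|fib v|)) => [|w w0].
  rewrite sum_nat_const mulnC; congr (_ * _)%N.
  by rewrite -card_rV (cardD1 0) /=; apply: eq_card => w; rewrite !inE andbT.
by rewrite -(fibE w w0) -sum1_card; apply: eq_bigl => m; rewrite !inE.
Qed.

End RowImage.

Section RowLaw.
Context d (Om : measurableType d) (R : realType) (P : probability Om R).
Variables (b s : nat) (e : 'I_s -> nat).
Hypothesis pb : prime b.
Variables (D : 'I_s -> nat -> Om -> 'F_b) (M : 'I_s -> nat -> nat -> Om -> 'F_b).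
Hypothesis cs : coarse_scrambling P e D M.
Variable j : 'I_s.
Hypothesis e0 : (0 < e j)%N.
Local Notation rb := (rblock e M j).

Lemma rblock_above a c w : (a < c)%N -> rb a c w = 0.
Proof.
move=> ac; apply/matrixP => i l; rewrite !mxE.
apply: (matrix_lower cs); rewrite !divnMDl// !divn_small ?ltn_ord//.
by rewrite !addn0.
Qed.

Lemma finite_rv_rblock a c : finite_rv (rb a c).
Proof.
case: (ltngtP c a) => [ca|ac|->].
- exact: uniform_on_finite_rv (matrix_below cs ca).
- rewrite (_ : rb a c = fun=> 0); first exact: finite_rv_cst.
  by apply/funext => w; rewrite rblock_above.
- exact: (uniform_on_finite_rv (matrix_diag cs (j:=j) a)).
Qed.

Lemma finite_rv_entry k l : finite_rv (M j k l).
Proof.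
pose i := Ordinal (ltn_pmod k e0); pose i' := Ordinal (ltn_pmod l e0).
have := finite_rv_comp (fun m : 'M['F_b]_(e j) => m i i')
  (@finite_rv_rblock (k %/ e j) (l %/ e j)).
suff -> : (fun w => rb (k %/ e j) (l %/ e j) w i i') = M j k l by [].
by apply/funext => w; rewrite !mxE /= -!divn_eq.
Qed.

Definition block (lam : nat -> 'F_b) c : 'rV['F_b]_(e j) :=
  \row_i lam (c * e j + i)%N.

(** The entry at column [l] of the product of the row [lam], cut after its block
    [a], with the random matrix. *)
Definition row_image (lam : nat -> 'F_b) a l w : 'F_b :=
  \sum_(k < (a.+1 * e j)%N) lam k * M j k l w.

Lemma block_row_image lam a c w :
  block (row_image lam a ^~ w) c =
  \sum_(a' < a.+1) block lam a' *m rb a' c w.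
Proof.
apply/rowP => i; rewrite mxE /row_image summxE.
rewrite -(big_mkord xpredT (fun k => lam k * M j k (c * e j + i)%N w)).
rewrite big_nat_mul big_mkord; apply: eq_bigr => a' _.
rewrite mxE -[X in index_iota X _]add0n mulSn big_addn addnK big_mkord.
by apply: eq_bigr => k _; rewrite !mxE addnC.
Qed.

Variables (lam : nat -> 'F_b) (a : nat).
Hypothesis lam_a : block lam a != 0.

Lemma finite_rv_row_image l : finite_rv (row_image lam a l).
Proof.
apply: finite_rv_sum => k.
exact: (finite_rv_comp (fun x => lam k * x) (@finite_rv_entry k l)).
Qed.

(** The top block of the product is [block lam a] times an invertible matrix. *)
Lemma pr_row_image_top0 :
  pr P [set w | block (row_image lam a ^~ w) a == 0] = 0.
Proof.
have mW := finite_rv_rblock a a.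
have h : pr P [set w | rb a a w \notin unitmx] = 0.
  rewrite (uniform_on_pr (fun m => m \notin unitmx) (matrix_diag cs (j:=j) a)).
  rewrite (_ : [set _ in _ | _]%SET = finset.set0) ?cards0 ?mul0r//.
  by apply/setP => m; rewrite !inE andbN.
have mE : measurable [set w | block (row_image lam a ^~ w) a == 0].
  rewrite (_ : [set w | _] =
    [set w | forall i : 'I_(e j), row_image lam a (a * e j + i) w = 0]).
    by apply: measurable_forall => i; exact: (finite_rv_row_image _ 0).
  apply/seteqP; split => w /=.
    by move=> /eqP/rowP + i => /(_ i); rewrite !mxE.
  by move=> K; apply/eqP/rowP => i; rewrite !mxE.
apply/eqP; rewrite eq_le pr_ge0 andbT -h; apply: le_pr => //.
  exact: (finite_rv_preimage [set m | m \notin unitmx] mW).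
move=> w /=; apply: contraTN => mu.
rewrite block_row_image big_ord_recr /= big1 ?add0r; last first.
  by move=> a' _; rewrite rblock_above ?mulmx0.
by apply: contra lam_a => /eqP h0; rewrite -(mulmxK mu (block lam a)) h0 mul0mx.
Qed.

Let B : R := b%:R ^+ e j.

Let B1 : 1 < B.
Proof. by rewrite exprn_egt1 ?ltr1n ?prime_gt1// -lt0n. Qed.

Lemma pr_block_mulmx_le c (u : 'rV_(e j)) : (c <= a)%N ->
  pr P [set w | block lam a *m rb a c w == u] <=
    (if (c < a)%N then B^-1 else (B - 1)^-1).
Proof.
have BE : B = (b ^ e j)%:R by rewrite natrX.
rewrite leq_eqVlt => /predU1P[->|ca].
  rewrite ltnn (uniform_on_pr (fun m => block lam a *m m == u)
    (matrix_diag cs (j:=j) a)).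
  have [->|u0] := eqVneq u 0.
    rewrite (_ : [set _ in _ | _]%SET = finset.set0).
      by rewrite cards0 mul0r invr_ge0 subr_ge0 ltW.
    apply/setP => m; rewrite !inE; apply/negP => /andP[mu /eqP m0].
    by move/eqP: lam_a; apply; rewrite -(mulmxK mu (block lam a)) m0 mul0mx.
  have := card_unitmx_fiber lam_a u0; rewrite card_Fp//.
  have -> : [set m in [set G | G \in unitmx]%SET | block lam a *m m == u]%SET =
    [set m : 'M['F_b]_(e j) | (m \in unitmx) && (block lam a *m m == u)]%SET.
    by apply/setP => m; rewrite !inE.
  have : (0 < #|[set m : 'M['F_b]_(e j) | m \in unitmx]%SET|)%N.
    by apply/card_gt0P; exists 1%:M; rewrite inE unitmx1.
  move=> u_gt0 cE; rewrite ler_pdivrMr ?ltr0n// -cE natrM.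
  rewrite (_ : (_.-1)%:R = B - 1); last first.
    rewrite BE -[X in _ = X%:R - _](@prednK (b ^ e j)) ?expn_gt0 ?prime_gt0//.
    by rewrite -natr1 addrK.
  by rewrite mulrC mulfK// subr_eq0 gt_eqF.
rewrite ca (uniform_on_pr (fun m => block lam a *m m == u)
    (matrix_below cs (j := j) ca)).
have := card_mulmx_fiber u lam_a; rewrite card_Fp// cardsT => <-.
have -> : [set m in [set: 'M['F_b]_(e j)]%SET | block lam a *m m == u]%SET =
  [set m : 'M['F_b]_(e j) | block lam a *m m == u]%SET.
  by apply/setP => m; rewrite !inE.
rewrite natrM -BE.
have [->|n0] := eqVneq #|[set m : 'M['F_b]_(e j) | block lam a *m m == u]%SET| 0%N.
  by rewrite mul0r invr_ge0 ltW// (lt_trans ltr01).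
by rewrite invfM mulrA mulfV ?mul1r// pnatr_eq0.
Qed.

(** Given the block rows above the row [a], prescribing the product means
    prescribing [block lam a *m rb a c] for each [c <= a]. These are independent
    of one another and of the conditions, uniform for [c < a], and uniform on
    nonzero rows for [c = a]. *)
Lemma pr_row_image_le (v : nat -> 'F_b) :
  pr P [set w | forall l, (l < a.+1 * e j)%N -> row_image lam a l w = v l] <=
    (B ^+ a)^-1 * (B - 1)^-1.
Proof.
pose E := [set w | forall c : 'I_a.+1,
  \sum_(a' < a.+1) block lam a' *m rb a' c w = block v c].
have -> : [set w | forall l, (l < a.+1 * e j)%N -> row_image lam a l w = v l] = E.
  apply/seteqP; split => w /= h.
    move=> c; rewrite -block_row_image; apply/rowP => i; rewrite !mxE h//.
    apply: (@leq_trans (c.+1 * e j)); last by rewrite leq_mul2r ltn_ord orbT.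
    by rewrite mulSnr ltn_add2l.
  move=> l la.
  have ca : (l %/ e j < a.+1)%N by rewrite ltn_divLR.
  have := h (Ordinal ca); rewrite -block_row_image /=.
  move=> /rowP/(_ (Ordinal (ltn_pmod l e0))); rewrite !mxE /=.
  by rewrite -divn_eq.
pose W w := [ffun x : 'I_a * 'I_a.+1 => rb x.1 x.2 w].
have mW : finite_rv W by apply: finite_rv_ffun => x; exact: finite_rv_rblock.
(* Given that the block rows above [a] are [x], the event is that every block
   of these rows equals its value in [x] and that every block of the row [a]
   has the product with [block lam a] that remains to be made up. *)
pose A (x : {ffun 'I_a * 'I_a.+1 -> 'M['F_b]_(e j)}) (i : 'I_a.+1 * 'I_a.+1) :=
  [set w | if insub (val i.1) is Some a'
    then rb i.1 i.2 w == x (a', i.2)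
    else block lam a *m rb i.1 i.2 w ==
         block v i.2 - \sum_(a' < a) block lam a' *m x (a', i.2)].
have mA x i : measurable (A x i).
  rewrite /A; case: insub => [a'|].
    exact: (finite_rv_preimage [set m | m == x (a', i.2)]
      (finite_rv_rblock i.1 i.2)).
  exact: (finite_rv_preimage [set m | block lam a *m m ==
       block v i.2 - \sum_(a' < a) block lam a' *m x (a', i.2)]
      (finite_rv_rblock i.1 i.2)).
have insubw (a' : 'I_a) : insub (val (widen_ord (leqnSn a) a')) = Some a'.
  exact: valK.
have insubm : insub (val (@ord_max a)) = None :> option 'I_a.
  by rewrite insubF//= ltnn.
have EW x : E `&` W @^-1` [set x] = [set w | forall i, A x i w].
  apply/seteqP; split => w /=.
    move=> [Ew Wx] [a1 c]; rewrite /A/=.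
    case: insubP => [a' a'a a'E|].
      by rewrite -Wx ffunE /= a'E.
    rewrite -leqNgt => aa1; have {}aa1 : a1 = ord_max.
      apply/val_inj/eqP; rewrite eqn_leq /= -ltnS ltn_ord /=. exact: aa1.
    rewrite aa1 -(Ew c) big_ord_recr /= addrC.
    suff -> : \sum_(a' < a) block lam a' *m x (a', c) =
        \sum_(i < a) block lam i *m rb i c w by rewrite addrK.
    by apply: eq_bigr => i _; rewrite -Wx ffunE.
  move=> Aw; have Wx : W w = x.
    apply/ffunP => -[a' c]; rewrite ffunE /=.
    have := Aw (widen_ord (leqnSn a) a', c); rewrite /A insubw /=.
    by move=> /eqP.
  split => // c; rewrite big_ord_recr /=.
  have := Aw (ord_max, c); rewrite /A insubm /= => /eqP ->.
  suff -> : \sum_(a' < a) block lam a' *m x (a', c) =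
      \sum_(i < a) block lam i *m rb i c w by rewrite addrC subrK.
  by apply: eq_bigr => i _; rewrite -Wx ffunE.
have mE : measurable E.
  rewrite (_ : E = \bigcup_(x in [set: {ffun 'I_a * 'I_a.+1 -> 'M['F_b]_(e j)}])
    (E `&` W @^-1` [set x])).
    apply: fin_bigcup_measurable => [|x _]; first exact: finite_finset.
    by rewrite EW; exact: measurable_forall.
  by apply/seteqP; split => [w Ew|w [x _ []]]//; exists (W w).
rewrite (pr_split P mW mE).
pose f (i : 'I_a.+1 * 'I_a.+1) := (val i.1, val i.2).
have f_inj : injective f.
  by move=> [i i'] [k k'] [/val_inj -> /val_inj ->].
pose q (c : nat) : R := if (c < a)%N then B^-1 else (B - 1)^-1.
have prA x : pr P (E `&` W @^-1` [set x]) <=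
    (\prod_(i : 'I_a * 'I_a.+1) pr P [set w | rb i.1 i.2 w == x i]) * \prod_(c < a.+1) q c.
  rewrite EW (independent_pr (independent_inj f_inj (@matrix_indep _ _ _ _ _ _ _ _ _ cs j))).
  - have -> : \prod_i pr P (A x i) = \prod_c \prod_a1 pr P (A x (a1, c)).
      rewrite exchange_big pair_bigA. by apply: eq_bigr => -[].
    have -> : \prod_(i : 'I_a * 'I_a.+1) pr P [set w | rb i.1 i.2 w == x i] =
        \prod_(c < a.+1) \prod_(a' < a) pr P [set w | rb a' c w == x (a', c)].
      by rewrite exchange_big pair_bigA; apply: eq_bigr => -[].
    rewrite -big_split /=; apply: ler_prod => c _.
    rewrite prodr_ge0 => [|*]; last exact: pr_ge0.
    rewrite big_ord_recr /=; apply: ler_pM.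
    + by apply: prodr_ge0 => i _; rewrite pr_ge0.
    + exact: pr_ge0.
    + rewrite le_eqVlt; apply/orP; left; apply/eqP.
      by apply: eq_bigr => i _; rewrite /A insubw.
    + by rewrite /A insubm /=; apply: pr_block_mulmx_le; rewrite -ltnS ltn_ord.
  - move=> i; rewrite /A /=; case: insub => [a'|].
      by exists [set m | m == x (a', i.2)].
    by exists [set m | block lam a *m m ==
       block v i.2 - \sum_(a' < a) block lam a' *m x (a', i.2)].
  - exact: mA.
apply: le_trans (ler_sum _ (fun x _ => prA x)) _.
rewrite -mulr_suml -(bigA_distr_bigA (fun (i : 'I_a * 'I_a.+1) m => pr P [set w | rb i.1 i.2 w == m])).
rewrite big1 => [|i _]; last first.
  rewrite -(prT P) (pr_split P (finite_rv_rblock i.1 i.2)) //.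
  by apply: eq_bigr => m _; congr pr; apply/seteqP; split => w /=;
    [move=> /eqP|move=> [_ ->]].
rewrite mul1r big_ord_recr /= /q ltnn.
rewrite (eq_bigr (fun=> B^-1)) => [|c _]; last by rewrite ltn_ord.
by rewrite prodr_const card_ord exprVn.
Qed.

End RowLaw.

(** * Frequencies orthogonal to a scrambled net *)

Lemma sigma_of_family_finite_rv d (Om : measurableType d) (I : Type)
    (T : finType) (X : I -> Om -> T) i :
  @finite_rv _ (g_sigma_algebraType (\bigcup_i sigma_of (X i))) T (X i).
Proof.
move=> t; apply: sub_sigma_algebra; exists i => //.
by exists [set t].
Qed.

Lemma sigma_of_family_measurable d (Om : measurableType d) (I : Type)
    (T : finType) (X : I -> Om -> T) :
  (forall i, finite_rv (X i)) -> sigma_of_family X `<=` measurable.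
Proof.
move=> mX; apply: smallest_sub; first exact: sigma_algebra_measurable.
by move=> _ [i _ [B _ <-]]; exact: finite_rv_preimage.
Qed.

(** The least number of blocks of length [e] outside of which [lam] vanishes. *)
Lemma exists_top_block (F : fieldType) (e K : nat) (lam : nat -> F) :
  (0 < e)%N -> (forall k, (K <= k)%N -> lam k = 0) ->
  exists tau, [/\ (tau <= K)%N, forall k, lam k != 0 -> (k < tau * e)%N &
    (0 < tau)%N -> exists2 i, (i < e)%N & lam (tau.-1 * e + i)%N != 0].
Proof.
move=> e0 lam0.
pose Q t := `[< forall k, lam k != 0 -> (k < t * e)%N >].
have QK : Q K.
  apply/asboolP => k; apply: contraNT; rewrite -leqNgt => Kk.
  by apply/eqP/lam0/(leq_trans _ Kk); rewrite leq_pmulr.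
have exQ : exists t, Q t by exists K.
case: (ex_minnP exQ) => tau /asboolP Qtau tau_min.
exists tau; split; [exact: tau_min QK|exact: Qtau|].
case: tau Qtau tau_min => // t Qt t_min _ /=.
apply: contrapT => none; have : Q t.
  apply/asboolP => k lamk; have kt := Qt k lamk; rewrite ltnNge; apply/negP => tk.
  apply: none; exists (k - t * e)%N; last by rewrite subnKC.
  by rewrite ltn_subLR// addnC -mulSn.
by move/t_min; rewrite ltnn.
Qed.

Lemma eq_sum_support (V : nmodType) (f : nat -> V) n m :
  (forall k, (n <= k)%N || (m <= k)%N -> f k = 0) ->
  \sum_(k < n) f k = \sum_(k < m) f k.
Proof.
move=> f0.
have h t : (t <= n + m)%N -> (forall k, (t <= k)%N -> f k = 0) ->
    \sum_(k < t) f k = \sum_(k < n + m) f k.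
  move=> tnm ft; rewrite (big_ord_widen _ _ tnm) big_mkcond; apply: eq_bigr => k _.
  by case: ltnP => // tk; rewrite ft.
transitivity (\sum_(k < n + m) f k).
  by apply: h (leq_addr _ _) _ => k nk; rewrite f0// nk.
by apply/esym/h => [|k mk]; rewrite ?leq_addl// f0// mk orbT.
Qed.

Section ScrambledMatrix.
Context d (Om : measurableType d) (R : realType) (P : probability Om R).
Variables (b s : nat) (S : GNS b s).
Hypothesis pb : prime b.
Local Notation e := (gns_deg S).
Variables (D : 'I_s -> nat -> Om -> 'F_b) (M : 'I_s -> nat -> nat -> Om -> 'F_b).
Hypothesis cs : coarse_scrambling P e D M.

Lemma finite_rv_shift j k : finite_rv (D j k).
Proof. exact: uniform_on_finite_rv (shift_uniform cs j k). Qed.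

Lemma finite_rv_matrix j k l : finite_rv (M j k l).
Proof. exact: (finite_rv_entry cs (gns_deg_gt0 S j)). Qed.

Lemma sigma_shift_measurable j : sigma_shift D j `<=` measurable.
Proof. by apply: sigma_of_family_measurable => k; exact: finite_rv_shift. Qed.

Lemma sigma_matrix_measurable j : sigma_matrix M j `<=` measurable.
Proof. by apply: sigma_of_family_measurable => k; exact: finite_rv_matrix. Qed.

Lemma shift_matrix_pr (A B : 'I_s -> set Om) :
  (forall j, sigma_shift D j (A j)) -> (forall j, sigma_matrix M j (B j)) ->
  pr P [set w | forall j, A j w /\ B j w] =
  (\prod_j pr P (A j)) * \prod_j pr P (B j).
Proof.
move=> sA sB.
pose AB (i : 'I_s + 'I_s) := match i with inl j => A j | inr j => B j end.
have := @independent_pr _ _ _ P _ _ AB (@shift_matrix_indep _ _ _ _ _ _ _ _ _ cs).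
rewrite big_sumType => <-.
- congr pr; apply/seteqP; split => w /= h.
    by case=> j /=; have [] := h j.
  by move=> j; split; [exact: (h (inl j))|exact: (h (inr j))].
- by case.
- by case=> j; [exact: (sigma_shift_measurable (sA j))|
    exact: (sigma_matrix_measurable (sB j))].
Qed.

Lemma sigma_shiftT j : sigma_shift D j setT.
Proof. exact: (@measurableT _ (g_sigma_algebraType _)). Qed.

Lemma matrix_pr (B : 'I_s -> set Om) : (forall j, sigma_matrix M j (B j)) ->
  pr P [set w | forall j, B j w] = \prod_j pr P (B j).
Proof.
move=> sB; have := shift_matrix_pr sigma_shiftT sB.
rewrite big1 ?mul1r => [<-|j _]; last exact: prT.
by congr pr; apply/seteqP; split => w /= h j //; have [] := h j.
Qed.

Section Truncation.
Variables (K m : nat).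

Definition shift_digits w : {ffun 'I_s * 'I_K -> 'F_b} :=
  [ffun x : 'I_s * 'I_K => D x.1 x.2 w].

Definition scrambled_entry j k r w : 'F_b :=
  \sum_(l < ((k %/ e j).+1 * e j)%N) M j k l w * gns_C S j l r.

Definition scrambled_matrix w : {ffun ('I_s * 'I_K) * 'I_m -> 'F_b} :=
  [ffun x : ('I_s * 'I_K) * 'I_m => scrambled_entry x.1.1 x.1.2 x.2 w].

Lemma finite_rv_shift_digits : finite_rv shift_digits.
Proof. by apply: finite_rv_ffun => x; exact: finite_rv_shift. Qed.

Lemma finite_rv_scrambled_entry_sigma j k r :
  @finite_rv _ (g_sigma_algebraType
    (\bigcup_(kl : nat * nat) sigma_of (M j kl.1 kl.2))) _ (scrambled_entry j k r).
Proof.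
apply: finite_rv_sum => l.
apply: (finite_rv_comp (fun x => x * gns_C S j l r)).
exact: (@sigma_of_family_finite_rv _ _ _ _ (fun kl : nat * nat => M j kl.1 kl.2)
  (k, val l)).
Qed.

Lemma finite_rv_scrambled_matrix : finite_rv scrambled_matrix.
Proof.
apply: finite_rv_ffun => x; apply: finite_rv_sum => l.
apply: (finite_rv_comp (fun y => y * gns_C S x.1.1 l x.2)).
exact: finite_rv_matrix.
Qed.

Lemma pr_shift_digits_row j (z : 'I_K -> 'F_b) :
  pr P [set w | forall k : 'I_K, D j k w = z k] = (b%:R ^+ K)^-1.
Proof.
rewrite (independent_pr (independent_inj val_inj (@shift_indep _ _ _ _ _ _ _ _ _ cs j))).
- rewrite (eq_bigr (fun=> b%:R^-1)) => [|k _].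
    by rewrite prodr_const card_ord exprVn.
  rewrite /pr (shift_uniform cs j k (z k)).2 /= inE cardsT card_Fp//.
  by rewrite mul1r.
- by move=> k; exists [set z k].
- by move=> k; exact: finite_rv_shift.
Qed.

(** The shift is uniform given the matrix. *)
Lemma pr_matrix_shift g z :
  pr P (scrambled_matrix @^-1` [set g] `&` shift_digits @^-1` [set z]) =
  pr P (scrambled_matrix @^-1` [set g]) / #|{ffun 'I_s * 'I_K -> 'F_b}|%:R.
Proof.
pose A j := [set w | forall k : 'I_K, D j k w = z (j, k)].
pose B j := [set w | forall k : 'I_K, forall r : 'I_m,
  scrambled_entry j k r w = g ((j, k), r)].
have sA j : sigma_shift D j (A j).
  apply: (@measurable_forall _ (g_sigma_algebraType _)) => k.
  exact: (@sigma_of_family_finite_rv _ _ _ _ (D j)).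
have sB j : sigma_matrix M j (B j).
  apply: (@measurable_forall _ (g_sigma_algebraType _)) => k.
  apply: (@measurable_forall _ (g_sigma_algebraType _)) => r.
  exact: finite_rv_scrambled_entry_sigma.
have -> : scrambled_matrix @^-1` [set g] = [set w | forall j, B j w].
  apply/seteqP; split => w /=; first by move=> Wg j k r; rewrite -Wg ffunE.
  by move=> h; apply/ffunP => -[[j k] r]; rewrite ffunE; exact: h.
have -> : shift_digits @^-1` [set z] = [set w | forall j, A j w].
  apply/seteqP; split => w /=; first by move=> Dz j k; rewrite -Dz ffunE.
  by move=> h; apply/ffunP => -[j k]; rewrite ffunE; exact: h.
have -> : [set w | forall j, B j w] `&` [set w | forall j, A j w] =
    [set w | forall j, A j w /\ B j w].
  apply/seteqP; split => w /=; first by case=> hB hA j.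
  by move=> h; split => j; have [] := h j.
rewrite shift_matrix_pr// matrix_pr// mulrC; congr (_ * _).
rewrite (eq_bigr (fun=> (b%:R ^+ K)^-1)) => [|j _]; last exact: pr_shift_digits_row.
rewrite prodr_const card_ord exprVn -exprM; congr (_^-1).
rewrite -natrX; congr (_%:R).
have := card_ffun ('I_s * 'I_K)%type 'F_b; rewrite card_Fp// card_prod !card_ord => ->.
by rewrite mulnC.
Qed.

Definition row_product (lam : {ffun 'I_s * 'I_K -> 'F_b}) j l w : 'F_b :=
  \sum_(k < K) lam (j, k) * M j k l w.

(** Orthogonality of [lam] to the columns of the products of the random and the
    generating matrices is orthogonality of the products [kap] of [lam] with the
    random matrices to the columns of the generating matrices. Apart from values
    of probability zero, [kap] has the support and the nonzero top blocks that
    are counted by [gns_count], and each of its values has probability at most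
    [C / b ^ n] by [pr_row_image_le]. *)
Lemma pr_col_orth_le (C : R) (lam : {ffun 'I_s * 'I_K -> 'F_b}) :
  lam != 0 ->
  (forall Q : pred 'I_s,
     \prod_(j | Q j) (b%:R ^+ e j / (b%:R ^+ e j - 1)) <= C) ->
  pr P [set w | col_orth (scrambled_matrix w) lam] <= C / b%:R ^+ m.
Proof.
move=> lam0 CP.
(* Enough columns to contain the support of the first [K] rows for all [j]. *)
pose L := (K * \sum_j e j)%N.
have eE j : (e j <= \sum_j e j)%N by rewrite (bigD1 j)//= leq_addr.
pose la j k := if insub k is Some k' then lam (j, k') else 0.
have laE j (k : 'I_K) : la j k = lam (j, k) by rewrite /la valK.
have la0 j k : (K <= k)%N -> la j k = 0.
  by move=> Kk; rewrite /la insubF// ltnNge Kk.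
have [tau tauP] := choice (fun j =>
  exists_top_block (gns_deg_gt0 S j) (la0 j)).
have tauK j : (tau j <= K)%N by have [] := tauP j.
have la_tau j k : (tau j * e j <= k)%N -> la j k = 0.
  move=> tk; apply/eqP; have [_ h _] := tauP j.
  by apply: contraTT tk => /h; rewrite -ltnNge.
have tauL j : (tau j * e j <= L)%N by rewrite leq_mul.
have tau_pos : exists j, (0 < tau j)%N.
  apply: contrapT => none; move/eqP: lam0; apply.
  apply/ffunP => -[j k]; rewrite ffunE -laE la_tau//.
  have : ~~ (0 < tau j)%N by apply/negP => tj; apply: none; exists j.
  by rewrite -eqn0Ngt => /eqP ->.
have rowE j w l : row_product lam j l w =
    \sum_(k < (tau j * e j)%N) la j k * M j k l w.
  rewrite /row_product; under eq_bigr do rewrite -laE.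
  apply: (@eq_sum_support _ (fun k => la j k * M j k l w)) => k /orP[Kk|tk].
    by rewrite la0 ?mul0r.
  by rewrite la_tau ?mul0r.
have row_imageE j a l w : tau j = a.+1 ->
    row_product lam j l w = row_image e M j (la j) a l w.
  by move=> ta; rewrite rowE ta.
have blockN0 j a : tau j = a.+1 -> block e j (la j) a != 0.
  move=> ta; have [_ _ ] := tauP j; rewrite ta => /(_ isT) [i ie h].
  apply: contra h => /eqP/rowP/(_ (Ordinal ie)); rewrite !mxE /= => ->.
  by [].
pose kap w : {ffun 'I_s * 'I_L -> 'F_b} :=
  [ffun x : 'I_s * 'I_L => row_product lam x.1 x.2 w].
have mrow_sigma j l : @finite_rv _ (g_sigma_algebraType
    (\bigcup_(kl : nat * nat) sigma_of (M j kl.1 kl.2))) _ (row_product lam j l).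
  apply: finite_rv_sum => k; apply: (finite_rv_comp (fun x => lam (j, k) * x)).
  exact: (@sigma_of_family_finite_rv _ _ _ _
    (fun kl : nat * nat => M j kl.1 kl.2) (val k, l)).
have mkap : finite_rv kap.
  apply: finite_rv_ffun => x; apply: finite_rv_sum => k.
  apply: (finite_rv_comp (fun y => lam (x.1, k) * y)); exact: finite_rv_matrix.
have orthE w : col_orth (scrambled_matrix w) lam = orthogonal_columns S m (kap w).
  apply: eq_forallb => r; congr (_ == _).
  transitivity (\sum_j \sum_(k < K) lam (j, k) * scrambled_matrix w ((j, k), r)).
    by rewrite pair_bigA; apply: eq_bigr => -[].
  transitivity (\sum_j \sum_(l < L) kap w (j, l) * gns_C S j l r); last first.
    by rewrite pair_bigA; apply: eq_bigr => -[].
  apply: eq_bigr => j _.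
  under [RHS]eq_bigr do rewrite ffunE mulr_suml /=.
  rewrite exchange_big /=; apply: eq_bigr => k _.
  under [RHS]eq_bigr do rewrite -mulrA.
  rewrite -mulr_sumr ffunE /=; congr (_ * _).
  apply: (@eq_sum_support _ (fun l => M j k l w * gns_C S j l r)).
  have kK : ((k %/ e j).+1 * e j <= L)%N.
    by rewrite leq_mul// (leq_ltn_trans (leq_div _ _)).
  move=> l kl; rewrite (matrix_lower cs) ?mul0r//.
  rewrite leq_divRL ?gns_deg_gt0//.
  by case/orP: kl => // /(leq_trans kK).
have -> : [set w | col_orth (scrambled_matrix w) lam] =
    [set w | orthogonal_columns S m (kap w)].
  by apply/seteqP; split => w /=; rewrite orthE.
rewrite (pr_preimage _ _ mkap).
pose n := (\sum_j tau j * e j)%N.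
have b_gt1 : 1 < b%:R :> R by rewrite ltr1n prime_gt1.
have b_gt0 : 0 < b%:R :> R by rewrite (lt_trans ltr01).
have B1 j : 1 < b%:R ^+ e j :> R by rewrite exprn_egt1// -lt0n gns_deg_gt0.
pose good (v : {ffun 'I_s * 'I_L -> 'F_b}) := [&& block_supported S tau v, orthogonal_columns S m v &
  top_block_neq0 S tau v].
have prod_pr (v : {ffun 'I_s * 'I_L -> 'F_b}) : pr P (kap @^-1` [set v]) =
    \prod_j pr P [set w | forall l : 'I_L, row_product lam j l w = v (j, l)].
  rewrite -matrix_pr; last first.
    move=> j; apply: (@measurable_forall _ (g_sigma_algebraType _)) => l.
    exact: mrow_sigma.
  congr pr; apply/seteqP; split => w /=; first by move=> <- j l; rewrite ffunE.
  by move=> h; apply/ffunP => -[j l]; rewrite ffunE; exact: h.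
have mrow j (v : {ffun 'I_s * 'I_L -> 'F_b}) : measurable
    [set w | forall l : 'I_L, row_product lam j l w = v (j, l)].
  apply: measurable_forall => l; apply: finite_rv_sum => k.
  by apply: (finite_rv_comp (fun y => lam (j, k) * y)); exact: finite_rv_matrix.
have bad (v : {ffun 'I_s * 'I_L -> 'F_b}) : orthogonal_columns S m v -> ~~ good v ->
    pr P (kap @^-1` [set v]) = 0.
  move=> vo; rewrite /good vo /= negb_and => /orP[|].
    move=> /forallPn/= [[j l]]; rewrite negb_imply /= => /andP[tl vjl].
    rewrite -[RHS](pr0 P); congr pr; apply/seteqP; split => // w /= kv.
    move/eqP: vjl; apply; rewrite -kv ffunE /= rowE big1// => k _.
    rewrite (matrix_lower cs) ?mulr0// (@leq_trans (tau j))//.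
      by rewrite ltn_divLR ?gns_deg_gt0.
    by rewrite leq_divRL ?gns_deg_gt0.
  move=> /forallPn/= [j]; rewrite negb_imply => /andP[tj /existsPn vt].
  rewrite prod_pr (bigD1 j)//=; case E : (tau j) tj => [//|a] _.
  suff -> : pr P [set w | forall l : 'I_L, row_product lam j l w = v (j, l)] = 0.
    by rewrite mul0r.
  apply/eqP; rewrite eq_le pr_ge0 andbT.
  rewrite -(pr_row_image_top0 cs (gns_deg_gt0 S j) (blockN0 j a E)).
  apply: le_pr => //.
    rewrite (_ : [set w | _] = [set w | forall i : 'I_(e j),
        row_image e M j (la j) a (a * e j + i) w = 0]).
      apply: measurable_forall => i.
      exact: (finite_rv_row_image cs (gns_deg_gt0 S j) (la j) a _ 0).
    apply/seteqP; split => w /=.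
      by move=> /eqP/rowP + i => /(_ i); rewrite !mxE.
    by move=> h; apply/eqP/rowP => i; rewrite !mxE.
  move=> w /= h; apply/eqP/rowP => i; rewrite !mxE -row_imageE//.
  have lL : (a * e j + i < L)%N.
    by apply: leq_trans (tauL j); rewrite E mulSnr ltn_add2l.
  rewrite (h (Ordinal lL)); apply/eqP; have := vt (Ordinal lL).
  by rewrite E /= leq_addr /= negbK.
(* Coordinates with [tau j = 0] contribute the trivial bound 1 and no factor. *)
pose Bn : R := \prod_j (b%:R ^+ e j) ^+ tau j.
have BnE : Bn = b%:R ^+ n.
  rewrite /n -prodrXr; apply: eq_bigr => j _; rewrite -exprM mulnC.
  by [].
have Bn0 : 0 < Bn by rewrite BnE exprn_gt0.
have bound (v : {ffun 'I_s * 'I_L -> 'F_b}) : pr P (kap @^-1` [set v]) <= C / Bn.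
  rewrite prod_pr.
  have := CP (fun j => (0 < tau j)%N) => CPt.
  apply: (@le_trans _ _ ((\prod_(j | (0 < tau j)%N)
    (b%:R ^+ e j / (b%:R ^+ e j - 1))) / Bn)); last first.
    by rewrite ler_pM2r ?invr_gt0.
  rewrite /Bn -prodfV [X in _ <= X * _]big_mkcond -big_split /=.
  apply: ler_prod => j _; rewrite pr_ge0 /=.
  case E : (tau j) => [|a]; first by rewrite expr0 mul1r invr1 pr_le1.
  have -> : b%:R ^+ e j / (b%:R ^+ e j - 1) * (b%:R ^+ e j ^+ a.+1)^-1 =
      ((b%:R ^+ e j) ^+ a)^-1 * (b%:R ^+ e j - 1)^-1 :> R.
    have B0 : b%:R ^+ e j != 0 :> R by rewrite gt_eqF ?exprn_gt0.
    by rewrite exprS invfM mulrA [_ / (_ - _) / _]mulrAC divff// mul1r mulrC.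
  pose vj l := if insub l is Some l' then v (j, l') else 0.
  apply: le_trans (pr_row_image_le pb cs (gns_deg_gt0 S j) (blockN0 j a E) vj).
  apply: le_pr => //.
    rewrite (_ : [set w | _] = [set w | forall l : 'I_(a.+1 * e j),
        row_image e M j (la j) a l w = vj l]).
      apply: measurable_forall => i.
      exact: (finite_rv_row_image cs (gns_deg_gt0 S j) (la j) a _ _).
    by apply/seteqP; split => w /= h l; [exact: h|move=> la'; exact: (h (Ordinal la'))].
  move=> w /= h l la'.
  have lL : (l < L)%N by apply: leq_trans (tauL j); rewrite E.
  by rewrite -row_imageE// (h (Ordinal lL)) /vj insubT.
have C0 : 0 <= C.
  have := CP pred0; rewrite big_pred0_eq; exact: le_trans.
rewrite (bigID good) /= [X in _ + X]big1 ?addr0; last first.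
  by move=> v /andP[vo vg]; exact: bad.
apply: (@le_trans _ _ (\sum_(v | good v) C / Bn)).
  rewrite big_mkcond [leRHS]big_mkcond /=; apply: ler_sum => v _.
  case: ifP => [/andP[_ ->] //|_]; case: ifP => // _.
  by rewrite divr_ge0// ltW.
rewrite sumr_const -[leLHS]mulr_natl.
have := gns_count m pb tauL tau_pos.
rewrite (_ : #|[set _ | _]%SET| = #|[pred v | good v]|); last first.
  by apply: eq_card => v; rewrite !inE.
rewrite -(ler_nat R) natrM !natrX -/n -BnE => cnt.
rewrite ler_pdivlMr ?exprn_gt0// mulrAC mulrA ler_pdivrMr// mulrC.
by rewrite ler_wpM2l.
Qed.

End Truncation.
End ScrambledMatrix.

(** * Digits of scrambled points and their second moments *)

Section Digits.
Variable b : nat.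
Hypothesis pb : prime b.

Lemma val_bdigit n i : nat_of_ord (bdigit b n i) = ((n %/ b ^ i) %% b)%N.
Proof. by rewrite /bdigit val_Fp_nat// modn_mod. Qed.

Lemma bdigit_small n i : (n < b ^ i)%N -> bdigit b n i = 0.
Proof. by move=> ni; apply/val_inj; rewrite /= val_bdigit divn_small// mod0n. Qed.

Definition digit_vector m n : {ffun 'I_m -> 'F_b} := [ffun i => bdigit b n (val i)].

Lemma digit_vector_inj m n n' : (n < b ^ m)%N -> (n' < b ^ m)%N ->
  digit_vector m n = digit_vector m n' -> n = n'.
Proof.
have b0 := prime_gt0 pb.
suff h : forall m n n', (n < b ^ m)%N -> (n' < b ^ m)%N ->
    (forall i, (i < m)%N -> ((n %/ b ^ i) %% b = (n' %/ b ^ i) %% b)%N) -> n = n'.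
  move=> nm n'm nn'; apply: (h m) => // i im.
  have := congr1 (fun f : {ffun _ -> _} => f (Ordinal im)) nn'.
  by rewrite !ffunE /= => /(congr1 val) /=; rewrite !val_bdigit.
elim=> [|{}m IH] {}n {}n'; first by rewrite expn0 !ltnS !leqn0 => /eqP -> /eqP ->.
move=> nm n'm nn'.
rewrite (divn_eq n b) (divn_eq n' b); congr (_ * _ + _)%N; last first.
  by have := nn' 0%N isT; rewrite expn0 !divn1.
apply: IH => [||i im]; rewrite ?ltn_divLR -?expnSr//.
by rewrite -!divnMA -expnS; exact: nn'.
Qed.

Lemma sum_digit_vector (V : nmodType) m (f : {ffun 'I_m -> 'F_b} -> V) :
  \sum_(0 <= n < (b ^ m)%N) f (digit_vector m n) = \sum_x f x.
Proof.
rewrite big_mkord.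
have inj : injective (fun n : 'I_(b ^ m) => digit_vector m n).
  by move=> n n' /digit_vector_inj nn'; apply/val_inj/nn'.
have card_eq : (#|{ffun 'I_m -> 'F_b}| <= #|'I_(b ^ m)|)%N.
  have := card_ffun 'I_m 'F_b; rewrite (card_Fp pb) !card_ord => ->.
  exact: leqnn.
rewrite [RHS](reindex (fun n : 'I_(b ^ m) => digit_vector m n))//.
exact/onW_bij/inj_card_bij.
Qed.

Lemma digit_mulvE m (C : nat -> nat -> 'F_b) n k : (n < b ^ m)%N ->
  digit_mulv C n k = \sum_(r < m) C k r * bdigit b n r.
Proof.
move=> nm; apply: (@eq_sum_support _ (fun r => C k r * bdigit b n r)) => r.
move=> h; rewrite bdigit_small ?mulr0//.
case/orP: h => [nr|mr]; last by rewrite (leq_trans nm)// leq_exp2l// prime_gt1.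
by rewrite (leq_ltn_trans nr)// ltn_expl// prime_gt1.
Qed.

End Digits.

Section SecondMoment.
Context d (Om : measurableType d) (R : realType) (P : probability Om R).
Variables (b s : nat) (S : GNS b s).
Hypothesis pb : prime b.
Local Notation e := (gns_deg S).
Variables (D : 'I_s -> nat -> Om -> 'F_b) (M : 'I_s -> nat -> nat -> Om -> 'F_b).
Hypothesis cs : coarse_scrambling P e D M.
Variables (m : nat).

Definition scrambled_digit n j k w : 'F_b :=
  lower_mulv (e j) (fun k l => M j k l w) (digit_mulv (gns_C S j) n) k + D j k w.

Definition scrambled_digits n K w : {ffun 'I_s * 'I_K -> 'F_b} :=
  [ffun x : 'I_s * 'I_K => scrambled_digit n x.1 x.2 w].

Lemma scrambled_digitsE n K w : (n < b ^ m)%N ->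
  scrambled_digits n K w =
  lin_image (scrambled_matrix S M K m w) (digit_vector b m n) +
    shift_digits D K w.
Proof.
move=> nm; apply/ffunP => -[j k]; rewrite !ffunE /scrambled_digit /=.
congr (_ + _); rewrite /lower_mulv.
under [LHS]eq_bigr => l _.
  rewrite (digit_mulvE pb _ _ nm) mulr_sumr; over.
rewrite exchange_big /=; apply: eq_bigr => r _.
rewrite !ffunE /= /scrambled_entry mulr_suml; apply: eq_bigr => l _.
by rewrite mulrA.
Qed.

Let V K := {ffun 'I_s * 'I_K -> 'F_b}.

Let cardV_gt0 K : 0 < #|V K|%:R :> R.
Proof. by rewrite ltr0n; apply/card_gt0P; exists 0. Qed.

Lemma finite_rv_scrambled_digits n K : (n < b ^ m)%N ->
  finite_rv (scrambled_digits n K).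
Proof.
move=> nm; rewrite (_ : scrambled_digits n K = fun w => (fun x =>
  lin_image x.1 (digit_vector b m n) + x.2)
  (scrambled_matrix S M K m w, shift_digits D K w)); last first.
  by apply/funext => w; exact: scrambled_digitsE.
apply: (finite_rv_comp (fun x : {ffun ('I_s * 'I_K) * 'I_m -> 'F_b} * V K =>
  lin_image x.1 (digit_vector b m n) + x.2)).
apply: finite_rv_pair; first exact: (finite_rv_scrambled_matrix cs).
exact: (finite_rv_shift_digits cs).
Qed.

(** The independent uniform shift makes the digits of each point uniform. *)
Lemma pr_scrambled_digits n K z : (n < b ^ m)%N ->
  pr P (scrambled_digits n K @^-1` [set z]) = #|V K|%:R^-1.
Proof.
move=> nm; have mW := @finite_rv_scrambled_matrix _ _ _ _ _ _ S _ _ cs K m.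
rewrite (pr_split P mW); last exact: finite_rv_scrambled_digits.
transitivity (\sum_g pr P (scrambled_matrix S M K m @^-1` [set g]) / #|V K|%:R).
  apply: eq_bigr => g _.
  rewrite -(pr_matrix_shift pb cs g (z - lin_image g (digit_vector b m n))).
  congr pr; apply/seteqP; split => w /=; rewrite scrambled_digitsE//.
    by move=> [<- <-]; rewrite addrC addKr.
  by move=> [-> ->]; rewrite addrC subrK.
rewrite -mulr_suml; under eq_bigr do rewrite -[_ @^-1` _]setTI.
by rewrite -(pr_split P mW)// prT mul1r.
Qed.

(** The shift turns the square into the energies of [h] at the frequencies
    orthogonal to the columns of the matrix [g]. Taking probabilities, the
    frequency zero gives the squared mean, the others at most [C / b ^ m] times
    their total energy. *)
Lemma second_moment_le (C : R) K (h : V K -> R) :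
  (forall Q : pred 'I_s,
     \prod_(j | Q j) (b%:R ^+ e j / (b%:R ^+ e j - 1)) <= C) ->
  \sum_g \sum_z pr P (scrambled_matrix S M K m @^-1` [set g] `&`
                      shift_digits D K @^-1` [set z]) *
     ((b%:R ^+ m)^-1 * \sum_x h (lin_image g x + z)) ^+ 2 <=
  (#|V K|%:R^-1 * \sum_z h z) ^+ 2 +
  C / b%:R ^+ m * (#|V K|%:R^-1 * \sum_z h z ^+ 2).
Proof.
move=> CP.
have cm : #|{ffun 'I_m -> 'F_b}|%:R = b%:R ^+ m :> R.
  rewrite -natrX; congr (_%:R).
  by have := card_ffun 'I_m 'F_b; rewrite (card_Fp pb) card_ord.
have bm0 : b%:R ^+ m != 0 :> R by rewrite expf_neq0// pnatr_eq0 -lt0n prime_gt0.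
have V0 := lt0r_neq0 (cardV_gt0 K).
pose pg g := pr P (scrambled_matrix S M K m @^-1` [set g]).
have -> : \sum_g \sum_z pr P (scrambled_matrix S M K m @^-1` [set g] `&`
    shift_digits D K @^-1` [set z]) *
     ((b%:R ^+ m)^-1 * \sum_x h (lin_image g x + z)) ^+ 2 =
  \sum_mu pr P [set w | col_orth (scrambled_matrix S M K m w) mu] *
    (#|V K|%:R ^- 2 * line_energy mu h).
  transitivity (\sum_g \sum_(mu | col_orth g mu) pg g *
      (#|V K|%:R ^- 2 * line_energy mu h)).
    apply: eq_bigr => g _.
    under eq_bigr do rewrite (pr_matrix_shift pb cs).
    rewrite -!mulr_sumr -mulrA; congr (_ * _).
    under eq_bigr do rewrite exprMn.
    rewrite -mulr_sumr; apply: (mulfI V0); apply: (mulfI V0).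
    apply: (mulfI (expf_neq0 2 bm0)).
    have := coset_average_energy pb g h; rewrite cm => ce.
    rewrite [LHS](_ : _ = #|V K|%:R * (\sum_z (\sum_x h (lin_image g x + z)) ^+ 2) *
       ((b%:R ^+ m) ^+ 2 * (b%:R ^+ m) ^- 2) * (#|V K|%:R / #|V K|%:R)); last first.
      by rewrite exprVn; ring.
    rewrite ce (mulfV V0) (mulfV (expf_neq0 2 bm0)) !mulr1; congr (_ * _).
    by rewrite !mulrA -expr2 mulfV ?mul1r// expf_neq0.
  rewrite (exchange_big_dep xpredT)//=; apply: eq_bigr => mu _.
  rewrite -mulr_suml; congr (_ * _).
  rewrite (pr_preimage P (fun g => col_orth g mu))//.
  exact: (finite_rv_scrambled_matrix cs).
have e0 mu : 0 <= #|V K|%:R ^- 2 * line_energy mu h.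
  by rewrite mulr_ge0 ?line_energy_ge0// invr_ge0 exprn_ge0.
have morth mu : measurable [set w | col_orth (scrambled_matrix S M K m w) mu].
  exact: (finite_rv_preimage [set g | col_orth g mu]
    (@finite_rv_scrambled_matrix _ _ _ _ _ _ S _ _ cs K m)).
have C0 : 0 <= C / b%:R ^+ m.
  by rewrite divr_ge0// (le_trans _ (CP pred0)) ?big_pred0_eq.
rewrite (bigD1 (0 : V K))//=; apply: lerD.
  rewrite line_energy0// exprMn exprVn -[leRHS]mul1r.
  apply: ler_wpM2r; last exact: pr_le1.
  by rewrite mulr_ge0 ?sqr_ge0// invr_ge0 exprn_ge0.
apply: (@le_trans _ _ (\sum_mu C / b%:R ^+ m *
    (#|V K|%:R ^- 2 * line_energy mu h))).
  rewrite [leRHS](bigD1 (0 : V K))//= ler_wpDl//.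
    by apply: mulr_ge0 (e0 0).
  apply: ler_sum => mu mu0; apply: ler_wpM2r; first exact: e0.
  exact: (pr_col_orth_le pb cs).
rewrite -!mulr_sumr sum_line_energy// ler_wpM2l//.
rewrite mulrA (_ : #|V K|%:R ^- 2 * _ = #|V K|%:R^-1)//.
by rewrite expr2 invfM -mulrA (mulVf V0) mulr1.
Qed.

End SecondMoment.

(** * Real numbers and strings of digits *)

Section Phi.
Variables (R : realType) (b : nat).
Hypothesis pb : prime b.

Let b1 : (1 < b)%N := prime_gt1 pb.
Let b0 : (0 < b)%N := prime_gt0 pb.
Let bR0 : 0 < b%:R :> R. Proof. by rewrite ltr0n. Qed.
Let bX0 K : 0 < b%:R ^+ K :> R. Proof. by rewrite exprn_gt0. Qed.

(** The integer part of [b ^ K] times the number with digits [z], disregarding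
    the carry of an infinite tail of digits [b - 1]. *)
Fixpoint digit_int (z : nat -> 'F_b) K : nat :=
  if K is K'.+1 then (b * digit_int z K' + z K')%N else 0%N.

Lemma ltn_Fp (x : 'F_b) : (x < b)%N.
Proof. by rewrite -[X in (_ < X)%N](Fp_cast pb) ltn_ord. Qed.

Lemma digit_int_lt z K : (digit_int z K < b ^ K)%N.
Proof.
elim: K => // K IH /=; rewrite expnS.
apply: (@leq_trans (b * (digit_int z K).+1)); last by rewrite leq_mul2l IH orbT.
by rewrite mulnS addnC ltn_add2r ltn_Fp.
Qed.

Lemma eq_digit_int z z' K : (forall k, (k < K)%N -> z k = z' k) ->
  digit_int z K = digit_int z' K.
Proof.
elim: K => // K IH zz' /=; rewrite IH => [|k kK]; last by rewrite zz'// ltnW.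
by rewrite zz'.
Qed.

Lemma digit_int_inj z z' K : digit_int z K = digit_int z' K ->
  forall k, (k < K)%N -> z k = z' k.
Proof.
elim: K => // K IH /= zz' k.
have zK : z K = z' K :> nat.
  have := congr1 (modn^~ b) zz'.
  by rewrite !(mulnC b) !modnMDl !modn_small ?ltn_Fp.
have {}zz' : digit_int z K = digit_int z' K.
  by move: zz'; rewrite zK => /addIn/eqP; rewrite eqn_pmul2l// => /eqP.
by rewrite ltnS leq_eqVlt => /predU1P[->|/(IH zz')//]; exact/val_inj.
Qed.

Lemma series_digit_int z K :
  series (fun r => (nat_of_ord (z r))%:R / b%:R ^+ r.+1 : R) K =
  (digit_int z K)%:R / b%:R ^+ K.
Proof.
rewrite /series /=; elim: K => [|K IH]; first by rewrite big_geq// mul0r.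
rewrite big_nat_recr//= IH natrD natrM mulrDl; congr (_ + _).
by rewrite exprS invfM mulrACA divff ?mul1r// gt_eqF.
Qed.

Let u z K : R := (digit_int z K)%:R / b%:R ^+ K.

Let u_nd z : nondecreasing_seq (u z).
Proof.
apply/nondecreasing_seqP => K; rewrite /u -!series_digit_int /series /=.
by rewrite big_nat_recr//= lerDl divr_ge0// exprn_ge0// ltW.
Qed.

Let v_ni z : nonincreasing_seq (fun K => (digit_int z K).+1%:R / b%:R ^+ K : R).
Proof.
apply/nonincreasing_seqP => K /=; rewrite exprS.
rewrite ler_pdivrMr ?mulr_gt0// mulrA.
rewrite [X in _ <= X * _]mulrC mulrA mulfVK ?gt_eqF// -natrM ler_nat.
by rewrite mulnS addnC -addSn leq_add2r ltn_Fp.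
Qed.

Let u_le_v z n K : u z n <= (digit_int z K).+1%:R / b%:R ^+ K.
Proof.
have h k : u z k <= (digit_int z k).+1%:R / b%:R ^+ k.
  by rewrite /u ler_pM2r ?invr_gt0// ler_nat.
have [nK|Kn] := leqP n K.
  by apply: le_trans (h K); exact: u_nd.
by apply: le_trans (h n) _; apply: v_ni; exact: ltnW.
Qed.

Let phiE z : phi R z = limn (u z).
Proof. by rewrite /phi; congr (lim (_ @ \oo)); apply/funext => K; rewrite series_digit_int. Qed.

Lemma cvg_digit_int z :
  (digit_int z K)%:R / b%:R ^+ K @[K --> \oo] --> (phi R z : R).
Proof.
rewrite phiE; apply: nondecreasing_is_cvgn; first exact: u_nd.
by exists ((digit_int z 0).+1%:R / b%:R ^+ 0) => _ [n _ <-]; exact: u_le_v.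
Qed.

(** The upper end is attained by digit sequences that end in [b - 1]. *)
Lemma phi_itv z K :
  (digit_int z K)%:R / b%:R ^+ K <= phi R z <=
  (digit_int z K).+1%:R / b%:R ^+ K.
Proof.
have cu := @cvg_digit_int z.
rewrite -(cvg_lim _ cu)//; apply/andP; split.
  by apply: (nondecreasing_cvgn_le (u_nd z)); apply/cvg_ex; exists (phi R z).
apply: limr_le; first by apply/cvg_ex; exists (phi R z).
by near=> n; exact: u_le_v.
Unshelve. all: by end_near. Qed.

(** Padding by zero digits lets finite strings share the theory of infinite
    ones. *)
Definition row_int K (x : {ffun 'I_K -> 'F_b}) : nat :=
  digit_int (fun k => if insub k is Some i then x i else 0) K.

Lemma row_int_inj K : injective (@row_int K).
Proof.
move=> x y /digit_int_inj xy; apply/ffunP => i.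
by have := xy i (ltn_ord i); rewrite valK.
Qed.

Lemma row_int_lt K (x : {ffun 'I_K -> 'F_b}) : (row_int x < b ^ K)%N.
Proof. exact: digit_int_lt. Qed.

Lemma digit_int_row z K : digit_int z K = row_int [ffun i : 'I_K => z i].
Proof.
by apply: eq_digit_int => k kK; rewrite insubT ffunE.
Qed.

Lemma card_row K : #|{ffun 'I_K -> 'F_b}|%:R = b%:R ^+ K :> R.
Proof.
rewrite -natrX; congr (_%:R).
by have := card_ffun 'I_K 'F_b; rewrite (card_Fp pb) card_ord.
Qed.

Lemma card_le_inj (T : finType) (f : T -> nat) (y : R) : injective f -> 0 <= y ->
  #|[set x | (f x)%:R <= y]%SET|%:R <= y + 1.
Proof.
move=> f_inj y0; have ty : (Num.truncn y)%:R <= y by rewrite truncn_le.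
apply: (@le_trans _ _ (Num.truncn y).+1%:R); last by rewrite -natr1 lerD2r.
rewrite ler_nat; pose g x : 'I_(Num.truncn y).+1 := inord (f x).
have g_inj : {in [set x | (f x)%:R <= y]%SET &, injective g}.
  move=> x x'; rewrite !inE => xy x'y /(congr1 val) /=.
  by rewrite !inordK ?ltnS ?truncn_ge_nat// => /f_inj.
by rewrite -(card_in_imset g_inj) -[leqRHS]card_ord max_card.
Qed.

(** At every resolution [b ^- K], the set [A] is squeezed between two sets of
    digit strings whose frequencies are that close to [v], its probability under
    the uniform distribution. *)
Definition bracketed (A : set R) (v : R) := forall K,
  exists Q Q' : pred nat,
    [/\ forall z, Q (digit_int z K) -> A (phi R z),
        forall z, A (phi R z) -> Q' (digit_int z K),
        forall a, Q a -> Q' a,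
        v - b%:R ^- K <= #|[set x : {ffun 'I_K -> 'F_b} | Q (row_int x)]%SET|%:R / b%:R ^+ K &
        #|[set x : {ffun 'I_K -> 'F_b} | Q' (row_int x)]%SET|%:R / b%:R ^+ K <= v + b%:R ^- K].

Lemma card_row_set_le K (Q : pred {ffun 'I_K -> 'F_b}) :
  #|[set x | Q x]%SET|%:R <= b%:R ^+ K :> R.
Proof. by rewrite -card_row ler_nat max_card. Qed.

Lemma bracketedT : bracketed setT 1.
Proof.
move=> K; exists predT, predT; split => //.
  rewrite (_ : [set x | _]%SET = [set: {ffun 'I_K -> 'F_b}]%SET); last first.
    by apply/setP => x; rewrite !inE.
  by rewrite cardsT card_row divff ?gt_eqF// gerBl invr_ge0 ltW.
apply: (@le_trans _ _ 1); last by rewrite lerDl invr_ge0 ltW.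
by rewrite ler_pdivrMr// mul1r card_row_set_le.
Qed.

(** Digit strings whose interval lies beyond [t], and those whose interval meets
    the half-line; they differ by one interval of length [b ^- K]. *)
Lemma bracketed_ray (t : R) : bracketed `]t, +oo[ (1 - Num.max 0 (Num.min 1 t)).
Proof.
move=> K; pose y := t * b%:R ^+ K.
exists (fun a => y < a%:R), (fun a => y < a.+1%:R); split.
- move=> z; rewrite /= in_itv /= andbT /y -ltr_pdivlMr// => /lt_le_trans; apply.
  by have /andP[] := phi_itv z K.
- move=> z; rewrite /= in_itv /= andbT /y -ltr_pdivlMr// => /lt_le_trans; apply.
  by have /andP[] := phi_itv z K.
- by move=> a /lt_trans; apply; rewrite ltr_nat.
- rewrite ler_pdivlMr// mulrBl mulVf ?gt_eqF//.
  have [t1|t1] := leP 1 t.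
    have -> : Num.max 0 1 = 1 :> R by apply/max_idPr.
    by rewrite subrr mul0r (le_trans _ (ler0n _ _))// sub0r oppr_le0.
  have cE : #|[set x : {ffun 'I_K -> 'F_b} | y < (row_int x)%:R]%SET|%:R =
      b%:R ^+ K - #|[set x : {ffun 'I_K -> 'F_b} | (row_int x)%:R <= y]%SET|%:R :> R.
    apply/eqP; rewrite -subr_eq opprK -natrD -card_row; apply/eqP.
    congr (_%:R); rewrite addnC -(cardsC [set x | (row_int x)%:R <= y]%SET).
    congr (_ + _)%N; apply: eq_card => x; rewrite !inE ltNge.
    by [].
  rewrite cE; have [t0|t0] := leP 0 t.
    have := card_le_inj (@row_int_inj K) (mulr_ge0 t0 (ltW (bX0 K))).
    by rewrite mulrBl mul1r -/y; lra.
  rewrite subr0 mul1r (_ : [set x | _]%SET = finset.set0).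
    by rewrite cards0; lra.
  apply/setP => x; rewrite !inE; apply/negbTE; rewrite -ltNge.
  by apply: (@lt_le_trans _ _ 0); rewrite ?ler0n// /y nmulr_rlt0.
- rewrite ler_pdivrMr// mulrDl mulVf ?gt_eqF//.
  have [t1|t1] := leP 1 t.
    have -> : Num.max 0 1 = 1 :> R by apply/max_idPr.
    rewrite subrr mul0r add0r (_ : [set x | _]%SET = finset.set0).
      by rewrite cards0 ler01.
    apply/setP => x; rewrite !inE; apply/negbTE; rewrite -leNgt.
    apply: (@le_trans _ _ (b%:R ^+ K)); first by rewrite -natrX ler_nat row_int_lt.
    by rewrite /y ler_peMl// ltW.
  have [t0|t0] := leP 0 t; last first.
    by rewrite subr0 mul1r (le_trans (card_row_set_le _))// lerDl ler01.
  pose f (x : {ffun 'I_K -> 'F_b}) := (b ^ K - (row_int x).+1)%N.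
  have f_inj : injective f.
    move=> x x' xx'; apply: row_int_inj; apply: succn_inj.
    by rewrite -(subKn (row_int_lt x)) -(subKn (row_int_lt x')) -/(f x) xx'.
  have by0 : 0 <= b%:R ^+ K - y.
    by rewrite subr_ge0 /y ger_pMl// ltW.
  have := card_le_inj f_inj by0; rewrite mulrBl mul1r -/y.
  apply: le_trans; rewrite ler_nat; apply: subset_leq_card.
  apply/fintype.subsetP => x; rewrite !inE /f => yx.
  rewrite natrB ?row_int_lt// natrX.
  by rewrite lerD2l lerN2 ltW.
Qed.

End Phi.

(** * Probability of a box for a scrambled point *)

Lemma measurable_finite_rv d (Om : measurableType d) d' (T' : measurableType d')
    (T : finType) (X : Om -> T) (F : T -> T') :
  finite_rv X -> measurable_fun setT (F \o X).
Proof.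
move=> mX _ A mA; rewrite setTI.
exact: (@finite_rv_preimage _ _ _ _ (F @^-1` A) mX).
Qed.

Section LevelSets.
Context d (Om : measurableType d) (R : realType).
Variables (Z : Om -> R) (c : R).
Hypothesis mZ : measurable_fun setT Z.

Lemma measurable_superlevel : measurable [set w | c < Z w].
Proof.
rewrite (_ : [set w | _] = setT `&` Z @^-1` `]c, +oo[%classic).
  by apply: mZ => //; exact: measurable_itv.
by rewrite setTI; apply/seteqP; split => w; rewrite /= in_itv /= andbT.
Qed.

Lemma measurable_weak_superlevel : measurable [set w | c <= Z w].
Proof.
rewrite (_ : [set w | _] = setT `&` Z @^-1` `[c, +oo[%classic).
  by apply: mZ => //; exact: measurable_itv.
by rewrite setTI; apply/seteqP; split => w; rewrite /= in_itv /= andbT.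
Qed.

End LevelSets.

Section PointMeasurable.
Context d (Om : measurableType d) (R : realType).
Variables (b s : nat) (S : GNS b s).
Hypothesis pb : prime b.
Variables (D : 'I_s -> nat -> Om -> 'F_b) (M : 'I_s -> nat -> nat -> Om -> 'F_b).
Hypothesis mD : forall j k, finite_rv (D j k).
Hypothesis mM : forall j k l, finite_rv (M j k l).

Lemma finite_rv_scrambled_digit n j k : finite_rv (scrambled_digit S D M n j k).
Proof.
have mL : finite_rv (fun w => lower_mulv (gns_deg S j) (fun k l => M j k l w)
    (digit_mulv (gns_C S j) n) k).
  apply: finite_rv_sum => l.
  exact: (finite_rv_comp (fun x => x * digit_mulv (gns_C S j) n l) (mM j k l)).
exact: (finite_rv_comp (fun x : 'F_b * 'F_b => x.1 + x.2)
  (finite_rv_pair mL (mD j k))).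
Qed.

Lemma tnth_scrambled_point n w j :
  tnth (scrambled_point R S D M n w) j =
  phi R (fun k => scrambled_digit S D M n j k w).
Proof. by rewrite tnth_mktuple. Qed.

Lemma measurable_scrambled_point n :
  measurable_fun setT (scrambled_point R S D M n).
Proof.
apply/measurable_fun_tnthP => j.
pose h K w : R := (digit_int (fun k => scrambled_digit S D M n j k w) K)%:R /
  b%:R ^+ K.
apply: (@measurable_fun_cvg _ _ R setT h) => [K|w _]; last first.
  by rewrite /= tnth_scrambled_point; exact: cvg_digit_int.
have mW : finite_rv (fun w => [ffun k : 'I_K => scrambled_digit S D M n j k w]).
  by apply: finite_rv_ffun => k; exact: finite_rv_scrambled_digit.
rewrite (_ : h K = (fun x => (row_int x)%:R / b%:R ^+ K) \o
    (fun w => [ffun k : 'I_K => scrambled_digit S D M n j k w])).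
  exact: measurable_finite_rv.
by apply/funext => w; rewrite /h /= digit_int_row.
Qed.

End PointMeasurable.

(** Replace the factors one at a time. *)
Lemma prod_dist_le (R : realDomainType) (I : finType) (x y : I -> R) :
  (forall i, 0 <= x i <= 1) -> (forall i, 0 <= y i <= 1) ->
  `|\prod_i x i - \prod_i y i| <= \sum_i `|x i - y i|.
Proof.
move=> x01 y01.
suff [] : [/\ `|\prod_i x i - \prod_i y i| <= \sum_i `|x i - y i|,
   0 <= \prod_i x i <= 1 & 0 <= \prod_i y i <= 1] by [].
rewrite (_ : index_enum I = enum I); last by rewrite enumT.
elim: (enum I) => [|i r [IH x1 y1]].
  by rewrite !big_nil subrr normr0; split; rewrite ?lexx ?ler01.
rewrite !big_cons; have /andP[xi0 xi1] := x01 i; have /andP[yi0 yi1] := y01 i.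
have /andP[xr0 xr1] := x1; have /andP[yr0 yr1] := y1.
split; rewrite ?mulr_ge0 ?mulr_ile1//.
rewrite (_ : x i * _ - _ = (x i - y i) * \prod_(j <- r) x j +
   y i * (\prod_(j <- r) x j - \prod_(j <- r) y j)); last by ring.
apply: le_trans (ler_normD _ _) _; apply: lerD.
  by rewrite normrM ler_piMr// ger0_norm.
by apply: le_trans IH; rewrite normrM ler_piMl// ger0_norm.
Qed.

Section PointLaw.
Context d (Om : measurableType d) (R : realType) (P : probability Om R).
Variables (b s : nat) (S : GNS b s).
Hypothesis pb : prime b.
Variables (D : 'I_s -> nat -> Om -> 'F_b) (M : 'I_s -> nat -> nat -> Om -> 'F_b).
Hypothesis cs : coarse_scrambling P (gns_deg S) D M.
Variables (m n : nat).
Hypothesis nm : (n < b ^ m)%N.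
Local Notation X := (scrambled_point R S D M n).

Definition digit_row K (z : {ffun 'I_s * 'I_K -> 'F_b}) j : {ffun 'I_K -> 'F_b} :=
  [ffun k => z (j, k)].

Lemma card_digit_rows K (Q : 'I_s -> pred {ffun 'I_K -> 'F_b}) :
  #|[set z : {ffun 'I_s * 'I_K -> 'F_b} | [forall j, Q j (digit_row z j)]]%SET| =
  (\prod_j #|[set x | Q j x]%SET|)%N.
Proof.
rewrite -sum1_card.
rewrite (eq_bigr (fun j => \sum_x (Q j x : nat))%N); last first.
  move=> j _; rewrite -sum1_card big_mkcond; apply: eq_bigr => x _.
  by rewrite inE; case: (Q j x).
rewrite bigA_distr_bigA /= big_mkcond /=.
pose cur (f : {ffun 'I_s -> {ffun 'I_K -> 'F_b}}) :=
  [ffun x : 'I_s * 'I_K => f x.1 x.2].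
rewrite (reindex cur) /=; last first.
  exists (fun z => [ffun j => digit_row z j]) => z _.
    by apply/ffunP => j; apply/ffunP => k; rewrite !ffunE.
  by apply/ffunP => -[j k]; rewrite !ffunE.
apply: eq_bigr => f _.
have fE j : digit_row (cur f) j = f j by apply/ffunP => k; rewrite !ffunE.
rewrite inE; case: ifPn => [/forallP h|/forallPn[j h]].
  by rewrite big1// => j _; have := h j; rewrite fE => ->.
by rewrite (bigD1 j)//= -(fE j) (negPf h) mul0n.
Qed.

Lemma pr_digit_rows K (Q : 'I_s -> pred {ffun 'I_K -> 'F_b}) :
  pr P [set w | [forall j, Q j (digit_row (scrambled_digits S D M n K w) j)]] =
  \prod_j (#|[set x | Q j x]%SET|%:R / b%:R ^+ K).
Proof.
rewrite (@pr_preimage _ _ _ P _ (scrambled_digits S D M n K)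
  (fun z => [forall j, Q j (digit_row z j)])); last first.
  exact: (finite_rv_scrambled_digits pb cs nm).
rewrite (eq_bigr (fun=> #|{ffun 'I_s * 'I_K -> 'F_b}|%:R^-1)) => [|z _]; last first.
  exact: (pr_scrambled_digits pb cs z nm).
rewrite sumr_const -[LHS]mulr_natl big_split /=.
rewrite -natr_prod -card_digit_rows; congr (_ * _).
  by congr (_%:R); apply: eq_card => z; rewrite !inE.
have := card_ffun ('I_s * 'I_K)%type 'F_b; rewrite card_Fp// card_prod !card_ord.
move=> ->; rewrite prodr_const card_ord exprVn -exprM -natrX mulnC.
by [].
Qed.

Let bX0 K : 0 < b%:R ^+ K :> R.
Proof. by rewrite exprn_gt0// ltr0n prime_gt0. Qed.

Lemma le_natr_exp K : K%:R <= b%:R ^+ K :> R.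
Proof. by rewrite -natrX ler_nat ltnW// ltn_expl// prime_gt1. Qed.

Lemma small_resolution (x : R) : (forall K, x <= s.+1%:R * b%:R ^- K) -> x <= 0.
Proof.
move=> xK; apply/ler_addgt0Pr => y y0; rewrite add0r.
have [K Ky] : exists K : nat, s.+1%:R / y <= K%:R.
  by exists (Num.truncn (s.+1%:R / y)).+1; rewrite ltW// truncnS_gt.
apply: le_trans (xK K) _; rewrite ler_pdivrMr//.
rewrite -ler_pdivrMl// mulrC; apply: le_trans Ky _; exact: le_natr_exp.
Qed.

Lemma row_frequency_itv K (Q : pred {ffun 'I_K -> 'F_b}) :
  0 <= (#|[set x | Q x]%SET|%:R / b%:R ^+ K : R) <= 1.
Proof.
apply/andP; split; first by apply: divr_ge0 => //; exact: ltW.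
by rewrite ler_pdivrMr// mul1r card_row_set_le.
Qed.

Lemma bracketed_itv (A : set R) v : bracketed b A v -> 0 <= v <= 1.
Proof.
move=> Av.
have h1 K : exists2 q : R, 0 <= q <= 1 & v - b%:R ^- K <= q.
  have [Q [Q' [_ _ _ h _]]] := Av K; eexists; last exact: h.
  exact: row_frequency_itv.
have h2 K : exists2 q : R, 0 <= q <= 1 & q <= v + b%:R ^- K.
  have [Q [Q' [_ _ _ _ h]]] := Av K; eexists; last exact: h.
  exact: row_frequency_itv.
have s1 K : b%:R ^- K <= s.+1%:R * b%:R ^- K :> R.
  by apply: ler_peMl; rewrite ?invr_ge0 ?(ltW (bX0 K))// ler1n.
apply/andP; split; rewrite -subr_le0 ?sub0r; apply: small_resolution => K;
  apply: le_trans (s1 K).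
  by have [q /andP[q0 _] qv] := h2 K; rewrite lerNl -subr_ge0 opprK (le_trans q0).
by have [q /andP[_ q1] qv] := h1 K; rewrite lerBlDr -lerBlDl (le_trans qv).
Qed.

(** The digits of a point being uniform, boxes of digit strings have the product
    of their frequencies as probability; those that squeeze the given box have
    a probability within [s * b ^- K] of the product of the [v j]. *)
Lemma pr_scrambled_box (A : 'I_s -> set R) (v : 'I_s -> R) :
  (forall j, measurable (A j)) -> (forall j, bracketed b (A j) (v j)) ->
  pr P [set w | forall j, A j (tnth (X w) j)] = \prod_j v j.
Proof.
move=> mA Av.
have mE : measurable [set w | forall j, A j (tnth (X w) j)].
  apply: measurable_forall => j.
  have mX : measurable_fun setT (fun w => tnth (X w) j).
    have := @measurable_scrambled_point _ _ R _ _ S pb _ _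
      (finite_rv_shift cs) (finite_rv_matrix cs) n.
    by move=> /measurable_fun_tnthP/(_ j).
  by rewrite -[X in measurable X]setTI; exact: (mX measurableT _ (mA j)).
have mZ K Q : measurable [set w |
    [forall j, Q j (digit_row (scrambled_digits S D M n K w) j)]].
  exact: (finite_rv_preimage [set z | [forall j, Q j (digit_row z j)]]
    (finite_rv_scrambled_digits pb cs nm)).
have v01 j := bracketed_itv (Av j).
have rowE K w j : row_int (digit_row (scrambled_digits S D M n K w) j) =
    digit_int (fun k => scrambled_digit S D M n j k w) K.
  rewrite digit_int_row; congr row_int; apply/ffunP => k; rewrite !ffunE.
  by [].
have near K : `|pr P [set w | forall j, A j (tnth (X w) j)] - \prod_j v j| <=
    s.+1%:R * b%:R ^- K.
  have [Q QP] := choice (fun j => Av j K).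
  have {QP}[Q' QP] := choice QP.
  pose l j : R := #|[set x : {ffun 'I_K -> 'F_b} | Q j (row_int x)]%SET|%:R / b%:R ^+ K.
  pose u j : R := #|[set x : {ffun 'I_K -> 'F_b} | Q' j (row_int x)]%SET|%:R / b%:R ^+ K.
  have l01 j : 0 <= l j <= 1.
    exact: row_frequency_itv.
  have u01 j : 0 <= u j <= 1.
    exact: row_frequency_itv.
  have lu j : l j <= u j.
    rewrite ler_pM2r ?invr_gt0// ler_nat; apply: subset_leq_card.
    apply/fintype.subsetP => x; rewrite !inE.
    by have [_ _ h _ _] := QP j; exact: h.
  have lE : \prod_j l j <= pr P [set w | forall j, A j (tnth (X w) j)].
    rewrite -(pr_digit_rows (fun j x => Q j (row_int x))).
    apply: (le_pr _ (mZ K (fun j x => Q j (row_int x))) mE).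
    move=> w /= /forallP h j; rewrite tnth_scrambled_point.
    by have [h1 _ _ _ _] := QP j; apply: h1; have := h j; rewrite rowE.
  have uE : pr P [set w | forall j, A j (tnth (X w) j)] <= \prod_j u j.
    rewrite -(pr_digit_rows (fun j x => Q' j (row_int x))).
    apply: (le_pr _ mE (mZ K (fun j x => Q' j (row_int x)))).
    move=> w /= h; apply/forallP => j; rewrite rowE.
    by have [_ h2 _ _ _] := QP j; apply: h2; have := h j; rewrite tnth_scrambled_point.
  have dist (q : 'I_s -> R) : (forall j, 0 <= q j <= 1) ->
      (forall j, `|q j - v j| <= b%:R ^- K) ->
      `|\prod_j q j - \prod_j v j| <= s.+1%:R * b%:R ^- K.
    move=> q01 qv; apply: le_trans (prod_dist_le q01 v01) _.
    apply: le_trans (ler_sum _ (fun j _ => qv j)) _.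
    by rewrite sumr_const card_ord -[leLHS]mulr_natl ler_pM2r ?invr_gt0// ler_nat.
  have ld : `|\prod_j l j - \prod_j v j| <= s.+1%:R * b%:R ^- K.
    apply: dist => // j; have [_ _ _ h1 h2] := QP j.
    rewrite ler_norml; have := lu j; rewrite -/(l j) in h1; rewrite -/(u j) in h2.
    by move: (l j) (u j) (v j) (b%:R ^- K) h1 h2 => *; apply/andP; split; lra.
  have ud : `|\prod_j u j - \prod_j v j| <= s.+1%:R * b%:R ^- K.
    apply: dist => // j; have [_ _ _ h1 h2] := QP j.
    rewrite ler_norml; have := lu j; rewrite -/(l j) in h1; rewrite -/(u j) in h2.
    by move: (l j) (u j) (v j) (b%:R ^- K) h1 h2 => *; apply/andP; split; lra.
  move: ld ud lE uE; rewrite !ler_norml.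
  move: (pr _ _) (\prod_j l j) (\prod_j u j) (\prod_j v j) (_ * _) => x1 x2 x3 x4 x5.
  by move=> /andP[h1 h2] /andP[h3 h4] h5 h6; apply/andP; split; lra.
apply/eqP; rewrite -subr_eq0 -normr_eq0 eq_le normr_ge0 andbT.
exact: small_resolution.
Qed.

End PointLaw.

(** * The law of a scrambled point *)

Lemma power_measure_box d (T : measurableType d) (R : realType)
    (mu : {sigma_finite_measure set T -> \bar R}) n (A : 'I_n -> set T) :
  (forall i, measurable (A i)) ->
  power_measure mu n [set x | forall i, A i (tnth x i)] = (\prod_i mu (A i))%E.
Proof.
elim: n A => [|n IH] A mA.
  rewrite big_ord0 /= diracE (_ : _ \in _ = true)//.
  by apply/mem_set => -[].
rewrite big_ord_recl /= /cons_measure /pushforward.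
pose A' i := A (lift ord0 i).
rewrite (_ : @tcons _ T n @^-1` _ = A ord0 `*` [set x | forall i, A' i (tnth x i)]).
  rewrite product_measure1E//; first by rewrite IH// => i; exact: mA.
  rewrite (_ : [set x | _] = \bigcap_(i in [set: 'I_n]) ((@tnth n T)^~ i @^-1` A' i)).
    apply: fin_bigcap_measurable => // i _.
    by rewrite -[X in measurable X]setTI; apply: measurable_tnth => //; exact: mA.
  by apply/seteqP; split => x /= h i; [move=> _; exact: h|exact: (h i I)].
apply/seteqP; split => -[a t] /= h.
  split; first by have := h ord0; rewrite tnth0.
  by move=> i; have := h (lift ord0 i); rewrite tnthS.
case: h => h1 h2 i; case: (unliftP ord0 i) => [j ->|->].
  by rewrite tnthS; exact: h2.
by rewrite tnth0.
Qed.

Section Boxes.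
Variables (R : realType) (s : nat).
Local Notation T := (s.-tuple (measurableTypeR R)).

(** Including the whole line makes the boxes of half-lines closed under
    intersection and lets them contain the full space. *)
Definition half_line (A : set R) := A = setT \/ exists t : R, A = `]t, +oo[%classic.

Definition boxes : set (set T) :=
  [set E | exists2 A : 'I_s -> set R, (forall j, half_line (A j)) &
     E = [set x | forall j, A j (tnth x j)]].

Lemma measurable_half_line (A : set R) : half_line A -> measurable A.
Proof. by case=> [->|[t ->]]. Qed.

Lemma half_line_setI (A B : set R) : half_line A -> half_line B ->
  half_line (A `&` B).
Proof.
case=> [->|[t ->]] hB; first by rewrite setTI.
case: hB => [->|[u ->]]; first by rewrite setIT; right; exists t.
right; exists (Num.max t u); apply/seteqP; split => x /=;
  by rewrite !in_itv /= !andbT gt_max => /andP.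
Qed.

Lemma setI_closed_boxes : setI_closed boxes.
Proof.
move=> _ _ [A hA ->] [B hB ->]; exists (fun j => A j `&` B j) => [j|].
  exact: half_line_setI.
apply/seteqP; split => x /=; first by move=> [h h'] j.
by move=> h; split => j; have [] := h j.
Qed.

Lemma boxes_measurable : boxes `<=` measurable.
Proof.
move=> _ [A hA ->]; apply: measurable_forall => j.
rewrite -[X in measurable X]setTI.
exact: (measurable_tnth j measurableT (measurable_half_line (hA j))).
Qed.

Lemma measurable_tupleE : @measurable _ T = <<s boxes >>.
Proof.
apply/seteqP; split; last first.
  apply: smallest_sub; first exact: sigma_algebra_measurable.
  exact: boxes_measurable.
apply: smallest_sub; first exact: smallest_sigma_algebra.
move=> E; rewrite -bigcup_seq => -[j _ [B mB <-]].
pose f (x : g_sigma_algebraType boxes) : measurableTypeR R := tnth (x : T) j.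
have mf : measurable_fun setT f.
  apply: (measurability _ (RGenOInfty.measurableE R)).
  move=> _ [_ [t ->] <-]; apply: sub_sigma_algebra.
  exists (fun i => if i == j then `]t, +oo[%classic else setT).
    by move=> i; case: ifP => _; [right; exists t|left].
  rewrite setTI; apply/seteqP; split => x /=.
    by move=> h i; case: ifP => // /eqP ->.
  by move=> /(_ j); rewrite eqxx.
exact: mf.
Qed.

Lemma tuple_measure_unique (m1 m2 : {measure set T -> \bar R}) :
  (forall E, boxes E -> m1 E = m2 E) -> (m1 setT < +oo)%E ->
  forall E, measurable E -> m1 E = m2 E.
Proof.
move=> m12 m1oo E mE.
apply: (measure_unique boxes (fun=> setT) measurable_tupleE setI_closed_boxes).
- move=> _; exists (fun=> setT); first by move=> j; left.
  by apply/seteqP; split.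
- by apply/seteqP; split => // x _; exists 0%N.
- exact: m12.
- by [].
- exact: mE.
Qed.

Lemma measurable_open_cube : measurable (open_cube R s).
Proof.
rewrite (_ : open_cube R s =
  [set x : T | forall i, `]0 : R, 1[%classic (tnth x i)]).
  apply: measurable_forall => j; rewrite -[X in measurable X]setTI.
  by apply: (measurable_tnth j measurableT); exact: measurable_itv.
by apply/seteqP; split => x h i; have := h i; rewrite /= in_itv /=.
Qed.

End Boxes.

Lemma lebesgue_half_line_unit (R : realType) (b : nat) (A : set R) :
  prime b -> half_line A -> exists2 v : R, bracketed b A v &
    lebesgue_measure (A `&` `]0, 1[%classic) = v%:E.
Proof.
move=> pb; case=> [->|[t ->]].
  exists 1; first exact: bracketedT.
  by rewrite setTI lebesgue_measure_itv /= lte01 oppr0 adde0.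
exists (1 - Num.max 0 (Num.min 1 t)); first exact: bracketed_ray.
have -> : `]t, +oo[%classic `&` `]0, 1[%classic = `]Num.max 0 t, 1[%classic :> set R.
  apply/seteqP; split => x /=; rewrite !in_itv /= andbT gt_max.
    by move=> [-> /andP[-> ->]].
  by move=> /andP[/andP[-> ->] ->].
rewrite lebesgue_measure_itv /= lte_fin.
have [t1|t1] := leP 1 t.
  have -> : Num.max 0 1 = 1 :> R by apply/max_idPr.
  by rewrite subrr ltNge le_max t1 orbT.
case: (leP 0 t) => t0; first by rewrite t1 -EFinB.
by rewrite ltr01 -EFinB.
Qed.

Section TupleLaw.
Context d (Om : measurableType d) (R : realType) (P : probability Om R).
Variables (b s : nat) (S : GNS b s).
Hypothesis pb : prime b.
Variables (D : 'I_s -> nat -> Om -> 'F_b) (M : 'I_s -> nat -> nat -> Om -> 'F_b).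
Hypothesis cs : coarse_scrambling P (gns_deg S) D M.
Variables (m n : nat).
Hypothesis nm : (n < b ^ m)%N.
Local Notation X := (scrambled_point R S D M n).

Lemma measurable_scrambled : measurable_fun setT X.
Proof.
exact: (@measurable_scrambled_point _ _ R _ _ S pb _ _
  (finite_rv_shift cs) (finite_rv_matrix cs) n).
Qed.

(** Both sides are finite measures that agree on the boxes, by
    [pr_scrambled_box]. *)
Lemma scrambled_point_law (E : set (s.-tuple (measurableTypeR R))) :
  measurable E -> P (X @^-1` E) = lebesgue_tuple R s (E `&` open_cube R s).
Proof.
move=> mE.
pose mX : {mfun Om >-> s.-tuple (measurableTypeR R)} :=
  mfun_Sub (mem_set measurable_scrambled).
pose m1 : {measure set (s.-tuple (measurableTypeR R)) -> \bar R} :=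
  distribution P mX.
pose m2 : {measure set (s.-tuple (measurableTypeR R)) -> \bar R} :=
  mrestr (lebesgue_tuple R s) (@measurable_open_cube R s).
suff : m1 E = m2 E by [].
apply: (@tuple_measure_unique _ _ m1 m2) => //; last first.
  by rewrite /m1 /= /distribution /pushforward preimage_setT probability_setT ltry.
move=> _ [A hA ->].
have /choice[v vP] j : exists v, bracketed b (A j) v /\
    lebesgue_measure (A j `&` `]0, 1[%classic) = v%:E.
  by have [v v1 v2] := lebesgue_half_line_unit pb (hA j); exists v.
have mA j := measurable_half_line (hA j).
rewrite /m1 /m2 /= /distribution /pushforward /mrestr.
have mXE : measurable (X @^-1` [set x | forall j, A j (tnth x j)]).
  rewrite -[X in measurable X]setTI; apply: measurable_scrambled => //.
  by apply: boxes_measurable; exists A.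
rewrite prE//.
rewrite (pr_scrambled_box pb cs nm mA (fun j => (vP j).1)).
rewrite (_ : _ `&` _ = [set x : s.-tuple (measurableTypeR R) |
    forall j, (A j `&` `]0, 1[%classic) (tnth x j)]).
  have mAI j : measurable (A j `&` `]0, 1[%classic).
    by apply: measurableI => //; exact: mA.
  apply/esym; apply: etrans (@power_measure_box _ _ R (@lebesgue_measure R) s
    (fun j => A j `&` `]0, 1[%classic) mAI) _.
  by rewrite -prodEFin; apply: eq_bigr => j _; exact: (vP j).2.
apply/seteqP; split => x /=.
  by move=> [h1 h2] j; split; [exact: h1|rewrite /= in_itv /=; exact: h2].
move=> h; split => j; first by have [] := h j.
by have [_] := h j; rewrite /= in_itv.
Qed.

End TupleLaw.

(** * Expectations, and sets decided by finitely many digits *)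

Section Mean.
Context d (Om : measurableType d) (R : realType) (P : probability Om R).
Implicit Types f g : Om -> R.

Definition bounded_rv f :=
  measurable_fun setT f /\ exists c, forall w, `|f w| <= c.

Definition mean f : R := \int[P]_w f w.

Lemma bounded_rv_integrable f : bounded_rv f -> P.-integrable setT (EFin \o f).
Proof.
move=> [mf [c fc]]; apply: measurable_bounded_integrable => //.
  exact: le_lt_trans (probability_le1 P measurableT) (ltry _).
exists c; split; first exact: num_real.
by move=> c' cc' w _; exact: le_trans (fc w) (ltW cc').
Qed.

Lemma bounded_rv_cst c : bounded_rv (fun=> c).
Proof. by split=> //; exists `|c|. Qed.

Lemma bounded_rvD f g : bounded_rv f -> bounded_rv g ->
  bounded_rv (fun w => f w + g w).
Proof.
move=> [mf [c fc]] [mg [c' gc']]; split; first exact: measurable_funD.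
exists (c + c') => w; apply: le_trans (ler_normD _ _) _.
by rewrite lerD.
Qed.

Lemma bounded_rvM f g : bounded_rv f -> bounded_rv g ->
  bounded_rv (fun w => f w * g w).
Proof.
move=> [mf [c fc]] [mg [c' gc']]; split; first exact: measurable_funM.
exists (c * c') => w; rewrite normrM.
by apply: ler_pM.
Qed.

Lemma bounded_rvZ c f : bounded_rv f -> bounded_rv (fun w => c * f w).
Proof. by move=> bf; apply: bounded_rvM bf; exact: bounded_rv_cst. Qed.

Lemma bounded_rvB f g : bounded_rv f -> bounded_rv g ->
  bounded_rv (fun w => f w - g w).
Proof.
move=> bf bg; have := bounded_rvD bf (bounded_rvZ (-1) bg).
by congr bounded_rv; apply/funext => w; rewrite mulN1r.
Qed.

Lemma bounded_rv_abs f : bounded_rv f -> bounded_rv (fun w => `|f w|).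
Proof.
move=> [mf [c fc]]; split; first exact: measurableT_comp.
by exists c => w; rewrite normr_id.
Qed.

Lemma bounded_rv_sum (I : Type) (r : seq I) (F : I -> Om -> R) :
  (forall i, bounded_rv (F i)) -> bounded_rv (fun w => \sum_(i <- r) F i w).
Proof.
move=> bF; elim: r => [|i r IH].
  have := bounded_rv_cst 0; congr bounded_rv.
  by apply/funext => w; rewrite big_nil.
have := bounded_rvD (bF i) IH; congr bounded_rv.
by apply/funext => w; rewrite big_cons.
Qed.

Lemma bounded_rv_indic A : measurable A -> bounded_rv (\1_A : Om -> R).
Proof.
move=> mA; split; first exact: measurable_indic.
by exists 1 => w; rewrite ger0_norm ?indic_ge0 // indicE; case: (_ \in _).
Qed.

Lemma bounded_rv_finite (T : finType) (W : Om -> T) (F : T -> R) :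
  finite_rv W -> bounded_rv (fun w => F (W w)).
Proof.
move=> mW; split; first exact: (measurable_finite_rv F mW).
exists (\sum_t `|F t|) => w; rewrite (bigD1 (W w))//= lerDl.
by apply: sumr_ge0 => t _.
Qed.

Lemma meanD f g : bounded_rv f -> bounded_rv g ->
  mean (fun w => f w + g w) = mean f + mean g.
Proof.
by move=> bf bg; rewrite /mean RintegralD//; exact: bounded_rv_integrable.
Qed.

Lemma meanZ c f : bounded_rv f -> mean (fun w => c * f w) = c * mean f.
Proof.
by move=> bf; rewrite /mean RintegralZl//; exact: bounded_rv_integrable.
Qed.

Lemma meanB f g : bounded_rv f -> bounded_rv g ->
  mean (fun w => f w - g w) = mean f - mean g.
Proof.
move=> bf bg; rewrite -mulN1r -(meanZ _ bg) -meanD//; last exact: bounded_rvZ.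
by congr mean; apply/funext => w; rewrite mulN1r.
Qed.

Lemma mean_cst c : mean (fun=> c) = c.
Proof. by rewrite /mean Rintegral_cst// -[fine _]/(pr P setT) prT mulr1. Qed.

Lemma mean_sum (I : Type) (r : seq I) (F : I -> Om -> R) :
  (forall i, bounded_rv (F i)) ->
  mean (fun w => \sum_(i <- r) F i w) = \sum_(i <- r) mean (F i).
Proof.
move=> bF; elim: r => [|i r IH].
  rewrite big_nil -[RHS](mean_cst 0); congr mean.
  by apply/funext => w; rewrite big_nil.
rewrite big_cons -IH -meanD//; last exact: bounded_rv_sum.
by congr mean; apply/funext => w; rewrite big_cons.
Qed.

Lemma le_mean f g : bounded_rv f -> bounded_rv g -> (forall w, f w <= g w) ->
  mean f <= mean g.
Proof.
by move=> bf bg fg; apply: le_Rintegral => //; exact: bounded_rv_integrable.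
Qed.

Lemma mean_indic A : measurable A -> mean \1_A = pr P A.
Proof. by move=> mA; rewrite /mean /Rintegral integral_indic// setIT. Qed.

Lemma le_norm_mean f : bounded_rv f -> `|mean f| <= mean (fun w => `|f w|).
Proof.
by move=> bf; apply: le_normr_Rintegral => //; exact: bounded_rv_integrable.
Qed.

Lemma mean_finite (T : finType) (W : Om -> T) (F : T -> R) : finite_rv W ->
  mean (fun w => F (W w)) = \sum_t pr P (W @^-1` [set t]) * F t.
Proof.
move=> mW.
have -> : (fun w => F (W w)) =
    fun w => \sum_t F t * \1_(W @^-1` [set t]) w.
  apply/funext => w; rewrite (bigD1 (W w))//= indicE mem_set// mulr1.
  rewrite big1 ?addr0// => t tW; rewrite indicE memNset ?mulr0//=.
  by move=> tE; rewrite tE eqxx in tW.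
rewrite mean_sum => [|t]; last first.
  by apply: bounded_rvZ; apply: bounded_rv_indic; exact: mW.
apply: eq_bigr => t _; rewrite meanZ; last exact: bounded_rv_indic.
by rewrite mean_indic// mulrC.
Qed.

Lemma markov_mean f (eps : R) : bounded_rv f -> (forall w, 0 <= f w) -> 0 < eps ->
  eps * pr P [set w | eps <= f w] <= mean f.
Proof.
move=> bf f0 eps0.
have mE : measurable [set w | eps <= f w].
  by have [mf _] := bf; exact: measurable_weak_superlevel.
rewrite -mean_indic// -meanZ; last exact: bounded_rv_indic.
apply: le_mean => // [|w]; first by apply: bounded_rvZ; exact: bounded_rv_indic.
rewrite indicE; have [/set_mem|_] := boolP (_ \in _); rewrite ?mulr1 ?mulr0//.
Qed.

End Mean.

Section Approximation.
Context d (Om : measurableType d) (R : realType) (P : probability Om R).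
Variables (b s : nat) (S : GNS b s).
Hypothesis pb : prime b.
Variables (D : 'I_s -> nat -> Om -> 'F_b) (M : 'I_s -> nat -> nat -> Om -> 'F_b).
Hypothesis cs : coarse_scrambling P (gns_deg S) D M.
Variable m : nat.
Local Notation X := (scrambled_point R S D M).
Local Notation T := (s.-tuple (measurableTypeR R)).
Local Notation V K := {ffun 'I_s * 'I_K -> 'F_b}.
Local Notation Z n K := (scrambled_digits S D M n K).

Definition digit_discrepancy (A : set T) K (B : pred (V K)) n : set Om :=
  [set w | `[< A (X n w) >] != B (Z n K w)].

Lemma measurable_point_preimage n (A : set T) : measurable A ->
  measurable (X n @^-1` A).
Proof.
move=> mA; rewrite -[X in measurable X]setTI.
exact: (measurable_scrambled pb cs n measurableT).
Qed.

Lemma measurable_digit_preimage n K (B : pred (V K)) : (n < b ^ m)%N ->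
  measurable [set w | B (Z n K w)].
Proof.
move=> nm; exact: (finite_rv_preimage [set z | B z]
  (finite_rv_scrambled_digits pb cs nm)).
Qed.

Lemma measurable_digit_discrepancy A K (B : pred (V K)) n :
  measurable A -> (n < b ^ m)%N -> measurable (digit_discrepancy A B n).
Proof.
move=> mA nm; have mX := measurable_point_preimage n mA.
have mZ := measurable_digit_preimage B nm.
rewrite (_ : digit_discrepancy _ _ _ =
  (X n @^-1` A `\` [set w | B (Z n K w)]) `|`
  ([set w | B (Z n K w)] `\` X n @^-1` A)).
  by apply: measurableU; exact: measurableD.
apply/seteqP; split => w; rewrite /digit_discrepancy /=.
  by case: asboolP => Aw; case: (B _) => //= _; [left|right].
by case=> [[/asboolT -> /negP/negPf ->]|[-> /asboolF ->]].
Qed.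

(** Sets that finitely many digits decide up to an error of small probability,
    uniformly over the points of the net. *)
Definition digit_approximable (A : set T) := measurable A /\
  forall eps, 0 < eps -> exists K (B : pred (V K)),
    forall n, (n < b ^ m)%N -> pr P (digit_discrepancy A B n) <= eps.

Definition truncate_digits K K' (KK' : (K <= K')%N) (z : V K') : V K :=
  [ffun x : 'I_s * 'I_K => z (x.1, widen_ord KK' x.2)].

Lemma digit_discrepancy_lift A K K' (KK' : (K <= K')%N) (B : pred (V K)) n :
  digit_discrepancy A (fun z => B (truncate_digits KK' z)) n =
  digit_discrepancy A B n.
Proof.
apply/seteqP; split => w; rewrite /digit_discrepancy /=;
  by rewrite (_ : truncate_digits KK' _ = Z n K w)//;
  apply/ffunP => -[j k]; rewrite !ffunE.
Qed.

Lemma digit_approximable_set0 : digit_approximable set0.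
Proof.
split=> // eps eps0; exists 0%N, xpred0 => n _.
rewrite (_ : digit_discrepancy _ _ _ = set0) ?pr0 ?ltW//.
by apply/seteqP; split => // w; rewrite /digit_discrepancy /= asboolF.
Qed.

Lemma digit_approximableC A : digit_approximable A -> digit_approximable (~` A).
Proof.
move=> [mA hA]; split; first exact: measurableC.
move=> eps /hA[K [B AB]]; exists K, (predC B) => n nm.
rewrite (_ : digit_discrepancy _ _ _ = digit_discrepancy A B n); first exact: AB.
apply/seteqP; split => w; rewrite /digit_discrepancy /= asbool_neg;
  by case: asbool; case: (B _).
Qed.

Lemma digit_approximableU A A' : digit_approximable A -> digit_approximable A' ->
  digit_approximable (A `|` A').
Proof.
move=> [mA hA] [mA' hA']; split; first exact: measurableU.
move=> eps eps0; have eps2 : 0 < eps / 2 by rewrite divr_gt0.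
have [K [B AB]] := hA _ eps2; have [K' [B' AB']] := hA' _ eps2.
pose L := maxn K K'.
exists L, (fun z => B (truncate_digits (leq_maxl K K') z) ||
  B' (truncate_digits (leq_maxr K K') z)) => n nm.
have m1 := measurable_digit_discrepancy B mA nm.
have m2 := measurable_digit_discrepancy B' mA' nm.
rewrite [leRHS]splitr; apply: le_trans (lerD (AB n nm) (AB' n nm)).
apply: le_trans (prU_le P m1 m2); apply: le_pr.
- by apply: measurable_digit_discrepancy => //; exact: measurableU.
- exact: measurableU.
rewrite -(digit_discrepancy_lift _ (leq_maxl K K')).
rewrite -(digit_discrepancy_lift _ (leq_maxr K K')).
move=> w; rewrite /digit_discrepancy /= asbool_or.
case: (asbool (A _)); case: (asbool (A' _)); case: (B _); case: (B' _) => //=;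
  by [left|right].
Qed.

(** A finite part of the union exhausts it up to a set of small probability. The
    points of the net have the same law, so one finite part serves them all. *)
Lemma digit_approximable_bigcup (F : (set T)^nat) :
  (forall i, digit_approximable (F i)) -> digit_approximable (\bigcup_i F i).
Proof.
move=> hF; have mF i : measurable (F i) by have [] := hF i.
have mU : measurable (\bigcup_i F i) by exact: bigcupT_measurable.
split=> // eps eps0; have eps2 : 0 < eps / 2 by rewrite divr_gt0.
pose G N := \big[setU/set0]_(i < N) F i.
have hG N : digit_approximable (G N).
  rewrite /G; elim: N => [|N IH].
    by rewrite big_ord0; exact: digit_approximable_set0.
  by rewrite big_ord_recr; exact: digit_approximableU.
have mG N : measurable (G N) by have [] := hG N.
pose H N := (\bigcup_i F i) `\` G N.
have mH N : measurable (H N) by exact: measurableD.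
have [N HN] : exists N, pr P (X 0%N @^-1` H N) <= eps / 2.
  have cH : P \o (fun N => X 0%N @^-1` H N) @ \oo -->
      P (\bigcap_N X 0%N @^-1` H N).
    apply: nonincreasing_cvg_mu.
    - by rewrite (le_lt_trans (probability_le1 P _)) ?ltry//;
        exact: measurable_point_preimage.
    - by move=> i; exact: measurable_point_preimage.
    - by apply: bigcapT_measurable => i; exact: measurable_point_preimage.
    - move=> i k ik; apply/subsetPset => w [Uw Gw]; split => // Giw; apply: Gw.
      exact: (subset_bigsetU ik Giw).
  have H0 : \bigcap_N X 0%N @^-1` H N = set0.
    apply/seteqP; split => // w Hw.
    have [[i _ Fi] _] := Hw 0%N I.
    have [_] := Hw i.+1 I; apply; rewrite /G big_ord_recr /=; right.
    exact: Fi.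
  rewrite H0 measure0 in cH.
  have /cvgr_lt/(_ (eps / 2) eps2) : fine \o (P \o (fun N => X 0%N @^-1` H N)) @ \oo --> (0 : R).
    exact: fine_cvg cH.
  by case=> N _ /(_ N (leqnn _)) /= HN; exists N; exact: ltW.
have [_ /(_ _ eps2)[K [B GB]]] := hG N.
exists K, B => n nm.
have HnN : pr P (X n @^-1` H N) <= eps / 2.
  have m0 : (0 < b ^ m)%N by rewrite expn_gt0 prime_gt0.
  by move: HN; rewrite /pr (scrambled_point_law pb cs m0 (mH N))
    (scrambled_point_law pb cs nm (mH N)).
rewrite [leRHS]splitr; apply: le_trans (lerD (GB n nm) HnN).
have m1 := measurable_digit_discrepancy B (mG N) nm.
have m2 := measurable_point_preimage n (mH N).
apply: le_trans (prU_le P m1 m2); apply: le_pr.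
- exact: measurable_digit_discrepancy.
- exact: measurableU.
move=> w; rewrite /digit_discrepancy /= => Uw.
have [Gw|Gw] := pselect (G N (X n w)).
  left; rewrite asboolT//; move: Uw; rewrite asboolT//.
  by move: Gw; rewrite /G -bigcup_mkord => -[i _ Fi]; exists i.
have [Uw'|Uw'] := pselect ((\bigcup_i F i) (X n w)); first by right.
by left; rewrite asboolF//; move: Uw; rewrite asboolF.
Qed.

(** The digits decide membership except on the strings that separate the two
    bracketing sets, of frequency at most [2 b ^- K]. *)
Lemma digit_approximable_half_line (A : set R) j : half_line A ->
  digit_approximable [set x | A (tnth x j)].
Proof.
move=> hA; have [v Av _] := lebesgue_half_line_unit pb hA.
have mA : measurable ([set x | A (tnth x j)] : set T).
  rewrite -[X in measurable X]setTI.
  exact: (measurable_tnth j measurableT (measurable_half_line hA)).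
split=> // eps eps0.
have [K Keps] : exists K, 2 / b%:R ^+ K <= eps.
  exists (Num.truncn (2 / eps)).+1; rewrite ler_pdivrMr; last first.
    by rewrite exprn_gt0// ltr0n prime_gt0.
  rewrite mulrC -ler_pdivrMr//; apply: le_trans (le_natr_exp R pb _).
  by rewrite ltW// truncnS_gt.
have [Q [Q' [QA AQ' QQ' lQ uQ']]] := Av K.
exists K, (fun z => Q (row_int (digit_row z j))) => n nm.
apply: le_trans Keps.
have mX := measurable_digit_discrepancy (fun z => Q (row_int (digit_row z j))) mA nm.
pose q := [pred x : {ffun 'I_K -> 'F_b} | Q (row_int x)].
pose q' := [pred x : {ffun 'I_K -> 'F_b} | Q' (row_int x)].
pose qd := [pred x : {ffun 'I_K -> 'F_b} | Q' (row_int x) && ~~ Q (row_int x)].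
have rowE w : row_int (digit_row (Z n K w) j) =
    digit_int (fun k => scrambled_digit S D M n j k w) K.
  by rewrite digit_int_row; congr row_int; apply/ffunP => k; rewrite !ffunE.
have prq : pr P [set w | qd (digit_row (Z n K w) j)] =
    #|[set x | qd x]%SET|%:R / b%:R ^+ K.
  have := pr_digit_rows pb cs nm (fun i x => (i == j) ==> qd x) (K := K).
  rewrite (bigD1 j)//= big1 => [|i ij]; last first.
    rewrite (negPf ij) (_ : [set x | _]%SET = [set: {ffun 'I_K -> 'F_b}]%SET).
      by rewrite cardsT card_row// divff// gt_eqF// exprn_gt0// ltr0n prime_gt0.
    by apply/setP => x; rewrite !inE.
  rewrite mulr1 eqxx /= => <-.
    by congr pr; apply/seteqP; split => w /=;
      [move=> h; apply/forallP => i; apply/implyP => /eqP ->|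
       move=> /forallP/(_ j); rewrite eqxx].
apply: (@le_trans _ _ (pr P [set w | qd (digit_row (Z n K w) j)])).
  apply: le_pr => //.
    exact: (finite_rv_preimage [set z | qd (digit_row z j)]
      (finite_rv_scrambled_digits pb cs nm)).
  move=> w; rewrite /digit_discrepancy /= rowE tnth_scrambled_point.
  case: asboolP => [Aw|Aw].
    by rewrite AQ' //; case: (Q _).
  by case E : (Q _) => // _; case: Aw; exact: QA.
rewrite prq; have b0 : 0 < b%:R ^+ K :> R by rewrite exprn_gt0// ltr0n prime_gt0.
have cE : #|[set x | q' x]%SET| =
    (#|[set x | qd x]%SET| + #|[set x | q x]%SET|)%N.
  rewrite -cardsUI (_ : _ :&: _ = finset.set0) ?cards0 ?addn0; last first.
    by apply/setP => x; rewrite !inE; case: (Q _); rewrite ?andbF.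
  apply: eq_card => x; rewrite !inE; case E : (Q _); rewrite ?andbF ?andbT ?orbF//.
  by rewrite QQ'.
move: lQ uQ'; rewrite cE natrD mulrDl -/q.
move: (_ / _) (_ / _) => x y; rewrite -[2 / _]/(2 * b%:R ^- K).
by move: (b%:R ^- K) => z h1 h2; lra.
Qed.

End Approximation.

(** * Second moment of net averages *)

Lemma count_below_itv (R : realDomainType) (y : R) N : 0 <= y <= N%:R ->
  y - 1 <= \sum_(i < N) (i.+1%:R < y)%R%:R <= y.
Proof.
move=> /andP[y0 yN].
have full k : k%:R < y -> \sum_(i < k) (i.+1%:R < y)%R%:R = k%:R :> R.
  move=> ky; rewrite (eq_bigr (fun=> 1)) ?sumr_const ?card_ord// => i _.
  by rewrite (le_lt_trans _ ky)// ler_nat.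
suff h k : y <= k%:R -> y - 1 <= \sum_(i < k) (i.+1%:R < y)%R%:R <= y by exact: h.
elim: k => [|k IH] yk; first by rewrite big_ord0 y0 andbT; lra.
rewrite big_ord_recr /= ltNge yk addr0.
have [yk'|ky] := leP y k%:R; first exact: IH.
by rewrite full// (ltW ky) andbT lerBlDr natr1.
Qed.

Lemma sqr_diff_le (R : realDomainType) (u v c : R) : `|u| <= c -> `|v| <= c ->
  u ^+ 2 <= v ^+ 2 + 2 * c * `|u - v|.
Proof.
move=> uc vc; rewrite -lerBlDl subr_sqr mulrC.
apply: le_trans (ler_norm _) _; rewrite normrM ler_wpM2r//.
by apply: le_trans (ler_normD _ _) _; rewrite mulr_natl mulr2n lerD.
Qed.

Lemma mean_sqr_le d (Om : measurableType d) (R : realType)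
    (P : probability Om R) (U W : Om -> R) c :
  bounded_rv U -> bounded_rv W ->
  (forall w, `|U w| <= c) -> (forall w, `|W w| <= c) ->
  mean P (fun w => U w ^+ 2) <=
  mean P (fun w => W w ^+ 2) + 2 * c * mean P (fun w => `|U w - W w|).
Proof.
move=> bU bW Uc Wc; have bd := bounded_rv_abs (bounded_rvB bU bW).
rewrite -meanZ// -meanD//; [|exact: bounded_rvM|exact: bounded_rvZ].
apply: le_mean => [||w]; last exact: sqr_diff_le.
- exact: bounded_rvM.
- by apply: bounded_rvD; [exact: bounded_rvM|exact: bounded_rvZ].
Qed.

Section Variance.
Context d (Om : measurableType d) (R : realType) (P : probability Om R).
Variables (b s : nat) (S : GNS b s).
Hypothesis pb : prime b.
Variables (D : 'I_s -> nat -> Om -> 'F_b) (M : 'I_s -> nat -> nat -> Om -> 'F_b).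
Hypothesis cs : coarse_scrambling P (gns_deg S) D M.
Variable m : nat.
Local Notation X := (scrambled_point R S D M).
Local Notation T := (s.-tuple (measurableTypeR R)).
Local Notation V K := {ffun 'I_s * 'I_K -> 'F_b}.
Local Notation Z n K := (scrambled_digits S D M n K).
Local Notation approx := (digit_approximable P S D M m).

Lemma measurable_digit_approximable (A : set T) : measurable A -> approx A.
Proof.
rewrite measurable_tupleE; move: A; apply: smallest_sub.
  split.
  - exact: digit_approximable_set0.
  - by move=> A; rewrite setTD; exact: digit_approximableC.
  - by move=> F; exact: (digit_approximable_bigcup pb cs).
move=> _ [A hA ->].
pose F (i : nat) : set T := if insub i is Some j then ~` [set x | A j (tnth x j)] else set0.
rewrite (_ : [set x | _] = ~` (\bigcup_i F i)).
  apply: digit_approximableC; apply: (digit_approximable_bigcup pb cs) => i.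
  rewrite /F; case: insub => [j|]; last exact: digit_approximable_set0.
  by apply: digit_approximableC; exact: (digit_approximable_half_line pb cs).
apply/seteqP; split => x /=.
  by move=> h [i _]; rewrite /F; case: insub => [j|//]; apply; exact: h.
move=> h j; apply: contrapT => nA; apply: h; exists (val j) => //.
by rewrite /F valK.
Qed.

(** Reading more digits than necessary does no harm, so finitely many sets can
    share the number of digits. *)
Lemma finite_levels (I : finType) (A : I -> set T) (eps : R) :
  (forall i, measurable (A i)) -> 0 < eps ->
  exists K (B : I -> pred (V K)), forall i n, (n < b ^ m)%N ->
    pr P (digit_discrepancy S D M (A i) (B i) n) <= eps.
Proof.
move=> mA eps0.
have [K KP] := choice (fun i => (measurable_digit_approximable (mA i)).2 eps eps0).
pose L := (\max_i K i)%N.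
have KL i : (K i <= L)%N by exact: leq_bigmax.
exists L.
have /choice[B BP] i : exists B : pred (V L), forall n, (n < b ^ m)%N ->
    pr P (digit_discrepancy S D M (A i) B n) <= eps.
  have [B BP] := KP i; exists (fun z => B (truncate_digits (KL i) z)) => n nm.
  by rewrite digit_discrepancy_lift; exact: BP.
by exists B.
Qed.

Lemma bounded_rv_point (g : T -> R) c n : measurable_fun setT g ->
  (forall x, `|g x| <= c) -> bounded_rv (fun w => g (X n w)).
Proof.
move=> mg gc; split; last by exists c.
apply: measurableT_comp => //; exact: (measurable_scrambled pb cs).
Qed.

Lemma bounded_rv_digits K (h : V K -> R) n : (n < b ^ m)%N ->
  bounded_rv (fun w => h (Z n K w)).
Proof. by move=> nm; apply: bounded_rv_finite; exact: (finite_rv_scrambled_digits pb cs nm). Qed.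

(** Layer-cake approximation: [g] is up to [2 c / N] an affine image of the
    number of levels that it exceeds, and each level set is nearly decided by
    finitely many digits. *)
Lemma L1_digit_approximation (g : T -> R) (c eta : R) :
  measurable_fun setT g -> 0 < c -> (forall x, `|g x| <= c) -> 0 < eta ->
  exists K (h : V K -> R), (forall z, `|h z| <= c) /\
    forall n, (n < b ^ m)%N -> mean P (fun w => `|g (X n w) - h (Z n K w)|) <= eta.
Proof.
move=> mg c0 gc eta0.
(* Rounding down to a multiple of the step [dl] costs at most [eta / 2]. *)
pose N := (Num.truncn (4 * c / eta)).+1.
have N0 : 0 < N%:R :> R by rewrite ltr0n.
pose dl : R := 2 * c / N%:R.
have dl0 : 0 < dl by rewrite divr_gt0// mulr_gt0.
have dlN : dl * N%:R = 2 * c by rewrite divfK// gt_eqF.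
have dleta : dl <= eta / 2.
  have : 4 * c / eta < N%:R by exact: truncnS_gt.
  rewrite ltr_pdivrMr// /dl ler_pdivrMr// => h; lra.
clearbody dl; pose A (i : 'I_N) : set T := [set x | - c + dl * i.+1%:R < g x].
have mA i : measurable (A i).
  exact: measurable_superlevel.
(* The [N] wrongly decided levels cost [dl * N * eps = 2 * c * eps] in the mean,
   the other half of [eta]. *)
pose eps := eta / (4 * c).
have eps0 : 0 < eps by rewrite divr_gt0// mulr_gt0.
have [K [B BP]] := finite_levels mA eps0.
pose h (z : V K) : R := - c + dl * \sum_(i < N) (B i z)%:R.
exists K, h; split.
  move=> z; have h0 : 0 <= \sum_(i < N) (B i z)%:R :> R by exact: sumr_ge0.
  have h1 : \sum_(i < N) (B i z)%:R <= N%:R :> R.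
    rewrite -[X in X%:R](card_ord N) -sum1_card natr_sum.
    by apply: ler_sum => i _; rewrite ler_nat; case: (B i z).
  rewrite ler_norml /h; have h2 : dl * \sum_(i < N) (B i z)%:R <= 2 * c.
    by rewrite -dlN ler_pM2l.
  have h3 : 0 <= dl * \sum_(i < N) (B i z)%:R by rewrite mulr_ge0// ltW.
  by apply/andP; split; lra.
move=> n nm.
have mdis i : measurable (digit_discrepancy S D M (A i) (B i) n).
  exact: (measurable_digit_discrepancy pb cs _ (mA i) nm).
have bdis i := bounded_rv_indic R (mdis i).
have bsum : bounded_rv (fun w =>
    dl + dl * \sum_(i < N) \1_(digit_discrepancy S D M (A i) (B i) n) w).
  apply: bounded_rvD; first exact: bounded_rv_cst.
  by apply: bounded_rvZ; apply: bounded_rv_sum.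
have bgh : bounded_rv (fun w => `|g (X n w) - h (Z n K w)|).
  apply: bounded_rv_abs; apply: bounded_rvB; last exact: bounded_rv_digits.
  exact: bounded_rv_point.
apply: (@le_trans _ _ (mean P (fun w =>
    dl + dl * \sum_(i < N) \1_(digit_discrepancy S D M (A i) (B i) n) w))).
  apply: le_mean => // w.
  pose y := (g (X n w) + c) / dl.
  have /andP[g1 g2] : - c <= g (X n w) <= c by rewrite -ler_norml.
  have y01 : 0 <= y <= N%:R.
    rewrite /y divr_ge0 ?(ltW dl0)//=; last by lra.
    by rewrite ler_pdivrMr// mulrC dlN; lra.
  have /andP[s1 s2] := count_below_itv y01.
  set sA := \sum_(i < N) _ in s1 s2.
  set sD := \sum_(i < N) _.
  have AE (i : 'I_N) : (i.+1%:R < y) = `[< A i (X n w) >].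
    rewrite /y ltr_pdivlMr//; apply/idP/asboolP; rewrite /A /= => h'; lra.
  have sAB : `|sA - \sum_(i < N) (B i (Z n K w))%:R| <= sD.
    rewrite /sA -sumrB; apply: le_trans (ler_norm_sum _ _ _) _.
    apply: ler_sum => i _; rewrite AE indicE.
    have -> : (w \in digit_discrepancy S D M (A i) (B i) n) =
        (`[< A i (X n w) >] != B i (Z n K w)).
      by apply/idP/idP => [/set_mem|h']; [|apply/mem_set].
    by case: asbool; case: (B i _); rewrite /= ?subrr ?subr0 ?sub0r ?normr0 ?normrN ?normr1.
  have gE : g (X n w) = - c + dl * y by rewrite /y mulrC divfK ?gt_eqF//; lra.
  have -> : g (X n w) - h (Z n K w) =
     dl * (y - sA) + dl * (sA - \sum_(i < N) (B i (Z n K w))%:R).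
    by rewrite /h {1}gE; ring.
  apply: le_trans (ler_normD _ _) _; rewrite !normrM !(gtr0_norm dl0).
  apply: lerD; last by rewrite ler_pM2l.
  rewrite -[leRHS]mulr1 ler_pM2l// ler_norml.
  by apply/andP; split; lra.
rewrite meanD//; [|exact: bounded_rv_cst|by apply: bounded_rvZ; apply: bounded_rv_sum].
rewrite mean_cst meanZ; last exact: bounded_rv_sum.
rewrite mean_sum//.
have -> : eta = eta / 2 + dl * (N%:R * eps).
  rewrite mulrA dlN /eps; field; lra.
apply: lerD => //; rewrite ler_pM2l//.
apply: (@le_trans _ _ (\sum_(i < N) eps)).
  by apply: ler_sum => i _; rewrite mean_indic//; exact: BP.
by rewrite sumr_const card_ord mulr_natl.
Qed.

Definition net_average (g : T -> R) w : R :=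
  (b%:R ^+ m)^-1 * \sum_(n < (b ^ m)%N) g (X n w).

Lemma mean_scrambled_digits K (h : V K -> R) n : (n < b ^ m)%N ->
  mean P (fun w => h (Z n K w)) = #|V K|%:R^-1 * \sum_z h z.
Proof.
move=> nm; rewrite mean_finite; last exact: (finite_rv_scrambled_digits pb cs nm).
rewrite mulr_sumr; apply: eq_bigr => z _.
by rewrite (pr_scrambled_digits pb cs z nm).
Qed.

Lemma digit_average_second_moment (C : R) K (h : V K -> R) :
  (forall Q : pred 'I_s,
     \prod_(j | Q j) (b%:R ^+ gns_deg S j / (b%:R ^+ gns_deg S j - 1)) <= C) ->
  mean P (fun w => ((b%:R ^+ m)^-1 * \sum_(n < (b ^ m)%N) h (Z n K w)) ^+ 2) <=
  mean P (fun w => h (Z 0%N K w)) ^+ 2 +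
  C / b%:R ^+ m * mean P (fun w => h (Z 0%N K w) ^+ 2).
Proof.
move=> CP; have m0 : (0 < b ^ m)%N by rewrite expn_gt0 prime_gt0.
rewrite (mean_scrambled_digits h m0).
rewrite (mean_scrambled_digits (fun z => h z ^+ 2) m0).
apply: le_trans (second_moment_le pb cs m h CP).
rewrite le_eqVlt; apply/orP; left; apply/eqP.
pose W w := (scrambled_matrix S M K m w, shift_digits D K w).
have mW : finite_rv W.
  apply: finite_rv_pair; first exact: (finite_rv_scrambled_matrix cs).
  exact: (finite_rv_shift_digits cs).
pose F (gz : {ffun ('I_s * 'I_K) * 'I_m -> 'F_b} * V K) : R :=
  ((b%:R ^+ m)^-1 * \sum_x h (lin_image gz.1 x + gz.2)) ^+ 2.
transitivity (mean P (fun w => F (W w))).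
  congr mean; apply/funext => w; rewrite /F; congr ((_ * _) ^+ 2).
  rewrite -(sum_digit_vector pb (fun x => h (lin_image (W w).1 x + (W w).2))).
  rewrite big_mkord; apply: eq_bigr => n _.
  by rewrite (@scrambled_digitsE _ _ _ _ S pb D M m n K w (ltn_ord n)).
rewrite (mean_finite P F mW) pair_bigA; apply: eq_bigr => -[g z] _ /=.
congr (pr P _ * _); apply/seteqP; split => w /=; rewrite /W.
  by move=> [-> ->].
by move=> [-> ->].
Qed.

Definition cube_restricted :=
  mrestr (lebesgue_tuple R s) (@measurable_open_cube R s).

Lemma ge0_integral_point_law (G : T -> \bar R) n : (n < b ^ m)%N ->
  measurable_fun setT G -> (forall x, 0 <= G x)%E ->
  (\int[P]_w G (X n w) = \int[cube_restricted]_x G x)%E.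
Proof.
move=> nm mG G0; have mX := measurable_scrambled pb cs n.
pose X' : {mfun Om >-> T} := mfun_Sub (mem_set mX).
transitivity (\int[distribution P X']_x G x)%E.
  by rewrite /distribution ge0_integral_pushforward// => x _.
by apply: eq_measure_integral => A mA _; exact: (scrambled_point_law pb cs nm mA).
Qed.

Lemma integral_point_law (G : T -> \bar R) n : (n < b ^ m)%N ->
  measurable_fun setT G -> P.-integrable setT (G \o X n) ->
  (\int[P]_w G (X n w) = \int[cube_restricted]_x G x)%E.
Proof.
move=> nm mG iG; have mX := measurable_scrambled pb cs n.
pose X' : {mfun Om >-> T} := mfun_Sub (mem_set mX).
transitivity (\int[distribution P X']_x G x)%E.
  by rewrite /distribution integral_pushforward.
by apply: eq_measure_integral => A mA _; exact: (scrambled_point_law pb cs nm mA).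
Qed.

Lemma integral_cube_restricted (G : T -> \bar R) :
  (forall x, ~ open_cube R s x -> G x = 0%E) ->
  (\int[cube_restricted]_x G x = \int[lebesgue_tuple R s]_(x in open_cube R s) G x)%E.
Proof.
move=> G0.
transitivity (\int[cube_restricted]_(x in open_cube R s) G x)%E.
  rewrite [RHS]integral_mkcond; apply: eq_integral => x _.
  by rewrite patchE; case: ifPn => // /negP xC; apply: G0 => /mem_set.
apply: eq_measure_integral => A mA AC.
by rewrite /= /cube_restricted /mrestr (setIidl AC).
Qed.

Lemma mean_point_law (g : T -> R) c n : (n < b ^ m)%N -> measurable_fun setT g ->
  (forall x, `|g x| <= c) ->
  mean P (fun w => g (X n w)) = fine (\int[cube_restricted]_x (g x)%:E)%E.
Proof.
move=> nm mg gc; rewrite /mean /Rintegral.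
rewrite (@integral_point_law (EFin \o g) n nm)//.
  exact/measurable_EFinP.
exact: (bounded_rv_integrable P (bounded_rv_point n mg gc)).
Qed.

(** The digits approximate [g] in [L1]; as everything is bounded by [c], the
    two sides of the inequality move by at most a multiple of the error. *)
Lemma net_average_second_moment (C c : R) (g : T -> R) :
  (forall Q : pred 'I_s,
     \prod_(j | Q j) (b%:R ^+ gns_deg S j / (b%:R ^+ gns_deg S j - 1)) <= C) ->
  measurable_fun setT g -> 0 < c -> (forall x, `|g x| <= c) ->
  mean P (fun w => net_average g w ^+ 2) <=
  mean P (fun w => g (X 0%N w)) ^+ 2 +
  C / b%:R ^+ m * mean P (fun w => g (X 0%N w) ^+ 2).
Proof.
move=> CP mg c0 gc; have m0 : (0 < b ^ m)%N by rewrite expn_gt0 prime_gt0.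
have bm0 : 0 < b%:R ^+ m :> R by rewrite exprn_gt0// ltr0n prime_gt0.
have B0 : 0 <= C / b%:R ^+ m.
  by rewrite divr_ge0 ?(ltW bm0)// (le_trans _ (CP pred0)) ?big_pred0_eq.
set B := C / b%:R ^+ m in B0 *.
apply/ler_addgt0Pr => e e0.
pose eta := e / (4 * c + 2 * c * B).
have den0 : 0 < 4 * c + 2 * c * B.
  by rewrite ltr_wpDr ?mulr_gt0// mulr_ge0// mulr_ge0// ltW.
have eta0 : 0 < eta by rewrite divr_gt0.
have [K [h [hc gh]]] := L1_digit_approximation mg c0 gc eta0.
have bY n := bounded_rv_point n mg gc.
have bH n : (n < b ^ m)%N -> bounded_rv (fun w => h (Z n K w)).
  exact: bounded_rv_digits.
pose avgH w := (b%:R ^+ m)^-1 * \sum_(n < (b ^ m)%N) h (Z n K w).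
have bavgY : bounded_rv (net_average g).
  by apply: bounded_rvZ; apply: bounded_rv_sum => n; exact: bY.
have bavgH : bounded_rv avgH.
  by apply: bounded_rvZ; apply: bounded_rv_sum => n; exact: bH.
have avg_le (u : 'I_(b ^ m) -> R) (a : R) : (forall n, u n <= a) ->
    (b%:R ^+ m)^-1 * \sum_(n < (b ^ m)%N) u n <= a.
  move=> ua; rewrite ler_pdivrMl//; apply: le_trans (ler_sum _ (fun n _ => ua n)) _.
  by rewrite sumr_const card_ord -[leLHS]mulr_natl natrX.
have avg_norm (u : 'I_(b ^ m) -> R) (a : R) : (forall n, `|u n| <= a) ->
    `|(b%:R ^+ m)^-1 * \sum_(n < (b ^ m)%N) u n| <= a.
  move=> ua; rewrite normrM gtr0_norm ?invr_gt0//.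
  apply: le_trans (avg_le _ _ ua); rewrite ler_pM2l ?invr_gt0//.
  exact: ler_norm_sum.
have dY0 := gh 0%N m0.
have davg : mean P (fun w => `|net_average g w - avgH w|) <= eta.
  pose dn (n : 'I_(b ^ m)) w := `|g (X n w) - h (Z n K w)|.
  have bdn n : bounded_rv (dn n).
    by apply: bounded_rv_abs; apply: bounded_rvB; [exact: bY|exact: bH].
  apply: (@le_trans _ _ (mean P (fun w =>
      (b%:R ^+ m)^-1 * \sum_(n < (b ^ m)%N) dn n w))).
    apply: le_mean.
    - by apply: bounded_rv_abs; exact: bounded_rvB.
    - by apply: bounded_rvZ; exact: bounded_rv_sum.
    move=> w; rewrite /net_average /avgH -mulrBr -sumrB normrM gtr0_norm ?invr_gt0//.
    by rewrite ler_pM2l ?invr_gt0//; exact: ler_norm_sum.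
  rewrite meanZ; last exact: bounded_rv_sum.
  rewrite mean_sum//; apply: avg_le => n; exact: gh.
have h1 := mean_sqr_le P bavgY bavgH (fun w => avg_norm _ _ (fun n => gc (X n w)))
  (fun w => avg_norm _ _ (fun n => hc (Z n K w))).
have h2 := mean_sqr_le P (bH _ m0) (bY 0%N) (fun w => hc (Z 0%N K w)) (fun w => gc (X 0%N w)).
have dY0' : mean P (fun w => `|h (Z 0%N K w) - g (X 0%N w)|) <= eta.
  by apply: le_trans dY0; rewrite le_eqVlt; apply/orP; left; apply/eqP; congr mean;
    apply/funext => w; rewrite distrC.
have h3 := digit_average_second_moment h CP.
have h4 : mean P (fun w => h (Z 0%N K w)) ^+ 2 <=
    mean P (fun w => g (X 0%N w)) ^+ 2 + 2 * c * eta.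
  have nI : `|mean P (fun w => g (X 0%N w))| <= c.
    apply: le_trans (le_norm_mean P (bY 0%N)) _; rewrite -[leRHS](mean_cst P c).
    by apply: le_mean => //; [exact: bounded_rv_abs|exact: bounded_rv_cst].
  have nI' : `|mean P (fun w => h (Z 0%N K w))| <= c.
    apply: le_trans (le_norm_mean P (bH _ m0)) _; rewrite -[leRHS](mean_cst P c).
    by apply: le_mean => //; [apply: bounded_rv_abs; exact: bH|exact: bounded_rv_cst].
  have nd : `|mean P (fun w => h (Z 0%N K w)) - mean P (fun w => g (X 0%N w))| <= eta.
    rewrite -meanB//; last exact: bH.
    by apply: le_trans dY0'; apply: le_norm_mean; apply: bounded_rvB => //; exact: bH.
  apply: le_trans (sqr_diff_le nI' nI) _.
  by rewrite lerD2l ler_pM2l// mulr_gt0.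
have h5 : mean P (fun w => h (Z 0%N K w) ^+ 2) <=
    mean P (fun w => g (X 0%N w) ^+ 2) + 2 * c * eta.
  by apply: le_trans h2 _; rewrite lerD2l ler_pM2l// mulr_gt0.
apply: le_trans h1 _; apply: (@le_trans _ _ (mean P (fun w => avgH w ^+ 2) + 2 * c * eta)).
  by rewrite lerD2l ler_pM2l// mulr_gt0.
apply: le_trans (lerD h3 (lexx _)) _.
have h6 : C / b%:R ^+ m * mean P (fun w => h (Z 0%N K w) ^+ 2) <=
    B * (mean P (fun w => g (X 0%N w) ^+ 2) + 2 * c * eta) by rewrite ler_wpM2l.
apply: le_trans (lerD (lerD h4 h6) (lexx _)) _.
have -> : e = (4 * c + 2 * c * B) * eta by rewrite mulrC divfK// gt_eqF.
by rewrite le_eqVlt; apply/orP; left; apply/eqP; ring.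
Qed.

End Variance.

(** * A single estimate for an integrand in Lp *)

Section PowerBounds.
Variables (R : realType) (p t y : R).
Hypotheses (p12 : 1 < p < 2) (t0 : 0 < t) (y0 : 0 <= y).

Lemma tail_le_powR : t < y -> y <= y `^ p * t `^ (1 - p).
Proof.
have /andP[p1 p2] := p12 => ty.
have p0 : 0 < p by lra.
rewrite -(mulr_powRB1 y0 p0) -mulrA ler_peMr//.
rewrite -[1 - p]opprB powRN ler_pdivlMr ?powR_gt0// mul1r.
by apply: ge0_ler_powR;
  [lra|rewrite nnegrE ltW|rewrite nnegrE|exact: ltW].
Qed.

Lemma sqr_le_powR : y <= t -> y ^+ 2 <= y `^ p * t `^ (2 - p).
Proof.
have /andP[p1 p2] := p12 => yt.
have [->|yn0] := eqVneq y 0.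
  by rewrite expr0n /= mulr_ge0// powR_ge0.
have -> : y ^+ 2 = y `^ p * y `^ (2 - p).
  by rewrite -powRD ?yn0 ?implybT// addrC subrK -powR_mulrn.
rewrite ler_wpM2l ?powR_ge0//; by apply: ge0_ler_powR; [lra|rewrite nnegrE|rewrite nnegrE ltW|].
Qed.

Lemma threshold_le_powR : t < y -> t `^ p <= y `^ p.
Proof.
have /andP[p1 p2] := p12 => ty.
by apply: ge0_ler_powR;
  [lra|rewrite nnegrE ltW|rewrite nnegrE|exact: ltW].
Qed.

Lemma le_1powR : y <= 1 + y `^ p.
Proof.
have /andP[p1 p2] := p12; have [y1|y1] := leP y 1.
  by rewrite (le_trans y1)// lerDl powR_ge0.
by rewrite (le_trans (le1r_powR (ltW y1) (ltW p1)))// lerDr.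
Qed.

End PowerBounds.

Lemma measurable_estimator d (Om : measurableType d) (R : realType) (b s : nat)
    (S : GNS b s) (D : 'I_s -> nat -> Om -> 'F_b)
    (M : 'I_s -> nat -> nat -> Om -> 'F_b) m
    (f : s.-tuple (measurableTypeR R) -> R) :
  prime b -> (forall j k, finite_rv (D j k)) ->
  (forall j k l, finite_rv (M j k l)) -> measurable_fun setT (cube_fun f) ->
  measurable_fun setT (estimator S D M m f).
Proof.
move=> pb mD mM mf; apply: measurable_funM => //.
apply: measurable_sum => n; apply: measurableT_comp => //.
exact: (@measurable_scrambled_point _ _ R _ _ S pb _ _ mD mM n).
Qed.

Lemma measurable_deviation d (Om : measurableType d) (R : realType)
    (Z : Om -> R) (e I : R) : measurable_fun setT Z ->
  measurable [set w | e < `|Z w - I|].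
Proof.
move=> mZ.
apply: measurable_superlevel.
by apply: measurableT_comp => //; exact: measurable_funB.
Qed.

Section SingleEstimate.
Context d (Om : measurableType d) (R : realType) (P : probability Om R).
Variables (b s : nat) (S : GNS b s).
Hypothesis pb : prime b.
Variables (D : 'I_s -> nat -> Om -> 'F_b) (M : 'I_s -> nat -> nat -> Om -> 'F_b).
Hypothesis cs : coarse_scrambling P (gns_deg S) D M.
Variables (m : nat) (p : R) (f : s.-tuple (measurableTypeR R) -> R).
Hypothesis p12 : 1 < p < 2.
Hypothesis fLp : Lp_cube p f.
Local Notation X := (scrambled_point R S D M).
Local Notation T := (s.-tuple (measurableTypeR R)).
Local Notation G := (cube_fun f).
Local Notation Y n := (fun w => G (X n w)).

Let p0 : 0 < p. Proof. by have /andP[/ltW/(lt_le_trans ltr01)] := p12. Qed.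

Lemma cube_fun_off (x : T) : ~ open_cube R s x -> G x = 0.
Proof. by move=> xC; rewrite /cube_fun patchE; case: ifPn => // /set_mem. Qed.

Lemma measurable_cube_fun : measurable_fun setT G.
Proof. by move: fLp; rewrite /Lp_cube inE => /andP[/[!inE]]. Qed.

Lemma measurable_estimator_error (e I : R) :
  measurable [set w | e < `|estimator S D M m f w - I|].
Proof.
apply: measurable_deviation.
exact: (@measurable_estimator _ _ _ _ _ S D M m f pb
  (finite_rv_shift cs) (finite_rv_matrix cs) measurable_cube_fun).
Qed.

Lemma measurable_cube_fun_point n : measurable_fun setT (Y n).
Proof.
by apply: measurableT_comp; [exact: measurable_cube_fun|
  exact: (measurable_scrambled pb cs)].
Qed.

Lemma integral_powR_point n : (n < b ^ m)%N ->
  (\int[P]_w (`|G (X n w)| `^ p)%:E)%E = (norm_cube p f `^ p)%:E.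
Proof.
move=> nm.
have mpow : measurable_fun setT (fun x : T => (`|G x| `^ p)%:E).
  apply/measurable_EFinP; apply: (measurableT_comp (measurable_powR p)).
  by apply: measurableT_comp => //; exact: measurable_cube_fun.
rewrite (ge0_integral_point_law pb cs nm mpow); last first.
  by move=> x; rewrite lee_fin powR_ge0.
have off (x : T) : ~ open_cube R s x -> (`|G x| `^ p)%:E = 0%E.
  by move=> xC; rewrite cube_fun_off// normr0 powR0// gt_eqF.
rewrite integral_cube_restricted// integral_mkcond.
transitivity (\int[lebesgue_tuple R s]_x (`| (EFin \o G) x | `^ p))%E.
  apply: eq_integral => x _; rewrite patchE; case: ifPn => // /negP xC.
  apply/esym; rewrite -[LHS]/((`|G x| `^ p)%:E).
  by apply: off; apply: contra_not xC; exact: mem_set.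
rewrite -poweR_Lnorm ?gt_eqF// /norm_cube.
have fin : Lnorm (lebesgue_tuple R s) p%:E (EFin \o G) \is a fin_num.
  move: fLp; rewrite /Lp_cube inE => /andP[_ /[!inE] /= fin].
  by rewrite ge0_fin_numE// Lnorm_ge0.
by rewrite -[in LHS](fineK fin).
Qed.

Lemma integrable_powR_point n : (n < b ^ m)%N ->
  P.-integrable setT (EFin \o (fun w => `|G (X n w)| `^ p)).
Proof.
move=> nm; apply/integrableP; split.
  apply/measurable_EFinP; apply: (measurableT_comp (measurable_powR p)).
  by apply: measurableT_comp => //; exact: measurable_cube_fun_point.
under eq_integral do rewrite /= ger0_norm ?powR_ge0//.
by rewrite integral_powR_point// ltry.
Qed.

Lemma integrable_point n : (n < b ^ m)%N -> P.-integrable setT (EFin \o Y n).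
Proof.
move=> nm.
have i1 : P.-integrable setT (EFin \o (fun w => 1 + `|G (X n w)| `^ p)).
  have := integrableD measurableT
    (bounded_rv_integrable P (bounded_rv_cst Om 1)) (integrable_powR_point nm).
  by [].
apply: le_integrable i1 => //.
  by apply/measurable_EFinP; exact: measurable_cube_fun_point.
move=> w _; rewrite /= lee_fin [leRHS]ger0_norm ?addr_ge0 ?powR_ge0//.
exact: le_1powR.
Qed.

Lemma integral_cubeE : integral_cube f = \int[P]_w G (X 0%N w).
Proof.
have m0 : (0 < b ^ m)%N by rewrite expn_gt0 prime_gt0.
rewrite /integral_cube /Rintegral; congr fine.
rewrite (@integral_point_law _ _ _ _ _ _ _ pb _ _ cs m (EFin \o G) 0%N m0).
- rewrite integral_cube_restricted => [|x xC]; last by rewrite /= cube_fun_off.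
  by apply: eq_integral => x xC; rewrite /= /cube_fun patchE xC.
- by apply/measurable_EFinP; exact: measurable_cube_fun.
- exact: integrable_point.
Qed.

Section Truncation.
Variables (t v : R).
Hypothesis t0 : 0 < t.
(** By Markov's inequality, [v] bounds the probability that a given point
    exceeds the level [t]. *)
Hypothesis norm_le : norm_cube p f `^ p <= v * t `^ p.

Definition truncated (x : T) : R := G x * \1_[set x | `|G x| <= t] x.

Let mA : measurable [set x : T | `|G x| <= t].
Proof.
rewrite (_ : [set x | _] = setT `&` (Num.norm \o G) @^-1` `]-oo, t]%classic).
  by apply: (measurableT_comp _ measurable_cube_fun) => //; exact: measurable_itv.
by rewrite setTI; apply/seteqP; split => x; rewrite /= in_itv.
Qed.

Lemma measurable_truncated : measurable_fun setT truncated.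
Proof. by apply: measurable_funM; [exact: measurable_cube_fun|exact: measurable_indic]. Qed.

Lemma truncatedE x : truncated x = if `|G x| <= t then G x else 0.
Proof.
rewrite /truncated indicE; case: ifPn => h.
  by rewrite mem_set// mulr1.
by rewrite memNset ?mulr0//; exact/negP.
Qed.

Lemma truncated_le x : `|truncated x| <= t.
Proof. by rewrite truncatedE; case: ifPn => // _; rewrite normr0 ltW. Qed.

Lemma measurable_exceed n : measurable [set w | t < `|G (X n w)|].
Proof.
apply: measurable_superlevel.
by apply: measurableT_comp => //; exact: measurable_cube_fun_point.
Qed.

Lemma pr_exceed_le n : (n < b ^ m)%N -> pr P [set w | t < `|G (X n w)|] <= v.
Proof.
move=> nm; have tp0 : 0 < t `^ p by rewrite powR_gt0.
have mE : measurable [set w | t < `|G (X n w)|] by exact: measurable_exceed.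
rewrite -(ler_pM2r tp0); apply: le_trans norm_le.
have -> : norm_cube p f `^ p = \int[P]_w (`|G (X n w)| `^ p).
  by rewrite /Rintegral integral_powR_point.
rewrite mulrC -(mean_indic P mE) -meanZ; last exact: bounded_rv_indic.
apply: le_Rintegral => //.
- by apply: bounded_rv_integrable; apply: bounded_rvZ; exact: bounded_rv_indic.
- exact: integrable_powR_point.
move=> w _; rewrite indicE; have [/set_mem h|_] := boolP (_ \in _).
  by rewrite mulr1; apply: threshold_le_powR.
by rewrite mulr0 powR_ge0.
Qed.

Let bt n := bounded_rv_point pb cs n measurable_truncated truncated_le.

Lemma truncation_bias : `|mean P (fun w => truncated (X 0%N w)) - integral_cube f| <= v * t.
Proof.
have m0 : (0 < b ^ m)%N by rewrite expn_gt0 prime_gt0.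
have idiff : P.-integrable setT (EFin \o
    (fun w => truncated (X 0%N w) - G (X 0%N w))).
  have := integrableB measurableT (bounded_rv_integrable P (bt 0%N))
    (integrable_point m0).
  by [].
have ipow : P.-integrable setT (EFin \o
    (fun w => t `^ (1 - p) * `|G (X 0%N w)| `^ p)).
  have := integrableZl measurableT (t `^ (1 - p)) (integrable_powR_point m0).
  by [].
rewrite integral_cubeE /mean -RintegralB//; last 2 first.
- exact: (bounded_rv_integrable P (bt 0%N)).
- exact: integrable_point.
apply: le_trans (le_normr_Rintegral _ idiff) _ => //.
apply: (@le_trans _ _ (\int[P]_w (t `^ (1 - p) * `|G (X 0%N w)| `^ p))).
  apply: le_Rintegral => //.
    by have := integrable_norm idiff.
  move=> w _; rewrite truncatedE; case: ifPn => h.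
    by rewrite subrr normr0 mulr_ge0// powR_ge0.
  by rewrite sub0r normrN mulrC; apply: tail_le_powR => //; rewrite ltNge.
rewrite RintegralZl//; last exact: integrable_powR_point.
rewrite [X in _ * X](_ : _ = norm_cube p f `^ p); last first.
  by rewrite /Rintegral integral_powR_point.
apply: le_trans (ler_wpM2l (powR_ge0 _ _) norm_le) _.
rewrite mulrCA -powRD ?(gt_eqF t0) ?implybT// subrK powRr1//.
exact: ltW.
Qed.

Lemma truncation_second_moment :
  mean P (fun w => truncated (X 0%N w) ^+ 2) <= v * t ^+ 2.
Proof.
have m0 : (0 < b ^ m)%N by rewrite expn_gt0 prime_gt0.
have ipow : P.-integrable setT (EFin \o
    (fun w => t `^ (2 - p) * `|G (X 0%N w)| `^ p)).
  have := integrableZl measurableT (t `^ (2 - p)) (integrable_powR_point m0).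
  by [].
apply: (@le_trans _ _ (\int[P]_w (t `^ (2 - p) * `|G (X 0%N w)| `^ p))).
  apply: le_Rintegral => //.
    by apply: bounded_rv_integrable; exact: bounded_rvM.
  move=> w _; rewrite truncatedE; case: ifPn => h.
    by rewrite -real_normK ?num_real// mulrC; apply: sqr_le_powR.
  by rewrite expr0n /= mulr_ge0// powR_ge0.
rewrite RintegralZl//; last exact: integrable_powR_point.
rewrite [X in _ * X](_ : _ = norm_cube p f `^ p); last first.
  by rewrite /Rintegral integral_powR_point.
apply: le_trans (ler_wpM2l (powR_ge0 _ _) norm_le) _.
rewrite mulrCA -powRD ?(gt_eqF t0) ?implybT// subrK -powR_mulrn//.
exact: ltW.
Qed.

Variable C : R.
Hypothesis CP : forall Q : pred 'I_s,
  \prod_(j | Q j) (b%:R ^+ gns_deg S j / (b%:R ^+ gns_deg S j - 1)) <= C.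

Let C1 : 1 <= C. Proof. by have := CP pred0; rewrite big_pred0_eq. Qed.
Let bm0 : 0 < b%:R ^+ m :> R. Proof. by rewrite exprn_gt0// ltr0n prime_gt0. Qed.

Local Notation avg := (net_average S D M m truncated).

Let bavg : bounded_rv avg.
Proof. by apply: bounded_rvZ; apply: bounded_rv_sum => n; exact: bt. Qed.

(** The variance is the second moment minus the squared mean, and all points of
    the net share the mean. *)
Lemma truncation_variance :
  mean P (fun w => (avg w - mean P (fun w => truncated (X 0%N w))) ^+ 2) <=
  C / b%:R ^+ m * (v * t ^+ 2).
Proof.
have m0 : (0 < b ^ m)%N by rewrite expn_gt0 prime_gt0.
set I := mean P (fun w => truncated (X 0%N w)).
have mavg : mean P avg = I.
  rewrite /net_average meanZ; last by apply: bounded_rv_sum => n; exact: bt.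
  rewrite mean_sum => [|n]; last exact: bt.
  rewrite (eq_bigr (fun=> I)) => [|n _]; last first.
    rewrite (mean_point_law pb cs (ltn_ord n) measurable_truncated truncated_le).
    by rewrite /I (mean_point_law pb cs m0 measurable_truncated truncated_le).
  by rewrite sumr_const card_ord -[X in _ * X]mulr_natl natrX mulKf// gt_eqF.
have -> : (fun w => (avg w - I) ^+ 2) = (fun w => avg w * avg w + (- (2 * I) * avg w + I ^+ 2)).
  by apply/funext => w; ring.
have b1 : bounded_rv (fun w => - (2 * I) * avg w) by exact: bounded_rvZ.
rewrite meanD; [|exact: bounded_rvM|by apply: bounded_rvD => //; exact: bounded_rv_cst].
rewrite meanD//; last exact: bounded_rv_cst.
rewrite meanZ// mean_cst mavg.
have h := net_average_second_moment pb cs m CP measurable_truncated t0 truncated_le.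
have h2 : C / b%:R ^+ m * mean P (fun w => truncated (X 0%N w) ^+ 2) <=
    C / b%:R ^+ m * (v * t ^+ 2).
  rewrite ler_wpM2l ?truncation_second_moment// divr_ge0 ?(ltW bm0)//.
  by rewrite (le_trans ler01).
have {h} := le_trans h (lerD (lexx _) h2); rewrite -/I.
rewrite (_ : (fun w => avg w ^+ 2) = fun w => avg w * avg w); last first.
  by apply/funext => w; rewrite expr2.
move: (mean _ _) (C / _ * _) => x y h.
have -> : x + (- (2 * I) * I + I ^+ 2) = x - I ^+ 2 by ring.
by rewrite lerBlDl.
Qed.

(** Outside of the event that some point exceeds the level, and of the event that
    Chebyshev's inequality controls, the error is at most the deviation of the
    net average from its mean plus the bias. *)
Lemma truncated_estimate (dl : R) : 0 < dl -> v = dl / b%:R ^+ m ->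
  pr P [set w | (dl + Num.sqrt C) * (t / b%:R ^+ m) <
    `|estimator S D M m f w - integral_cube f|] <= 2 * dl.
Proof.
move=> dl0 vE; set A := t / b%:R ^+ m.
have A0 : 0 < A by rewrite divr_gt0.
have C0 : 0 < C by rewrite (lt_le_trans ltr01).
set I := mean P (fun w => truncated (X 0%N w)).
pose E n := [set w | t < `|G (X n w)|].
pose F := [set w | C * A ^+ 2 <= (avg w - I) ^+ 2].
have mE n : measurable (E n) by exact: measurable_exceed.
have bdev : bounded_rv (fun w => (avg w - I) ^+ 2).
  have bd : bounded_rv (fun w => avg w - I).
    by apply: bounded_rvB => //; exact: bounded_rv_cst.
  exact: bounded_rvM.
have mF : measurable F.
  by have [mdev _] := bdev; exact: measurable_weak_superlevel.
have prF : pr P F <= dl.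
  have CA0 : 0 < C * A ^+ 2 by rewrite mulr_gt0// exprn_gt0.
  rewrite -(ler_pM2l CA0); apply: le_trans (markov_mean P bdev _ CA0) _.
    by move=> w; exact: sqr_ge0.
  apply: le_trans truncation_variance _; rewrite vE /A expr_div_n.
  rewrite le_eqVlt; apply/orP; left; apply/eqP.
  by rewrite [(b%:R ^+ m) ^+ 2]expr2 invfM; ring.
have mU : measurable (\big[setU/set0]_(n < (b ^ m)%N) E n).
  by apply: bigsetU_measurable => n _; exact: mE.
have prU : pr P (\big[setU/set0]_(n < (b ^ m)%N) E n) <= dl.
  apply: (@le_trans _ _ (\sum_(n < (b ^ m)%N) v)).
    suff h k : (k <= b ^ m)%N -> pr P (\big[setU/set0]_(n < k) E n) <= \sum_(n < k) v.
      exact: h.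
    elim: k => [|k IH] km; first by rewrite !big_ord0 pr0.
    rewrite !big_ord_recr /=.
    apply: le_trans (prU_le P _ (mE k)) _.
      by apply: bigsetU_measurable => n _; exact: mE.
    by apply: lerD; [exact: IH (ltnW km)|exact: pr_exceed_le].
  by rewrite sumr_const card_ord -mulr_natl natrX vE mulrC divfK// gt_eqF.
rewrite mulr_natl mulr2n; apply: le_trans (lerD prU prF).
apply: le_trans (prU_le P mU mF); apply: le_pr.
- apply: measurable_estimator_error.
- exact: measurableU.
move=> w /= far; apply: contrapT => /not_orP[nE nF].
have avgE : estimator S D M m f w = avg w.
  rewrite /estimator /net_average big_mkord; congr (_ * _).
  apply: eq_bigr => n _; rewrite truncatedE; case: ifPn => // h.
  exfalso; apply: nE; rewrite -bigcup_mkord; exists (val n) => //=.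
  by rewrite /E /= ltNge.
have dev : `|avg w - I| <= Num.sqrt C * A.
  have : (avg w - I) ^+ 2 <= (Num.sqrt C * A) ^+ 2.
    by rewrite exprMn sqr_sqrtr ?(ltW C0)// leNgt; apply/negP => h; apply: nF; exact: ltW.
  rewrite -real_normK ?num_real// ler_pXn2r// nnegrE//.
  by rewrite mulr_ge0 ?sqrtr_ge0 ?ltW.
have bias : `|I - integral_cube f| <= dl * A.
  by apply: le_trans truncation_bias _; rewrite vE /A mulrAC mulrA.
move: far; rewrite avgE ltNge => /negP; apply.
rewrite (_ : avg w - _ = (avg w - I) + (I - integral_cube f)); last by ring.
by apply: le_trans (ler_normD _ _) _; rewrite mulrDl addrC lerD.
Qed.

End Truncation.

(** The truncation level is positive only for a positive norm. So the norm is
    first replaced by larger positive numbers [N'], which then decrease to it. *)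
Lemma single_estimate (C dl : R) :
  (forall Q : pred 'I_s,
    \prod_(j | Q j) (b%:R ^+ gns_deg S j / (b%:R ^+ gns_deg S j - 1)) <= C) ->
  0 < dl ->
  pr P [set w | (dl + Num.sqrt C) * dl `^ (- (1 / p)) * norm_cube p f *
      b%:R `^ (- (m%:R * (1 - 1 / p))) <
    `|estimator S D M m f w - integral_cube f|] <= 2 * dl.
Proof.
move=> CP dl0.
have bm0 : 0 < b%:R ^+ m :> R by rewrite exprn_gt0// ltr0n prime_gt0.
have b0 : 0 < b%:R :> R by rewrite ltr0n prime_gt0.
have N0 : 0 <= norm_cube p f by rewrite fine_ge0// Lnorm_ge0.
set k := (dl + Num.sqrt C) * dl `^ (- (1 / p)) * b%:R `^ (- (m%:R * (1 - 1 / p))).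
have k0 : 0 <= k.
  by rewrite !mulr_ge0 ?powR_ge0// addr_ge0 ?sqrtr_ge0// ltW.
have above N' : norm_cube p f <= N' -> 0 < N' ->
    pr P [set w | k * N' < `|estimator S D M m f w - integral_cube f|] <= 2 * dl.
  (* The level at which one point in [b ^ m] is exceeded with probability [dl]. *)
  move=> NN' N'0; pose t := N' * (b%:R ^+ m / dl) `^ p^-1.
  have bdl : 0 < b%:R ^+ m / dl by rewrite divr_gt0.
  have t0 : 0 < t by rewrite mulr_gt0// powR_gt0.
  have kE : k * N' = (dl + Num.sqrt C) * (t / b%:R ^+ m).
    rewrite /k /t -!mulrA; congr (_ * _).
    rewrite powRM ?invr_ge0 ?(ltW dl0) ?(ltW bm0)//.
    rewrite -[dl^-1]powR_inv1 ?(ltW dl0)// -powRrM mulN1r div1r.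
    rewrite -powR_mulrn ?(ltW b0)// -powRrM -powRN.
    rewrite [X in _ = N' * X]mulrAC -powRD ?(gt_eqF b0) ?implybT//.
    rewrite (_ : m%:R / p + - m%:R = - (m%:R * (1 - p^-1))); last by ring.
    by rewrite mulrCA [RHS]mulrCA; congr (_ * _); rewrite mulrC.
  rewrite kE; apply: (@truncated_estimate t (dl / b%:R ^+ m)) => //.
  rewrite /t powRM ?powR_ge0 ?(ltW N'0)// -powRrM mulVf ?gt_eqF// powRr1 ?(ltW bdl)//.
  rewrite mulrCA -[dl / _]invf_div mulVf ?gt_eqF// mulr1.
  by apply: ge0_ler_powR; rewrite ?nnegrE// ltW.
pose E n := [set w | k * (norm_cube p f + n.+1%:R^-1) <
  `|estimator S D M m f w - integral_cube f|].
have mE n : measurable (E n) by exact: measurable_estimator_error.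
have -> : [set w | (dl + Num.sqrt C) * dl `^ (- (1 / p)) * norm_cube p f *
      b%:R `^ (- (m%:R * (1 - 1 / p))) <
    `|estimator S D M m f w - integral_cube f|] = \bigcup_n E n.
  rewrite mulrAC -/k; apply/seteqP; split => w /=; last first.
    case=> n _; apply: le_lt_trans; rewrite ler_wpM2l// lerDl invr_ge0.
    by [].
  set x := `|_|; set y := k * _ => yx.
  have [n nP] : exists n : nat, k / (x - y) < n.+1%:R.
    by exists (Num.truncn (k / (x - y))); exact: truncnS_gt.
  exists n => //; rewrite /E /= -/x mulrDr -/y -ltrBrDl.
  by rewrite ltr_pdivrMr// mulrC -ltr_pdivrMr// subr_gt0.
have cE : P \o E @ \oo --> P (\bigcup_n E n).
  apply: nondecreasing_cvg_mu => //; first exact: bigcupT_measurable.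
  move=> i j ij; apply/subsetPset => w; rewrite /E /=; apply: le_lt_trans.
  rewrite ler_wpM2l// lerD2l lef_pV2 ?posrE ?ltr0n// ler_nat.
  by [].
rewrite -lee_fin -prE; last exact: bigcupT_measurable.
apply: (cvge_to_le cE); near=> n; rewrite /= prE// lee_fin; apply: above.
  by rewrite lerDl invr_ge0.
by rewrite ltr_wpDl// invr_gt0.
Unshelve. all: by end_near. Qed.

End SingleEstimate.

(** * Medians of independent estimates *)

Section Median.
Variable R : realType.
Implicit Types (xs : seq R) (t : R).

Lemma size_sort_median xs : odd (size xs) ->
  size (sort <=%R xs) = ((size xs)./2 + (size xs)./2).+1.
Proof. by move=> oxs; rewrite size_sort addnn -[LHS]odd_double_half oxs. Qed.

Lemma nth_sort_le xs i j : (i <= j)%N -> (j < size xs)%N ->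
  nth 0 (sort <=%R xs) i <= nth 0 (sort <=%R xs) j.
Proof.
move=> ij jxs; apply: (sorted_leq_nth le_trans le_refl) => //.
- exact: (sort_sorted (@le_total _ R)).
- by rewrite inE size_sort (leq_ltn_trans ij).
- by rewrite inE size_sort.
Qed.

(** The entries from the middle position of the sorted list onwards. *)
Lemma count_ge_median xs (Q : pred R) : odd (size xs) ->
  (forall x, median xs <= x -> Q x) -> ((size xs).+1./2 <= count Q xs)%N.
Proof.
move=> oxs QP; set q := (size xs)./2; have szE := size_sort_median oxs.
have sz2 : size xs = (q + q).+1 by rewrite -szE size_sort.
rewrite -(permP (permEl (perm_sort <=%R xs))) -(cat_take_drop q (sort _ _)).
rewrite count_cat; apply: leq_trans (leq_addl _ _).
have : all Q (drop q (sort <=%R xs)).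
  apply/(all_nthP 0) => i; rewrite size_drop szE nth_drop => iq.
  by apply: QP; apply: nth_sort_le; rewrite ?leq_addr// sz2; lia.
rewrite all_count => /eqP ->; by rewrite size_drop szE sz2 addnn -doubleS doubleK -addnn; lia.
Qed.

Lemma count_le_median xs (Q : pred R) : odd (size xs) ->
  (forall x, x <= median xs -> Q x) -> ((size xs).+1./2 <= count Q xs)%N.
Proof.
move=> oxs QP; set q := (size xs)./2; have szE := size_sort_median oxs.
have sz2 : size xs = (q + q).+1 by rewrite -szE size_sort.
rewrite -(permP (permEl (perm_sort <=%R xs))) -(cat_take_drop q.+1 (sort _ _)).
rewrite count_cat; apply: leq_trans (leq_addr _ _).
have szt : size (take q.+1 (sort <=%R xs)) = q.+1.
  by rewrite size_takel// szE ltnS leq_addr.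
have : all Q (take q.+1 (sort <=%R xs)).
  apply/(all_nthP 0) => i; rewrite szt ltnS => iq; rewrite nth_take ?ltnS//.
  by apply: QP; apply: nth_sort_le => //; rewrite sz2; lia.
rewrite all_count => /eqP ->; by rewrite szt sz2 addnn -doubleS doubleK.
Qed.

Lemma lt_median_count xs t : odd (size xs) ->
  (t < median xs) = ((size xs).+1./2 <= count (fun x => (t < x)%R) xs)%N.
Proof.
move=> oxs; apply/idP/idP => [tm|].
  by apply: count_ge_median => // x; exact: lt_le_trans.
apply: contraTT; rewrite -leNgt -ltnNge => mt.
have h : ((size xs).+1./2 <= count (predC (fun x => (t < x)%R)) xs)%N.
  by apply: count_le_median => // x xm; rewrite /= -leNgt (le_trans xm).
have := count_predC (fun x => (t < x)%R) xs; move: h.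
have -> : size xs = (size xs)./2.*2.+1 by rewrite -[LHS]odd_double_half oxs.
by rewrite -doubleS doubleK -addnn; move: (count _ _) (count _ _) => c1 c2; lia.
Qed.

(** If the median lies beyond [I + e], so do all entries above it, and similarly
    below. *)
Lemma median_dist_count xs (e I : R) : odd (size xs) -> e < `|median xs - I| ->
  ((size xs).+1./2 <= count (fun x => (e < `|x - I|)%R) xs)%N.
Proof.
move=> oxs; rewrite ltr_normr => /orP[h|h].
  apply: count_ge_median => // x mx; rewrite ltr_normr; apply/orP; left.
  by apply: lt_le_trans h _; rewrite lerD2r.
apply: count_le_median => // x mx; rewrite ltr_normr; apply/orP; right.
by apply: lt_le_trans h _; rewrite lerN2 lerD2r.
Qed.

End Median.

Section MedianProbability.
Context d (Om : measurableType d) (R : realType) (P : probability Om R).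

(** The median exceeds [t] if and only if a majority of the values does. *)
Lemma measurable_median N (Z : 'I_N -> Om -> R) : odd N ->
  (forall r, measurable_fun setT (Z r)) ->
  measurable_fun setT (fun w => median [seq Z r w | r <- enum 'I_N]).
Proof.
move=> oN mZ; apply: (measurability _ (RGenOInfty.measurableE R)).
move=> _ [_ [t ->] <-]; rewrite setTI.
pose W w := [ffun r : 'I_N => (t < Z r w)%R].
have mW : finite_rv W.
  apply: finite_rv_ffun => r c.
  have mtZ : measurable [set w | t < Z r w].
    exact: measurable_superlevel.
  case: c; first by rewrite (_ : _ @^-1` _ = [set w | t < Z r w]).
  rewrite (_ : _ @^-1` _ = ~` [set w | t < Z r w]); first exact: measurableC.
  by apply/seteqP; split => w /=; [move=> ->|move=> /negP/negPf].
rewrite (_ : _ @^-1` _ = W @^-1` [set g : {ffun 'I_N -> bool} |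
    (N.+1./2 <= count g (enum 'I_N))%N]).
  exact: finite_rv_preimage.
have szN w : size [seq Z r w | r <- enum 'I_N] = N by rewrite size_map size_enum_ord.
have medE w : (t < median [seq Z r w | r <- enum 'I_N]) =
    (N.+1./2 <= count (W w) (enum 'I_N))%N.
  rewrite lt_median_count szN// count_map; congr (_ <= _)%N.
  by apply: eq_count => r; rewrite /= ffunE.
by apply/seteqP; split => w; rewrite /= in_itv /= andbT medE.
Qed.

Lemma measurable_majority N (A : 'I_N -> set Om) k :
  (forall r, measurable (A r)) ->
  measurable [set w | (k <= #|[set r | `[< A r w >]]%SET|)%N].
Proof.
move=> mA.
pose W w := [ffun r : 'I_N => `[< A r w >]].
have mW : finite_rv W.
  apply: finite_rv_ffun => r c; case: c.
    rewrite (_ : _ @^-1` _ = A r)//.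
    by apply/seteqP; split => w /=; [move=> /asboolP|move=> /asboolT].
  rewrite (_ : _ @^-1` _ = ~` A r); first exact: measurableC.
  by apply/seteqP; split => w /=; [move=> /asboolPn|move=> /asboolF].
rewrite (_ : [set w | _] = W @^-1` [set g : {ffun 'I_N -> bool} |
  (k <= #|[set r | g r]%SET|)%N]); first exact: finite_rv_preimage.
have WE w : [set r | `[< A r w >]]%SET = [set r | W w r]%SET.
  by apply/setP => r; rewrite !inE ffunE.
by apply/seteqP; split => w /=; rewrite WE.
Qed.

(** A union bound over the sets of [k] indices at which the event occurs; there
    are at most [2 ^ N] of them, and independence gives each probability
    [q ^ k] at most. *)
Lemma majority_pr_le N (G : 'I_N -> set (set Om)) (A : 'I_N -> set Om) (q : R) k :
  mutually_independent P G -> (forall r, G r (A r)) ->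
  (forall r, measurable (A r)) -> 0 <= q -> (forall r, pr P (A r) <= q) ->
  pr P [set w | (k <= #|[set r | `[< A r w >]]%SET|)%N] <= 2 ^+ N * q ^+ k.
Proof.
move=> indG GA mA q0 Aq.
pose B (J : {set 'I_N}) := [set w | forall r, r \in J -> A r w].
have BE J : B J = \big[setI/setT]_(r <- enum J) A r.
  rewrite -bigcap_seq; apply/seteqP; split => w h r; have := h r;
    by rewrite /= mem_enum.
have mB J : measurable (B J).
  by rewrite BE; apply: bigsetI_measurable => r _; exact: mA.
have prB J : pr P (B J) <= q ^+ #|J|.
  have -> : pr P (B J) = \prod_(r in J) pr P (A r).
    apply: EFin_inj; rewrite -prE// BE (indG _ _ (enum_uniq _))//.
    by rewrite -big_enum -prodEFin; apply: eq_bigr => r _; rewrite prE.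
  rewrite -prodr_const; apply: ler_prod => r _.
  by rewrite pr_ge0 Aq.
have mE := measurable_majority k mA.
have union_le (r : seq {set 'I_N}) :
    pr P (\big[setU/set0]_(J <- r) B J) <= \sum_(J <- r) pr P (B J).
  elim: r => [|J r IH]; first by rewrite !big_nil pr0.
  rewrite !big_cons; apply: le_trans (prU_le P (mB J) _) _.
    by apply: bigsetU_measurable => K _; exact: mB.
  by rewrite lerD2l.
pose r := enum [set J : {set 'I_N} | #|J| == k]%SET.
apply: (@le_trans _ _ (pr P (\big[setU/set0]_(J <- r) B J))).
  apply: le_pr => //; first by apply: bigsetU_measurable => K _; exact: mB.
  move=> w /= /card_geqP[t [ut tk tA]]; rewrite -bigcup_seq.
  exists [set x in t]%SET.
    rewrite /= mem_enum inE -tk; apply/eqP.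
    rewrite -(card_uniqP ut); apply: eq_card => x; rewrite inE.
    by [].
  by move=> x; rewrite inE => /tA; rewrite inE => /asboolP.
apply: le_trans (union_le r) _.
apply: (@le_trans _ _ (\sum_(J <- r) q ^+ k)).
  rewrite !big_enum /=; apply: ler_sum => J; rewrite inE => /eqP <-; exact: prB.
rewrite big_enum sumr_const -[leLHS]mulr_natl.
apply: ler_wpM2r; first exact: exprn_ge0.
rewrite -natrX ler_nat; apply: leq_trans (max_card _) _.
by rewrite -cardsT -powersetT card_powerset cardsT card_ord.
Qed.

End MedianProbability.

Section SubSigmaAlgebra.
Context d (Om : measurableType d) (R : realType).
Variables (b s : nat) (S : GNS b s).
Hypothesis pb : prime b.
Variables (D : 'I_s -> nat -> Om -> 'F_b) (M : 'I_s -> nat -> nat -> Om -> 'F_b).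
Variables (m : nat) (f : s.-tuple (measurableTypeR R) -> R).
Hypothesis mf : measurable_fun setT (cube_fun f).

(** Independence concerns the sigma-algebras generated by the scramblings, so the
    event must be measurable for one of these: measurability of the estimator is
    applied to the space that carries this sigma-algebra. *)
Lemma sigma_scrambling_error (e I : R) :
  sigma_scrambling D M [set w | e < `|estimator S D M m f w - I|].
Proof.
pose Om' := g_sigma_algebraType (\bigcup_j (sigma_shift D j `|` sigma_matrix M j)).
have mD j k : @finite_rv _ Om' _ (D j k).
  move=> t; apply: sub_sigma_algebra; exists j => //; left.
  exact: (@sigma_of_family_finite_rv _ _ _ _ (D j) k t).
have mM j k l : @finite_rv _ Om' _ (M j k l).
  move=> t; apply: sub_sigma_algebra; exists j => //; right.
  exact: (@sigma_of_family_finite_rv _ _ _ _ (fun kl : nat * nat => M j kl.1 kl.2) (k, l) t).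
exact: (measurable_deviation e I
  (@measurable_estimator _ Om' _ _ _ S D M m f pb mD mM mf)).
Qed.

End SubSigmaAlgebra.

(** * The error of the median *)

Theorem theorem3p6 (R : realType) (b s m N : nat) (p delta beta : R)
    (S : GNS b s)
    (d : measure_display) (Om : measurableType d) (P : probability Om R)
    (D : 'I_N -> 'I_s -> nat -> Om -> 'F_b)
    (M : 'I_N -> 'I_s -> nat -> nat -> Om -> 'F_b)
    (f : s.-tuple (measurableTypeR R) -> R) :
  prime b -> (0 < s)%N -> (0 < m)%N -> odd N ->
  1 < p < 2 -> 0 < delta < 1 / 8 -> 0 < beta ->
  reduced (fun n => ln n%:R `^ (1 + beta)) S ->
  (forall r, coarse_scrambling P (gns_deg S) (D r) (M r)) ->
  mutually_independent P (fun r : 'I_N => sigma_scrambling (D r) (M r)) ->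
  Lp_cube p f ->
  (P [set w | ((delta + Num.sqrt (C_const beta)) * delta `^ (- (1 / p)) *
                 norm_cube p f * b%:R `^ (- (m%:R * (1 - 1 / p))) <
               `|median_estimator S D M m f w - integral_cube f|)%R]
   <= (1 / 2 * (8 * delta) ^+ (N.+1)./2)%:E)%E.
Proof.
move=> pb s0 m0 oN p12 /andP[dl0 _] beta0 redS cs indep fLp.
set thr := (_ * _ * _ * _).
pose I := integral_cube f.
pose Z r := estimator S (D r) (M r) m f.
pose A r := [set w | thr < `|Z r w - I|].
pose k := (N.+1)./2.
have mG := measurable_cube_fun fLp.
have mZ r : measurable_fun setT (Z r).
  exact: (@measurable_estimator _ _ _ _ _ S (D r) (M r) m f pb
    (finite_rv_shift (cs r)) (finite_rv_matrix (cs r)) mG).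
have mA r : measurable (A r) by exact: measurable_deviation.
have prA r : pr P (A r) <= 2 * delta.
  apply: (single_estimate pb (cs r) m p12 fLp) => // Q.
  exact: (gns_constant_le pb Q beta0 redS).
have szN w : size [seq Z r w | r <- enum 'I_N] = N.
  by rewrite size_map size_enum_ord.
have mE : measurable [set w | thr < `|median_estimator S D M m f w - I|].
  exact: (measurable_deviation thr I (measurable_median oN mZ)).
rewrite prE// lee_fin.
have -> : 1 / 2 * (8 * delta) ^+ k = 2 ^+ N * (2 * delta) ^+ k.
  have NE : N = (N./2 + N./2).+1 by rewrite addnn -[LHS]odd_double_half oN.
  have kE : k = (N./2).+1 by rewrite /k [in LHS]NE addnn -doubleS doubleK.
  rewrite kE [X in _ = 2 ^+ X * _]NE (_ : 8 * delta = 2 * 2 * (2 * delta)); last by ring.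
  rewrite [LHS](_ : _ = 1 / 2 * (2 ^+ N./2.+1 * 2 ^+ N./2.+1 *
    (2 * delta) ^+ N./2.+1)); last by rewrite -!exprMn.
  rewrite [in RHS]exprS exprD ![2 ^+ _.+1]exprS.
  by move: (2 ^+ _) (_ ^+ _.+1) => x y; field.
have q0 : 0 <= 2 * delta by rewrite mulr_ge0// ltW.
have maj := majority_pr_le k indep
  (fun r => @sigma_scrambling_error _ _ _ _ _ S pb (D r) (M r) m f mG thr I) mA q0 prA.
apply: le_trans maj; apply: le_pr => //.
  exact: measurable_majority.
move=> w /= far.
have := @median_dist_count _ [seq Z r w | r <- enum 'I_N] thr I.
rewrite szN => /(_ oN far); rewrite count_map => h.
apply: leq_trans h _; rewrite -sum1_count -sum1_card big_enum_cond /=.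
apply: eq_leq; apply: eq_bigl => r; rewrite !inE.
by apply/idP/asboolP.
Qed.
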